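(* Let $a,b,c,d\in\mathbb{N}$ be such that $ab=cd$ and $a=\min(a,b,c,d)$. If $a$ divides either $c$ or $d$, then $$\begin{bmatrix}c+d\\ c\end{bmatrix}-\begin{bmatrix}a+b\\ a\end{bmatrix}$$ is a unimodal polynomial in $q$.
   Context: $\mathbb{N}$ is the set of positive integers, $\mathbb{N}_0=\mathbb{N}\cup\{0\}$. $\begin{bmatrix}n\\k\end{bmatrix}=\frac{[n][n-1]\cdots[n-k+1]}{[k][k-1]\cdots[1]}$ is the Gaussian ($q$-)binomial coefficient, a polynomial in $q$, where $[n]=1+q+\cdots+q^{n-1}$. A polynomial $a_0+a_1q+\cdots+a_nq^n\in\mathbb{N}_0[q]$ is unimodal if $a_0\le a_1\le\cdots\le a_k\ge\cdots\ge a_n$ for some $k$. *)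

(* Defs.v *)
From mathcomp Require Import all_boot all_order all_algebra.

Set Implicit Arguments.
Unset Strict Implicit.
Unset Printing Implicit Defensive.

Import Order.TTheory GRing.Theory Num.Theory.
Local Open Scope ring_scope.

Definition qint (n : nat) : {poly int} := \sum_(i < n) 'X^i.

(* The denominator is monic (for every k), so the pseudo-division [%/] over   *)
(* [int] is here the genuine Euclidean division, and it is exact.  For k > n  *)
(* the numerator contains the factor [qint 0 = 0], so the value is 0.         *)
Definition qbinom (n k : nat) : {poly int} :=
  (\prod_(i < k) qint (n - i)) %/ (\prod_(i < k) qint (k - i)).

(* Indices are not bounded by the degree: coefficients beyond it are 0, so,   *)
(* all coefficients being nonnegative, the extra inequalities hold trivially, *)
(* and the peak k of a nonzero polynomial cannot exceed its degree.  The zero *)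
(* polynomial is unimodal.                                                    *)
Definition unimodal (p : {poly int}) : Prop :=
  p \is a polyOver Num.nneg /\
  exists k : nat,
    (forall i : nat, (i < k)%N -> p`_i <= p`_i.+1) /\
    (forall i : nat, (k <= i)%N -> p`_i.+1 <= p`_i).

(* Main.v *)
Require Import Defs.
From HB Require Import structures.
From mathcomp Require Import all_boot all_order all_algebra all_fingroup all_field.
From mathcomp Require Import mpoly zify ring.
From Stdlib Require Import Classical_Prop.

Set Implicit Arguments.
Unset Strict Implicit.
Unset Printing Implicit Defensive.

Import Order.TTheory GRing.Theory Num.Theory.
Local Open Scope ring_scope.

(** Why the difference is unimodal.

    Up to exchanging c and d one has c = k a, b = k d and a <= d.  The
    coefficient of q^w in the Gaussian binomial [N+m, m] counts the monomials
    of degree m and weight w in variables of weights 0, ..., N.  So the two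
    polynomials count the monomials of degree k a in e_0, ..., e_d and those of
    degree a in E_0, ..., E_(k d).  The substitution rho that sends E_i to the
    coefficient of s^i in (e_0 + e_1 s + ... + e_d s^d)^k maps the second kind
    of polynomials to the first, respects weights, and commutes with the
    lowering operators of sl_2 ([rho_low]).  A lowering operator is onto below
    the middle weight ([lowering_onto]); when rho is injective, comparing the
    kernels of the two lowering operators therefore bounds the growth of the
    second sequence of dimensions by that of the first ([nmon_growth]).  Both
    sequences are palindromic about the same centre and start with 1, which
    gives nonnegativity and unimodality of the difference
    ([unimodal_of_growth]).

    It is enough that rho is injective in degree d, since one may multiply by
    powers of E_0.  Specialising the e_j to the coefficients of
    (X - x_1)...(X - x_d) sends E_a to the coefficient w_a of
    prod_i (X - x_i)^k.  The products of d of the w_a are as many as the orbits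
    of monomials of x_1, ..., x_d with exponents at most k d, so they are
    independent as soon as every symmetric linear form that kills them kills
    all monomials with exponents at most k d ([functional_vanishing],
    [independence]).

    This last statement is proved with the Dunkl operators D_i of parameter -k.
    They commute ([dunkl_comm]), so polynomials act by g |-> g(D), and the form
    <g, h> = constant term of g(D) h is symmetric ([cterm_opD_sym]).  On the
    kernel prod_(i,j) (z_j - x_i)^k, whose coefficients in z are the products
    of the w_a, power sums of the D_i in x act as power sums of the -D_j in z
    ([kernel_power]).  Hence a symmetric form eta that kills the products kills
    g(D) applied to the top monomial prod_i x_i^(k d), for every g
    ([eta_opD_top]).

    Finally, for every N >= k d there are forms q_1, ..., q_d of degree N + 1,
    given by explicit integrals, with D_j q_i = 0 for j <> i and no common zero
    but the origin ([dunkl_qpol], [qpol_zero]).  The q_i(D) annihilate, under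
    the constant term, all polynomials with exponents at most N.  As a complete
    intersection the quotient by (q_1, ..., q_d) has a one-dimensional socle
    ([socle_mix]), so g lies in (q_1, ..., q_d) as soon as g(D) is orthogonal
    to all r(D) prod_i x_i^N ([gorenstein], [dunkl_gorenstein]).  Letting N grow shows that
    <., .> is nondegenerate, so that eta is represented by some g; then N = k d
    shows that g lies in (q_1, ..., q_d), hence that eta vanishes
    ([dunkl_functional0]). *)

(** * Ideals and regular sequences of homogeneous polynomials *)

Section IdealSpan.
Variable A : comNzRingType.
Implicit Types (l : seq A) (g t : A).

(** The combination is unfolded along the list, one multiplier at a time,
    which is what inductions on the generators consume. *)
Fixpoint in_ideal l g : Prop :=
  if l is t :: l' then exists a, in_ideal l' (g - a * t) else g = 0.

Lemma in_idealD l g h : in_ideal l g -> in_ideal l h -> in_ideal l (g + h).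
Proof.
elim: l g h => [|t l IH] g h /=; first by move=> -> ->; rewrite addr0.
by move=> [a ga] [b hb]; exists (a + b); rewrite mulrDl opprD addrACA; exact: IH.
Qed.

Lemma in_ideal0 l : in_ideal l 0.
Proof. by elim: l => //= t l IH; exists 0; rewrite mul0r subr0. Qed.

Lemma in_idealM l r g : in_ideal l g -> in_ideal l (r * g).
Proof.
elim: l g => [|t l IH] g /=; first by move=> ->; rewrite mulr0.
by move=> [a ga]; exists (r * a); rewrite -mulrA -mulrBr; exact: IH.
Qed.

Lemma in_idealN l g : in_ideal l g -> in_ideal l (- g).
Proof. by move=> lg; rewrite -mulN1r; exact: in_idealM. Qed.

Lemma in_idealB l g h : in_ideal l g -> in_ideal l h -> in_ideal l (g - h).
Proof. by move=> lg lh; apply: in_idealD => //; exact: in_idealN. Qed.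

Lemma in_ideal_sum (I : Type) (r : seq I) (P : pred I) (f : I -> A) l :
  (forall i, P i -> in_ideal l (f i)) -> in_ideal l (\sum_(i <- r | P i) f i).
Proof. by move=> H; elim/big_ind: _ => //; [exact: in_ideal0 | exact: in_idealD]. Qed.

Lemma in_ideal_cons l t g : in_ideal l g -> in_ideal (t :: l) g.
Proof. by move=> lg; exists 0; rewrite mul0r subr0. Qed.

Lemma in_ideal_gen l t : t \in l -> in_ideal l t.
Proof.
elim: l => //= s l IH; rewrite inE => /orP[/eqP ->|/IH tl].
  by exists 1; rewrite mul1r subrr; exact: in_ideal0.
exact: (in_ideal_cons s tl).
Qed.

Lemma in_ideal_incl l1 l2 g :
  (forall t, t \in l1 -> in_ideal l2 t) -> in_ideal l1 g -> in_ideal l2 g.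
Proof.
elim: l1 g => [|t l IH] g /= l12; first by move=> ->; exact: in_ideal0.
move=> [a ga]; rewrite -(subrK (a * t) g); apply: in_idealD.
  by apply: IH => // s sl; apply: l12; rewrite inE sl orbT.
by apply: in_idealM; apply: l12; rewrite inE eqxx.
Qed.

Lemma in_ideal_eq_mem l1 l2 g : l1 =i l2 -> in_ideal l1 g -> in_ideal l2 g.
Proof. by move=> E; apply: in_ideal_incl => t; rewrite E; exact: in_ideal_gen. Qed.

End IdealSpan.

Section Homogeneous.
Variables (F : fieldType) (n : nat).
Local Notation S := {mpoly F[n]}.
Implicit Types (l : seq S) (g t : S).

(** Components of a product with a homogeneous factor come from a single
    component of the other factor; this makes homogeneous ideals graded. *)
Lemma pihomogM (d m : nat) a t : t \is m.-homog ->
  pihomog mdeg d (a * t) =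
  (if (m <= d)%N then pihomog mdeg (d - m) a else 0) * t.
Proof.
move=> tm.
have key e : pihomog mdeg d (pihomog mdeg e a * t) =
             if (e + m == d)%N then pihomog mdeg e a * t else 0.
  have H : pihomog mdeg e a * t \is (e + m).-homog.
    by apply: dhomogM => //; exact: pihomogP.
  have [<-|ne] := eqVneq (e + m)%N d; first exact: pihomog_dE.
  by rewrite (pihomog_ne0 ne H).
rewrite {1}(pihomog_partitionE (leqnn (mmeasure mdeg a))).
rewrite mulr_suml linear_sum /=.
rewrite (eq_bigr _ (fun (i : 'I_(msize a)) _ => key i)) -big_mkcond /=.
have out e : (msize a <= e)%N -> pihomog mdeg e a = 0.
  move=> le; rewrite (pihomog_partitionE (leqnn (mmeasure mdeg a))) linear_sum.
  rewrite big1 // => i _ /=; apply: (@pihomog_ne0 _ _ _ i).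
    by rewrite neq_ltn (leq_trans (ltn_ord i) le).
  exact: pihomogP.
case: leqP => [md|dm]; last first.
  rewrite mul0r big1 // => i /eqP E.
  by move: dm; rewrite -E ltnNge leq_addl.
have [lt|ge] := ltnP (d - m) (msize a).
  rewrite (big_pred1 (Ordinal lt)) // => i /=.
  by apply/eqP/eqP => [E|->] /=; [apply/val_inj => /= |]; lia.
rewrite out // mul0r big1 // => i /eqP E.
by move: (ltn_ord i) ge E; lia.
Qed.

Definition hompos t := exists2 m, (0 < m)%N & t \is m.-homog.
Definition homl l := forall t, t \in l -> hompos t.

Lemma homl_cons t l : homl (t :: l) -> hompos t /\ homl l.
Proof.
move=> H; split; first by apply: H; rewrite inE eqxx.
by move=> s sl; apply: H; rewrite inE sl orbT.
Qed.

Lemma in_ideal_pihomog l j g : homl l -> in_ideal l g -> in_ideal l (pihomog mdeg j g).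
Proof.
elim: l g => [|t l IH] g /=; first by move=> _ ->; rewrite linear0.
move=> /homl_cons[[m _ tm] hl] [a ga].
exists (if (m <= j)%N then pihomog mdeg (j - m) a else 0).
by rewrite -pihomogM // -linearB; exact: IH.
Qed.

(** The multiplier of a homogeneous generator can be taken homogeneous: pass
    to components of the right degree. The multiplier is 0 when the degrees do
    not allow a nonzero one. *)
Lemma in_ideal_homog m t l j g : homl l -> t \is m.-homog -> g \is j.-homog ->
  in_ideal (t :: l) g ->
  exists2 a, in_ideal l (g - a * t) &
    ((m <= j)%N /\ a \is (j - m).-homog) \/ a = 0.
Proof.
move=> hl tm gj [a ga].
exists (if (m <= j)%N then pihomog mdeg (j - m) a else 0).
  by rewrite -pihomogM // -{1}(pihomog_dE gj) -linearB; exact: in_ideal_pihomog.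
by case: leqP => _; [left; split=> //; exact: pihomogP | right].
Qed.

Lemma in_ideal_components l g : homl l ->
  (forall j, in_ideal l (pihomog mdeg j g)) -> in_ideal l g.
Proof.
move=> hl H; rewrite (pihomog_partitionE (leqnn (mmeasure mdeg g))).
exact: in_ideal_sum.
Qed.

(** Testing homogeneous elements only suffices, because all the ideals that
    occur are homogeneous, and it is what arguments by induction on the degree
    provide. *)
Definition nzd t l := forall j g, g \is j.-homog -> in_ideal l (t * g) -> in_ideal l g.

(** The last element of the list is the first one of the sequence, to match
    the recursion of the ideal. *)
Fixpoint regseq l : Prop := if l is t :: l' then nzd t l' /\ regseq l' else True.

(** For homogeneous elements of positive degree a regular sequence stays
    regular after a transposition. That a is a nonzerodivisor modulo the
    tail comes from Nakayama's argument: a g in the ideal of the tail forces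
    g = c b modulo the tail, with a c again in that ideal and c of smaller
    degree. *)
Lemma regseq_swap a b l : homl (a :: b :: l) -> regseq (a :: b :: l) ->
  regseq (b :: a :: l).
Proof.
move=> /homl_cons[[ma ma0 hma] /homl_cons[[mb mb0 hmb] hl]] [na [nb rl]].
have na' : nzd a l.
  move=> j; elim/ltn_ind: j => j IH g gj lag.
  have [c gc [[mbj cj]|c0]] := in_ideal_homog hl hmb gj (na _ _ gj (in_ideal_cons b lag));
    last by move: gc; rewrite c0 mul0r subr0.
  suff lc : in_ideal l c.
    rewrite -(subrK (c * b) g); apply: in_idealD => //.
    by rewrite mulrC; exact: in_idealM.
  apply: (IH (j - mb)%N) => //.
    by rewrite ltn_subrL mb0 (leq_trans mb0 mbj).
  apply: (nb (ma + (j - mb))%N); first exact: dhomogM.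
  have -> : b * (a * c) = a * g - a * (g - c * b) by ring.
  by apply: in_idealB => //; exact: in_idealM.
suff nb' : nzd b (a :: l) by [].
move=> j g gj [c lc0].
have hbg : b * g \is (mb + j).-homog by exact: dhomogM.
have [c' lc [[maj cj]|c0]] := in_ideal_homog hl hma hbg (ex_intro _ c lc0); last first.
  by move: lc; rewrite c0 mul0r subr0 => lc; apply: in_ideal_cons; exact: (nb j).
have [e le ej] : exists2 e, in_ideal l (c' - e * b) &
    ((mb <= mb + j - ma)%N /\ e \is (mb + j - ma - mb).-homog) \/ e = 0.
  apply: (in_ideal_homog hl hmb cj); suff: in_ideal (b :: l) c' by [].
  apply: (na _ _ cj); exists g.
  have -> : a * c' - g * b = - (b * g - c' * a) by ring.
  exact: in_idealN.
have lbg : in_ideal l (b * (g - e * a)).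
  have -> : b * (g - e * a) = (b * g - c' * a) + a * (c' - e * b)
    by ring.
  by apply: in_idealD => //; exact: in_idealM.
exists e; case: ej => [[mbj ej]|e0].
  apply: (nb j) => //; apply: dhomogD => //.
  rewrite dhomogN //.
  have -> : j = (mb + j - ma - mb + ma)%N by lia.
  exact: dhomogM.
by apply: (nb j) => //; rewrite e0 mul0r subr0.
Qed.

Lemma homl_mem l1 l2 : l1 =i l2 -> homl l1 -> homl l2.
Proof. by move=> E H t; rewrite -E; exact: H. Qed.

Lemma regseq_move t l1 l2 : homl (l1 ++ t :: l2) ->
  regseq (l1 ++ t :: l2) <-> regseq (t :: l1 ++ l2).
Proof.
elim: l1 => [|s l1 IH] //= H.
have hl : homl (l1 ++ t :: l2) by case: (homl_cons H).
have mem (x : S) : (x \in l1 ++ t :: l2) = (x \in t :: l1 ++ l2).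
  by rewrite !(mem_cat, inE) orbCA.
have sw : (forall g, in_ideal (l1 ++ t :: l2) g <-> in_ideal (t :: l1 ++ l2) g).
  by move=> g; split; apply: in_ideal_eq_mem => x; rewrite mem.
have nz : nzd s (l1 ++ t :: l2) <-> nzd s (t :: l1 ++ l2).
  by split=> N j g gj /sw lg; apply/sw; exact: (N j).
have hs : homl (s :: t :: l1 ++ l2).
  by apply: homl_mem H => x; rewrite !inE mem inE.
split.
  by move=> [N R]; apply: (@regseq_swap s t) => //=; split; [exact/nz | exact/IH].
move=> R; have [|N R'] := @regseq_swap t s _ _ R.
  by apply: homl_mem hs => x; rewrite !inE orbCA.
by split; [exact/nz | exact/IH].
Qed.

End Homogeneous.

(** * Projective zeros and regular sequences *)

Section VariableIdeals.
Variables (F : fieldType) (n : nat).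
Local Notation S := {mpoly F[n]}.
Implicit Types (l : seq S) (g t : S) (s : seq 'I_n).

Lemma in_ideal_X s g : in_ideal [seq 'X_i | i <- s] g <->
  forall m, m \in msupp g -> exists2 i, i \in s & m i != 0%N.
Proof.
split.
  elim: s g => [|i s IH] g /=; first by move=> ->; rewrite -mpolyC0 msupp0.
  move=> [a ga] m; rewrite -{1}(subrK (a * 'X_i) g).
  move/msuppD_le; rewrite mem_cat => /orP[/(IH _ ga)[j js mj]|].
    by exists j; rewrite // inE js orbT.
  move/msuppM_le/allpairsP => [[m1 m2] /= [_]].
  rewrite msuppX inE => /eqP -> ->; exists i; first by rewrite inE eqxx.
  by rewrite mnmDE mnm1E eqxx addn1.
move=> H; rewrite (mpolyE g) big_seq; apply: in_ideal_sum => m mg.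
have [i si mi] := H m mg; rewrite -mul_mpolyC; apply: in_idealM.
rewrite -(@submK _ U_(i)%MM m) ?lep1mP // mpolyXD; apply/in_idealM/in_ideal_gen.
exact: map_f.
Qed.

Lemma regseq_X s : uniq s -> regseq [seq ('X_i : S) | i <- s].
Proof.
elim: s => [|i s IH] //= /andP[si us]; split; last exact: IH.
move=> j g gj /in_ideal_X H; apply/in_ideal_X => m mg.
have [|k ks] := H (U_(i) + m)%MM.
  by rewrite mcoeff_msupp mulrC mcoeffMX -mcoeff_msupp.
rewrite mnmDE mnm1E; case: (i =P k) => [E|_] mk; last by exists k.
by move: si; rewrite E ks.
Qed.

(** Primary to the ideal of the origin: only the origin can be a common zero
    of such homogeneous generators. *)
Definition mprimary l := exists M, forall m, (M <= mdeg m)%N -> in_ideal l 'X_[m].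

Lemma mprimary_incl l1 l2 : (forall t, t \in l1 -> in_ideal l2 t) -> mprimary l1 -> mprimary l2.
Proof. by move=> H [M N]; exists M => m /N; exact: in_ideal_incl. Qed.

Lemma dhomog_X i : ('X_i : S) \is 1.-homog.
Proof. by rewrite dhomogX /= mdeg1. Qed.

Lemma hompos_X i : hompos ('X_i : S).
Proof. by exists 1%N => //; exact: dhomog_X. Qed.

End VariableIdeals.

Section PointArgument.
Variables (F : closedFieldType) (n : nat).
Local Notation S := {mpoly F[n]}.
Implicit Types (l : seq S) (g t : S).
Variable r : 'I_n.

(** Membership in the saturation of the ideal by the variable of index r, that
    is, vanishing on the chart where this variable is nonzero. *)
Definition sat l g := exists m, in_ideal l ('X_r ^+ m * g).

Lemma satM l a g : sat l g -> sat l (a * g).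
Proof. by move=> [m H]; exists m; rewrite mulrCA; exact: in_idealM. Qed.

Lemma satD l g h : sat l g -> sat l h -> sat l (g + h).
Proof.
move=> [m H] [m' H']; exists (m + m')%N; rewrite mulrDr; apply: in_idealD.
  by rewrite addnC exprD -mulrA; exact: in_idealM.
by rewrite exprD -mulrA; exact: in_idealM.
Qed.

Lemma sat0 l : sat l 0. Proof. by exists 0%N; rewrite mulr0; exact: in_ideal0. Qed.

Lemma sat_idl l g : in_ideal l g -> sat l g.
Proof. by exists 0%N; rewrite mul1r. Qed.

Lemma satX l m g : sat l ('X_r ^+ m * g) -> sat l g.
Proof. by move=> [m' H]; exists (m' + m)%N; rewrite exprD -mulrA. Qed.

(** If a product of linear factors kills g in the saturation, then one of the
    factors kills a multiple of g that is still outside. *)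
Lemma sat_peel l rs i g : ~ sat l g ->
  sat l (\prod_(z <- rs) ('X_i - z *: 'X_r) * g) ->
  exists z g', [/\ exists c, g' = c * g, ~ sat l g' &
                   sat l (('X_i - z *: 'X_r) * g')].
Proof.
elim: rs g => [|z rs IH] g Ng; first by rewrite big_nil mul1r.
rewrite big_cons -mulrA mulrCA => H.
have [Sg|Ng'] := classic (sat l (('X_i - z *: 'X_r) * g)).
  by exists z, g; split => //; exists 1; rewrite mul1r.
have [z' [g' [[c ->] N' S']]] := IH _ Ng' H.
by exists z', (c * (('X_i - z *: 'X_r) * g)); split => //;
    exists (c * ('X_i - z *: 'X_r)); rewrite mulrA.
Qed.

Definition homogenize (D : nat) (i : 'I_n) (p : {poly F}) : S :=
  \sum_(a < D.+1) p`_a *: ('X_i ^+ a * 'X_r ^+ (D - a)).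

Lemma homogenizeS D i z (p : {poly F}) : (size p <= D.+1)%N ->
  homogenize D.+1 i (('X - z%:P) * p) = ('X_i - z *: 'X_r) * homogenize D i p.
Proof.
move=> sp; rewrite /homogenize !mulrBl.
under eq_bigr => a _ do rewrite coefB coefXM coefCM scalerBl.
rewrite big_split /= sumrN; congr (_ - _).
  rewrite big_ord_recl /= scale0r add0r mulr_sumr; apply: eq_bigr => a _.
  by rewrite /= subSS exprS -scalerAr mulrA.
rewrite big_ord_recr /= (nth_default _ sp) mulr0 scale0r addr0 mulr_sumr.
apply: eq_bigr => a _; rewrite -scalerAl -scalerAr scalerA.
by rewrite subSn -1?ltnS // exprS mulrCA.
Qed.

Lemma homogenize_prod D i rs : (size rs <= D)%N ->
  homogenize D i (\prod_(z <- rs) ('X - z%:P)) =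
  'X_r ^+ (D - size rs) * \prod_(z <- rs) ('X_i - z *: 'X_r).
Proof.
elim: rs D => [|z rs IH] D /=.
  move=> _; rewrite !big_nil mulr1 subn0 /homogenize big_ord_recl /= coef1 scale1r.
  rewrite mul1r subn0 big1 ?addr0 // => a _.
  by rewrite coef1 scale0r.
case: D => // D; rewrite ltnS => sD.
by rewrite !big_cons homogenizeS ?IH // ?subSS 1?mulrCA // size_prod_XsubC.
Qed.

(** If the ideal together with the variable of index r contains all monomials
    of degree at least M, then modulo the ideal the finitely many monomials
    of degree less than M generate everything over the powers of this
    variable. *)
Lemma reduce_low_degree l M D g : homl l -> 
  (forall m, (M <= mdeg m)%N -> in_ideal ('X_r :: l) 'X_[m]) -> g \is D.-homog ->
  exists c : 'X_{1..n < M} -> F,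
    in_ideal l (g - \sum_b c b *: ('X_r ^+ (D - mdeg b) * 'X_[b])) /\
    (forall b : 'X_{1..n < M}, (D < mdeg b)%N -> c b = 0).
Proof.
move=> hl HM; elim/ltn_ind: D g => D IH g gD.
have [DM|MD] := ltnP D M.
  exists (fun b => g@_b); split; last first.
    move=> b Db; apply: (dhomog_nemf_coeff gD).
    by rewrite gtn_eqF.
  suff -> : g - \sum_(b : 'X_{1..n < M}) g@_b *: ('X_r ^+ (D - mdeg b) * 'X_[b]) = 0.
    exact: in_ideal0.
  apply/eqP; rewrite subr_eq0; apply/eqP.
  have sg : (msize g <= M)%N.
    by rewrite msizeE; apply/bigmax_leqP_seq => m mg _; rewrite (dhomog_mf gD mg : mdeg m = D).
  rewrite {1}(mpolywE sg); apply: eq_bigr => b _.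
  have [->|gb] := eqVneq g@_b 0; first by rewrite !scale0r.
  have -> : mdeg b = D by apply: (dhomog_mf gD); rewrite mcoeff_msupp.
  by rewrite subnn mul1r.
have lg : in_ideal ('X_r :: l) g.
  rewrite (mpolyE g) big_seq; apply: in_ideal_sum => m mg.
  by rewrite -mul_mpolyC; apply/in_idealM/HM; rewrite (dhomog_mf gD mg).
have [a la] := in_ideal_homog hl (dhomog_X F r) gD lg.
move=> [[D0 aD]|a0]; last first.
  exists (fun=> 0); split=> //; rewrite big1 ?subr0; last by move=> *; rewrite scale0r.
  by move: la; rewrite a0 mul0r subr0.
have lt : (D - 1 < D)%N by rewrite subn1 prednK.
have [c [lc c0]] := IH _ lt _ aD.
exists c; split; last first.
  by move=> b Db; apply: c0; exact: ltn_trans lt Db.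
have -> : \sum_b c b *: ('X_r ^+ (D - mdeg b) * 'X_[b]) =
          'X_r * \sum_(b : 'X_{1..n < M}) c b *: ('X_r ^+ (D - 1 - mdeg b) * 'X_[b]).
  rewrite mulr_sumr; apply: eq_bigr => b _; rewrite -scalerAr.
  have [/c0 ->|bD] := ltnP (D - 1)%N (mdeg b); first by rewrite !scale0r.
  by rewrite mulrA -exprS; congr (_ *: ('X_r ^+ _ * _)); lia.
set s := \sum_b _ in lc *.
have -> : g - 'X_r * s = (g - a * 'X_r) + 'X_r * (a - s) by ring.
by apply: in_idealD => //; exact: in_idealM.
Qed.

(** By finiteness the powers of a variable are dependent over the powers of
    the variable of index r; over an algebraically closed field the dependence
    splits into linear factors. *)
Lemma split_relation l i : homl l -> mprimary ('X_r :: l) ->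
  exists D rs, (size rs <= D)%N /\
    in_ideal l ('X_r ^+ (D - size rs) * \prod_(z <- rs) ('X_i - z *: 'X_r)).
Proof.
move=> hl [M HM]; pose K := #|{: 'X_{1..n < M}}|.
have ex (a : 'I_K.+1) : exists c : 'X_{1..n < M} -> F,
    in_ideal l ('X_i ^+ a * 'X_r ^+ (K - a) - \sum_b c b *: ('X_r ^+ (K - mdeg b) * 'X_[b])).
  have h : ('X_i ^+ a * 'X_r ^+ (K - a) : S) \is K.-homog.
    rewrite (_ : K.-homog = (1 * a + 1 * (K - a)).-homog); last first.
      by congr (_.-homog); have := ltn_ord a; lia.
    by apply: dhomogM; apply: dhomogMn; exact: dhomog_X.
  by have [c [lc _]] := reduce_low_degree hl HM h; exists c.
have [c lc] := fin_all_exists ex.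
pose A : 'M[F]_(K.+1, K) := \matrix_(a, b) c a (enum_val b).
(* K + 1 powers against K monomials of low degree. *)
have [w w0 wA] : exists2 w : 'rV_K.+1, w != 0 & w *m A = 0.
  have : kermx A != 0.
    rewrite -mxrank_eq0 mxrank_ker subn_eq0 -ltnNge ltnS; exact: rank_leq_col.
  by case/rowV0Pn => w /sub_kermxP wA w0; exists w.
pose p : {poly F} := \poly_(a < K.+1) w 0 (inord a).
have p0 : p != 0.
  apply: contraNneq w0 => p0; apply/eqP/rowP => a; rewrite mxE.
  have := congr1 (fun q : {poly F} => q`_a) p0.
  by rewrite coef_poly ltn_ord inord_val coef0.
have lp : in_ideal l (homogenize K i p).
  have -> : homogenize K i p = \sum_(a < K.+1) (w 0 a)%:MP *
      ('X_i ^+ a * 'X_r ^+ (K - a) - \sum_b c a b *: ('X_r ^+ (K - mdeg b) * 'X_[b])).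
    under [RHS]eq_bigr => a _ do rewrite mulrBr.
    rewrite big_split /= sumrN [X in _ - X](_ : _ = 0) ?subr0.
      apply: eq_bigr => a _; rewrite coef_poly ltn_ord inord_val.
      by rewrite mul_mpolyC.
    under eq_bigr => a _ do rewrite mulr_sumr.
    rewrite exchange_big big1 //= => b _.
    under eq_bigr => a _ do rewrite mul_mpolyC scalerA.
    rewrite -scaler_suml.
    have := congr1 (fun B : 'rV_K => B 0 (enum_rank b)) wA.
    rewrite !mxE => E; suff -> : \sum_(a < K.+1) w 0 a * c a b = 0 by rewrite scale0r.
    by rewrite -[RHS]E; apply: eq_bigr => a _; rewrite mxE enum_rankK.
  by apply: in_ideal_sum => a _; exact: in_idealM.
have [rs Ep] := closed_field_poly_normal p.
have rsK : (size rs <= K)%N.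
  have : (size p <= K.+1)%N by exact: size_poly.
  by rewrite Ep size_scale ?lead_coef_eq0 // size_prod_XsubC.
exists K, rs; split=> //; rewrite -homogenize_prod //.
have E : homogenize K i p = lead_coef p *: homogenize K i (\prod_(z <- rs) ('X - z%:P)).
  rewrite /homogenize scaler_sumr; apply: eq_bigr => a _.
  by rewrite scalerA -coefZ -Ep.
have -> : homogenize K i (\prod_(z <- rs) ('X - z%:P)) = ((lead_coef p)^-1)%:MP * homogenize K i p.
  by rewrite E mul_mpolyC scalerA mulVf ?scale1r // lead_coef_eq0.
exact: in_idealM.
Qed.

(** A homogeneous Nullstellensatz by hand: multiplying g0 repeatedly by linear
    factors makes every variable act on it as a scalar times the variable of
    index r, and these scalars are the coordinates of the zero. *)
Lemma proj_zero l0 l g0 : homl l0 -> mprimary ('X_r :: l0) ->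
  (forall t, t \in l0 -> in_ideal l t) -> ~ sat l g0 ->
  exists v : 'I_n -> F, v r = 1 /\
    forall m t, t \is m.-homog -> sat l (t * g0) -> t.@[v] = 0.
Proof.
move=> hl0 nil0 l0l Ng0.
have ind (s : seq 'I_n) : exists (v : 'I_n -> F) g', 
    [/\ exists c, g' = c * g0, ~ sat l g' &
      forall i, i \in s -> sat l (('X_i - v i *: 'X_r) * g')].
  elim: s => [|i s [v [g' [[c Eg'] Ng' vs]]]].
    by exists (fun=> 0), g0; split => //; exists 1; rewrite mul1r.
  have [D [rs [_ lp]]] := split_relation i hl0 nil0.
  have [||z [g'' [[c' Eg''] Ng'' S'']]] := @sat_peel l rs i g' => //.
    rewrite mulrC; apply: satM; apply: (@satX _ (D - size rs)).
    by apply: sat_idl; exact: in_ideal_incl l0l lp.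
  exists (fun j => if j == i then z else v j), g''; split => //.
    by exists (c' * c); rewrite Eg'' Eg' mulrA.
  move=> j; rewrite inE; case: eqVneq => [->|_] //= /vs H.
  by rewrite Eg'' mulrCA; exact: satM.
have [v [g' [[c Eg'] Ng' vs]]] := ind (enum 'I_n).
have vs' i : sat l (('X_i - v i *: 'X_r) * g') by apply: vs; rewrite mem_enum.
have vr : v r = 1.
  apply/eqP; apply: contra_notT Ng'; rewrite -subr_eq0 -oppr_eq0 opprB => nz.
  have := vs' r; have -> : 'X_r - v r *: 'X_r = (1 - v r) *: 'X_r :> S.
    by rewrite scalerBl scale1r.
  rewrite -scalerAl -mul_mpolyC => /(satM (((1 - v r)^-1)%:MP)).
  by rewrite mulrA -mpolyCM mulVf // mul1r -[X in X * g']expr1 => /satX.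
exists v; split => //.
have monE (m : 'X_{1..n}) :
    sat l (('X_[m] - (\prod_i v i ^+ m i) *: 'X_r ^+ mdeg m) * g').
  rewrite mpolyXE_id mdegE.
  elim: (index_enum _) => [|i s IH].
    by rewrite !big_nil scale1r subrr mul0r; exact: sat0.
  rewrite !big_cons.
  set V := \prod_(j <- s) _ in IH *; set P := \prod_(j <- s) _ in IH *.
  set e := (\sum_(j <- s) _)%N in IH *.
  have powE a : sat l (('X_i ^+ a - v i ^+ a *: 'X_r ^+ a) * g').
    elim: a => [|a IHa]; first by rewrite !expr0 scale1r subrr mul0r; exact: sat0.
    have -> : ('X_i ^+ a.+1 - v i ^+ a.+1 *: 'X_r ^+ a.+1) * g' =
      'X_i ^+ a * (('X_i - v i *: 'X_r) * g') +
      (v i *: 'X_r) * (('X_i ^+ a - v i ^+ a *: 'X_r ^+ a) * g').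
      by rewrite -!mul_mpolyC !exprS mpolyCM; ring.
    by apply: satD; exact: satM.
  have -> : ('X_i ^+ m i * P - (v i ^+ m i * V) *: 'X_r ^+ (m i + e)) * g' =
     P * (('X_i ^+ m i - v i ^+ m i *: 'X_r ^+ m i) * g') +
     (v i ^+ m i *: 'X_r ^+ m i) * ((P - V *: 'X_r ^+ e) * g').
    by rewrite -!mul_mpolyC mpolyCM exprD; ring.
  by apply: satD; exact: satM.
move=> m t tm tg0.
have : sat l ((t - t.@[v] *: 'X_r ^+ m) * g').
  rewrite {1}(mpolyE t) mevalE scaler_suml -sumrB mulr_suml big_seq.
  elim/big_ind: _ => [||k kt]; [exact: sat0 | exact: satD |].
  have := monE k; rewrite (dhomog_mf tm kt : mdeg k = m) => /(satM (t@_k)%:MP).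
  by rewrite mulrA mul_mpolyC scalerBr scalerA.
rewrite mulrBl => St; apply/eqP; apply: contra_notT Ng' => nz.
have St' : sat l (t * g') by rewrite Eg' mulrCA; exact: satM.
have : sat l ((t.@[v])^-1%:MP * (t * g' - (t * g' - (t.@[v] *: 'X_r ^+ m) * g'))).
  apply: satM; apply: satD => //; rewrite -mulN1r; exact: satM.
by rewrite subKr -scalerAl -mul_mpolyC mulrA -mpolyCM mulVf // mul1r => /satX.
Qed.

Lemma nzd_sat l g : homl l -> nzd 'X_r l -> sat l g -> in_ideal l g.
Proof.
move=> hl nz [m]; elim: m g => [|m IH] g; first by rewrite mul1r.
rewrite exprS -mulrA => H; apply: IH; apply: in_ideal_components => // j.
apply: (nz j); first exact: pihomogP.
have := in_ideal_pihomog j.+1 hl H.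
rewrite mulrC (pihomogM _ _ (dhomog_X F r)) /= subn1 /=.
by rewrite mulrC.
Qed.

(** A zero divisor would produce a projective zero of l on which q vanishes as
    well. *)
Lemma nzd_proj_zero l q L : homl l -> nzd 'X_r l -> mprimary ('X_r :: l) ->
  q \is L.-homog ->
  (forall v : 'I_n -> F, v r = 1 -> (forall t, t \in l -> t.@[v] = 0) -> q.@[v] <> 0) ->
  nzd q l.
Proof.
move=> hl nz nil qL Hv j g gj lqg; apply: NNPP => Ng.
have Ns : ~ sat l g by move=> /(nzd_sat hl nz).
have [v [vr Hv']] := proj_zero hl nil (fun t => @in_ideal_gen _ l t) Ns.
apply: (Hv v vr).
  move=> t tl; have [m _ tm] := hl t tl.
  by apply: (Hv' m) => //; apply: sat_idl; rewrite mulrC; apply/in_idealM/in_ideal_gen.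
by apply: (Hv' L) => //; exact: sat_idl.
Qed.

(** Without a projective zero the saturation contains 1, so it contains a
    power of the variable of index r; together with reduction to low degree
    this gives all large monomials. *)
Lemma mprimary_proj_zero l q L : homl l -> mprimary ('X_r :: l) -> q \is L.-homog ->
  (forall v : 'I_n -> F, v r = 1 -> (forall t, t \in l -> t.@[v] = 0) -> q.@[v] <> 0) ->
  mprimary (q :: l).
Proof.
move=> hl nil qL Hv.
have [[e]|Ns] := classic (sat (q :: l) 1); last first.
  have lq t : t \in l -> in_ideal (q :: l) t.
    by move=> tl; apply: in_ideal_gen; rewrite inE tl orbT.
  have [v [vr Hv']] := proj_zero hl nil lq Ns.
  case: (Hv v vr).
    move=> t tl; have [m _ tm] := hl t tl.
    by apply: (Hv' m) => //; apply: sat_idl; rewrite mulr1; exact: lq.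
  apply: (Hv' L) => //; apply: sat_idl; rewrite mulr1.
  by apply: in_ideal_gen; rewrite inE eqxx.
rewrite mulr1 => He; have [M HM] := nil; exists (M + e)%N => m mM.
have hm : ('X_[m] : S) \is (mdeg m).-homog by rewrite dhomogX /=.
have [c [lc _]] := reduce_low_degree hl HM hm.
rewrite -(subrK (\sum_b c b *: ('X_r ^+ (mdeg m - mdeg b) * 'X_[b])) 'X_[m]).
apply: in_idealD; first exact: in_ideal_cons.
apply: in_ideal_sum => b _; rewrite -mul_mpolyC; apply: in_idealM; rewrite mulrC.
apply: in_idealM; have bM := bmdeg b.
have -> : (mdeg m - mdeg b = (mdeg m - mdeg b - e) + e)%N by lia.
by rewrite exprD; exact: in_idealM.
Qed.

End PointArgument.

(** * Socle of a complete intersection *)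

Section CompleteIntersection.
Variables (F : closedFieldType) (n N : nat).
Local Notation S := {mpoly F[n]}.
Variable q : 'I_n -> S.
Hypothesis q_homog : forall i, q i \is N.+1.-homog.
Hypothesis q_zero : forall v : 'I_n -> F,
  (forall i, v i != 0 -> (q i).@[v] = 0) -> forall i, v i = 0.

(** The first r variables of the regular sequence of variables are replaced by
    the q_i; the socle is followed along these replacements. *)
Definition mixgen (r : nat) (i : 'I_n) : S := if (i < r)%N then q i else 'X_i.
Definition mix r : seq S := [seq mixgen r i | i <- enum 'I_n].
Definition mixD (r : 'I_n) : seq S := [seq mixgen r i | i <- rem r (enum 'I_n)].

Lemma hompos_mix r i : hompos (mixgen r i).
Proof. by rewrite /mixgen; case: ltnP => _; [exists N.+1 | exact: hompos_X]. Qed.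

Lemma homl_mix r : homl (mix r).
Proof. by move=> _ /mapP[i _ ->]; exact: hompos_mix. Qed.

Lemma homl_mixD r : homl (mixD r).
Proof. by move=> _ /mapP[i _ ->]; exact: hompos_mix. Qed.

Lemma mixD_S (r : 'I_n) : [seq mixgen r.+1 i | i <- rem r (enum 'I_n)] = mixD r.
Proof.
apply/eq_in_map => i; rewrite mem_rem_uniq ?enum_uniq // inE => /andP[ir _].
by rewrite /mixgen ltnS leq_eqVlt val_eqE (negbTE ir).
Qed.

Lemma enum_split (r : 'I_n) : exists s1 s2, enum 'I_n = s1 ++ r :: s2 /\
  rem r (enum 'I_n) = s1 ++ s2.
Proof.
have ri : r \in enum 'I_n by rewrite mem_enum.
exists (take (index r (enum 'I_n)) (enum 'I_n)), (drop (index r (enum 'I_n)).+1 (enum 'I_n)).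
by rewrite remE -drop_index // cat_take_drop.
Qed.

Lemma regseq_mix r (k : 'I_n) : regseq (mix r) <->
  regseq (mixgen r k :: [seq mixgen r i | i <- rem k (enum 'I_n)]).
Proof.
have [s1 [s2 [E1 E2]]] := enum_split k.
rewrite E2 map_cat; have := @homl_mix r; rewrite /mix E1 map_cat /=.
exact: regseq_move.
Qed.

Lemma mem_mix r (k : 'I_n) :
  mix r =i mixgen r k :: [seq mixgen r i | i <- rem k (enum 'I_n)].
Proof.
have [s1 [s2 [E1 E2]]] := enum_split k.
by move=> x; rewrite E2 map_cat /mix E1 map_cat /= !(mem_cat, inE) orbCA.
Qed.

Lemma mixgen_lo (r : 'I_n) : mixgen r r = 'X_r.
Proof. by rewrite /mixgen ltnn. Qed.

Lemma mixgen_hi (r : 'I_n) : mixgen r.+1 r = q r.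
Proof. by rewrite /mixgen ltnSn. Qed.

Lemma mix_nozero (r : 'I_n) (v : 'I_n -> F) : v r = 1 ->
  (forall t, t \in mixD r -> t.@[v] = 0) -> (q r).@[v] <> 0.
Proof.
move=> vr H qr; have [] := elimN eqP (oner_neq0 F).
rewrite -vr; apply: q_zero => i vi.
have [->//|ir] := eqVneq i r.
have := H (mixgen r i); rewrite /mixgen; case: ltnP => ltir; last first.
  move=> H0; case/eqP: vi; rewrite -(mevalXU v i); apply: H0.
  apply/mapP; exists i; last by rewrite /mixgen ltnNge ltir.
  by rewrite mem_rem_uniq ?enum_uniq // inE ir mem_enum.
apply; apply/mapP; exists i; last by rewrite /mixgen ltir.
by rewrite mem_rem_uniq ?enum_uniq // inE ir mem_enum.
Qed.

Lemma mix_regseq_mprimary r : (r <= n)%N -> regseq (mix r) /\ mprimary (mix r).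
Proof.
elim: r => [|r IH] rn.
  have E : mix 0 = [seq ('X_i : S) | i <- enum 'I_n] by apply: eq_map.
  rewrite E; split; first exact/regseq_X/enum_uniq.
  exists 1%N => m m0; apply/in_ideal_X => m'; rewrite msuppX inE => /eqP ->.
  have : m != 0%MM by rewrite -mdeg_eq0 -lt0n.
  move=> mn; have [i mi] : exists i, m i != 0%N.
    apply/existsP; apply: contraNT mn; rewrite negb_exists => /forallP H.
    by apply/eqP/mnmP => i; rewrite mnm0E; apply/eqP; rewrite -[_ == _]negbK.
  by exists i; rewrite ?mem_enum.
have [R Ni] := IH (ltnW rn); pose k := Ordinal rn.
have [nx Rk] := (regseq_mix r k).1 R; rewrite -/(mixD k) (mixgen_lo k) in nx Rk.
have nil' : mprimary ('X_k :: mixD k).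
  apply: mprimary_incl Ni => t; rewrite (mem_mix r k) => H.
  by apply: in_ideal_gen; rewrite -(mixgen_lo k).
split.
  apply/(regseq_mix r.+1 k); rewrite (mixD_S k) (mixgen_hi k); split => //.
  by apply: (nzd_proj_zero (@homl_mixD k) nx nil' (q_homog k)); exact: mix_nozero.
have := mprimary_proj_zero (@homl_mixD k) nil' (q_homog k) (@mix_nozero k).
apply: mprimary_incl => t H; apply: in_ideal_gen; rewrite (mem_mix _ k).
by rewrite (mixD_S k) (mixgen_hi k).
Qed.

Definition socle l (g : S) := forall i : 'I_n, in_ideal l ('X_i * g).

(** Linkage: multiplication by the variable of index r followed by division by
    q r sends the socle modulo q r to the socle modulo the variable, and
    lowers degrees by N. *)
Lemma socle_link (r : 'I_n) g j : nzd 'X_r (mixD r) -> nzd (q r) (mixD r) ->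
  g \is j.-homog -> socle (q r :: mixD r) g ->
  exists h, [/\ in_ideal (mixD r) ('X_r * g - h * q r),
    (N <= j)%N /\ h \is (j - N).-homog \/ h = 0 &
    socle ('X_r :: mixD r) h].
Proof.
move=> nx nq gj sg.
have hX (i : 'I_n) : 'X_i * g \is j.+1.-homog.
  by rewrite -add1n; apply: dhomogM => //; exact: dhomog_X.
have ex (i : 'I_n) : exists2 h, in_ideal (mixD r) ('X_i * g - h * q r) &
    (N <= j)%N /\ h \is (j - N).-homog \/ h = 0.
  by have := in_ideal_homog (@homl_mixD r) (q_homog r) (hX i) (sg i).
have [h lh hj] := ex r; exists h; split => // i.
have [hi lhi hij] := ex i.
exists hi.
have [Nj|jN] := leqP N j; last first.
  have -> : h = 0 by case: hj => // -[]; rewrite leqNgt jN.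
  have -> : hi = 0 by case: hij => // -[]; rewrite leqNgt jN.
  by rewrite mulr0 mul0r subrr; exact: in_ideal0.
have H0 p : (N <= j)%N /\ p \is (j - N).-homog \/ p = 0 -> p \is (j - N).-homog.
  by case=> [[]|->] //; exact: dhomog0.
apply: (nq (1 + (j - N))%N).
  apply: dhomogD; first by apply: dhomogM; [exact: dhomog_X | exact: H0].
  by rewrite dhomogN mulrC; apply: dhomogM; [exact: dhomog_X | exact: H0].
have -> : q r * ('X_i * h - hi * 'X_r) =
    'X_r * ('X_i * g - hi * q r) - 'X_i * ('X_r * g - h * q r) by ring.
by apply: in_idealB; exact: in_idealM.
Qed.

Lemma socle_link_inv (r : 'I_n) g h j : nzd 'X_r (mixD r) ->
  g \is j.-homog -> (N <= j)%N /\ h \is (j - N).-homog \/ h = 0 ->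
  in_ideal (mixD r) ('X_r * g - h * q r) ->
  in_ideal ('X_r :: mixD r) h -> in_ideal (q r :: mixD r) g.
Proof.
move=> nx gj hj lh lxh.
have [a la aj] : exists2 a, in_ideal (mixD r) (h - a * 'X_r) &
    a * q r \is j.-homog.
  case: hj => [[Nj hj]|->]; last first.
    by exists 0; rewrite ?mul0r ?subr0; [exact: in_ideal0 | exact: dhomog0].
  have [a la [[j0 aj]|a0]] := in_ideal_homog (@homl_mixD r) (dhomog_X F r) hj lxh.
    exists a => //; rewrite (_ : j = (j - N - 1 + N.+1)%N); last by lia.
    exact: dhomogM.
  by exists a; rewrite // a0 mul0r; exact: dhomog0.
exists a; apply: (nx j); first by apply: dhomogD => //; rewrite dhomogN.
have -> : 'X_r * (g - a * q r) =
   ('X_r * g - h * q r) + q r * (h - a * 'X_r) by ring.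
by apply: in_idealD => //; exact: in_idealM.
Qed.

(** Along the replacements the socle stays at most one-dimensional and its
    degree grows by N at each step, starting from the constants, which are the
    socle modulo all the variables. *)
Lemma socle_mix r : (r <= n)%N ->
  (forall j g, g \is j.-homog -> socle (mix r) g -> j != (r * N)%N ->
     in_ideal (mix r) g) /\
  (forall g1 g2, g1 \is (r * N).-homog -> g2 \is (r * N).-homog ->
     socle (mix r) g1 -> socle (mix r) g2 ->
     exists c1 c2, (c1 != 0) || (c2 != 0) /\
       in_ideal (mix r) (c1 *: g1 + c2 *: g2)).
Proof.
elim: r => [|r IH] rn.
  have E : mix 0 = [seq ('X_i : S) | i <- enum 'I_n] by apply: eq_map.
  have pos j (g : S) : g \is j.-homog -> j != 0%N -> in_ideal (mix 0) g.
    move=> gj j0; rewrite E; apply/in_ideal_X => m mg.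
    have : mdeg m != 0%N by rewrite (dhomog_mf gj mg : mdeg m = j).
    rewrite mdeg_eq0 => mn; have [i mi] : exists i, m i != 0%N.
      apply/existsP; apply: contraNT mn; rewrite negb_exists => /forallP H.
      by apply/eqP/mnmP => i; rewrite mnm0E; apply/eqP; rewrite -[_ == _]negbK.
    by exists i; rewrite ?mem_enum.
  split=> [j g gj _ j0|g1 g2 h1 h2 _ _]; first by apply: (pos j); rewrite ?mul0n in j0 *.
  have const (g : S) : g \is 0.-homog -> g = (g@_0)%:MP.
    move=> g0; apply: msize1_polyC; rewrite msizeE; apply/bigmax_leqP_seq => m mg _.
    by rewrite (dhomog_mf g0 mg : mdeg m = 0%N).
  rewrite mul0n in h1 h2.
  have [z|nz] := eqVneq (g1@_0) 0.
    exists 1, 0; split; first by rewrite oner_neq0.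
    by rewrite (const _ h1) z mpolyC0 scaler0 scale0r addr0; exact: in_ideal0.
  exists (- g2@_0), (g1@_0); split; first by rewrite nz orbT.
  move: (const _ h1) (const _ h2); move: (g1@_0) (g2@_0) => a b -> ->.
  by rewrite -!mul_mpolyC -!mpolyCM -mpolyCD mulNr mulrC addNr mpolyC0; exact: in_ideal0.
have [S1 S2] := IH (ltnW rn); pose k := Ordinal rn.
have [R _] := mix_regseq_mprimary (ltnW rn); have [R' _] := mix_regseq_mprimary rn.
have [nx _] := (regseq_mix r k).1 R; rewrite -/(mixD k) (mixgen_lo k) in nx.
have [nq _] := (regseq_mix r.+1 k).1 R'; rewrite (mixD_S k) (mixgen_hi k) in nq.
have to g : in_ideal ('X_k :: mixD k) g <-> in_ideal (mix r) g.
  split; apply: in_ideal_eq_mem => t; rewrite (mem_mix r k) (mixgen_lo k) //.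
have to' g : in_ideal (q k :: mixD k) g <-> in_ideal (mix r.+1) g.
  split; apply: in_ideal_eq_mem => t; rewrite (mem_mix r.+1 k) (mixD_S k) (mixgen_hi k) //.
split=> [j g gj sg jr|g1 g2 h1 h2 s1 s2].
  have sg' : socle (q k :: mixD k) g by move=> i; apply/to'.
  have [h [lh hj sh]] := socle_link nx nq gj sg'.
  apply/to'; apply: (socle_link_inv nx gj hj lh); apply/to.
  case: hj => [[Nj hj]|->]; last exact: in_ideal0.
  apply: (S1 (j - N)%N) => //; first by move=> i; apply/to.
  by apply: contraNneq jr => E; rewrite mulSn -E addnC subnK.
have s1' : socle (q k :: mixD k) g1 by move=> i; apply/to'.
have s2' : socle (q k :: mixD k) g2 by move=> i; apply/to'.
have [a1 [l1 b1 t1]] := socle_link nx nq h1 s1'.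
have [a2 [l2 b2 t2]] := socle_link nx nq h2 s2'.
have D : (r.+1 * N - N = r * N)%N by rewrite mulSn addKn.
have H0 p : (N <= r.+1 * N)%N /\ p \is (r.+1 * N - N).-homog \/ p = 0 -> p \is (r * N).-homog.
  by rewrite D; case=> [[]|->] //; exact: dhomog0.
have [c1 [c2 [nz lc]]] : exists c1 c2, (c1 != 0) || (c2 != 0) /\
    in_ideal (mix r) (c1 *: a1 + c2 *: a2).
  by apply: S2; [exact: H0 | exact: H0 | move=> i; apply/to | move=> i; apply/to].
exists c1, c2; split => //.
apply/to'; apply: (socle_link_inv (h := c1 *: a1 + c2 *: a2) nx (j := (r.+1 * N)%N)).
- by apply: dhomogD; exact: dhomogZ.
- left; rewrite leq_pmull // D; split => //.
  by apply: dhomogD; apply: dhomogZ; exact: H0.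
- have -> : 'X_k * (c1 *: g1 + c2 *: g2) - (c1 *: a1 + c2 *: a2) * q k =
    c1%:MP * ('X_k * g1 - a1 * q k) + c2%:MP * ('X_k * g2 - a2 * q k).
    by rewrite -!mul_mpolyC; ring.
  by apply: in_idealD; exact: in_idealM.
exact/to.
Qed.

Definition qideal : seq S := [seq q i | i <- enum 'I_n].

Lemma mix_n : mix n = qideal.
Proof. by apply: eq_map => i; rewrite /mixgen ltn_ord. Qed.

(** As the quotient vanishes in large degrees, a nonzero element has a nonzero
    multiple in the socle. *)
Lemma socle_multiple g : ~ in_ideal qideal g -> exists m : 'X_{1..n},
  ~ in_ideal qideal ('X_[m] * g) /\ socle qideal ('X_[m] * g).
Proof.
have [_ [M HM]] := mix_regseq_mprimary (leqnn n); rewrite mix_n in HM.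
suff ind e : forall m, (M <= mdeg m + e)%N -> ~ in_ideal qideal ('X_[m] * g) ->
    exists m, ~ in_ideal qideal ('X_[m] * g) /\ socle qideal ('X_[m] * g).
  by move=> Ng; apply: (ind M 0%MM); rewrite ?leq_addl // mpolyX0 mul1r.
elim: e => [|e IH] m le Nm.
  by case: Nm; rewrite mulrC; apply/in_idealM/HM; rewrite -[mdeg m]addn0.
have [[i Ni]|sg] := classic (exists i, ~ in_ideal qideal ('X_i * ('X_[m] * g))); last first.
  by exists m; split => // i; apply: NNPP => Ni; apply: sg; exists i.
apply: (IH (U_(i) + m)%MM); last by rewrite mpolyXD -mulrA.
by rewrite mdegD mdeg1; lia.
Qed.

(** A nonzero g has a nonzero socle multiple, which is proportional to u
    modulo the ideal because the socle is one-dimensional; phi detects it as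
    phi u is nonzero. *)
Lemma gorenstein (phi : {scalar S}) (u : S) :
  (forall g, in_ideal qideal g -> phi g = 0) ->
  u \is (n * N).-homog -> phi u != 0 ->
  forall g, (forall m, phi ('X_[m] * g) = 0) -> in_ideal qideal g.
Proof.
move=> phiJ uh pu g Hg; apply: NNPP => Ng.
have hq : homl qideal by rewrite -mix_n; exact: homl_mix.
have [S1 S2] := socle_mix (leqnn n); rewrite mix_n in S1 S2.
have [m [Nm sm]] := socle_multiple Ng.
set g1 := 'X_[m] * g in Nm sm.
have sc j : socle qideal (pihomog mdeg j g1).
  move=> i; have := in_ideal_pihomog j.+1 hq (sm i).
  by rewrite mulrC (pihomogM _ _ (dhomog_X F i)) /= subn1 mulrC.
set g2 := pihomog mdeg (n * N)%N g1.
have N2 : ~ in_ideal qideal g2.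
  move=> l2; apply: Nm; apply: in_ideal_components => // j.
  have [->//|jn] := eqVneq j (n * N)%N.
  by apply: S1 jn => //; exact: pihomogP.
have g12 : in_ideal qideal (g1 - g2).
  apply: in_ideal_components => // j; rewrite linearB /=.
  have [->|jn] := eqVneq j (n * N)%N.
    by rewrite pihomog_id subrr; exact: in_ideal0.
  rewrite (pihomog_ne0 _ (pihomogP _ _ _)) 1?eq_sym // subr0.
  by apply: S1 jn => //; exact: pihomogP.
have phi2 : phi g2 = 0.
  by rewrite -(subKr g1 g2) linearB /= (phiJ _ g12) subr0; exact: Hg.
have su : socle qideal u.
  move=> i; apply: NNPP => Nu.
  have [m' [Nm' sm']] := socle_multiple Nu; apply: Nm'.
  apply: (S1 (mdeg m' + (1 + n * N))%N) => //.
    by apply: dhomogM; [rewrite dhomogX /= | apply: dhomogM => //; exact: dhomog_X].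
  by lia.
have [c1 [c2 [nz lc]]] := S2 g2 u (pihomogP _ _ _) uh (sc _) su.
have c20 : c2 = 0.
  have := phiJ _ lc; rewrite linearD !linearZ /= phi2 mulr0 add0r => /eqP.
  by rewrite mulf_eq0 (negbTE pu) orbF => /eqP.
move: nz lc; rewrite c20 eqxx orbF scale0r addr0 => c1n lc; apply: N2.
have -> : g2 = c1^-1%:MP * (c1 *: g2).
  by rewrite mul_mpolyC scalerA mulVf // scale1r.
exact: in_idealM.
Qed.

End CompleteIntersection.

(** * Induction on monomials and linear extension *)

Lemma mnm_ind n (P : 'X_{1..n} -> Prop) : P 0%MM ->
  (forall i m, P m -> P (U_(i) + m)%MM) -> forall m, P m.
Proof.
move=> P0 PS m; move: {2}(mdeg m) (erefl (mdeg m)) => d.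
elim: d m => [|d IH] m dm.
  by move/eqP: dm; rewrite mdeg_eq0 => /eqP ->.
have [i mi] : exists i, (0 < m i)%N.
  apply: NNPP => no; suff /eqP: mdeg m == 0%N by rewrite dm.
  rewrite mdegE sum_nat_eq0; apply/forallP => i; apply/implyP => _.
  by rewrite -leqn0 leqNgt; apply/negP => mi; apply: no; exists i.
have dE : m = (U_(i) + (m - U_(i)))%MM.
  apply/mnmP => j; rewrite mnmDE mnmBE mnm1E.
  by case: (i =P j) => [<-|] /=; lia.
rewrite dE; apply/PS/IH; apply/eqP.
by rewrite -(eqn_add2l 1) -(mdeg1 i) -mdegD -dE dm mdeg1.
Qed.

Section MonomialInduction.
Variables (R : comNzRingType) (n : nat).
Local Notation S := {mpoly R[n]}.

Lemma mpoly_Xind (P : S -> Prop) : (forall c, P c%:MP) ->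
  (forall p q, P p -> P q -> P (p + q)) ->
  (forall i p, P p -> P ('X_i * p)) -> forall p, P p.
Proof.
move=> PC PD PX p.
have Pm (c : R) (m : 'X_{1..n}) : P (c *: 'X_[m]).
  elim/mnm_ind: m => [|i m IH] ; first by rewrite mpolyX0 -mul_mpolyC mulr1.
  by rewrite mpolyXD scalerAr; apply: PX.
elim/mpolyind: p => [|c m p _ _ Pp]; first by rewrite -mpolyC0.
exact: PD.
Qed.

Lemma big_msupp (V : lmodType R) (f : 'X_{1..n} -> V) (g : S) (r : seq 'X_{1..n}) :
  uniq r -> {subset msupp g <= r} ->
  \sum_(m <- msupp g) g@_m *: f m = \sum_(m <- r) g@_m *: f m.
Proof.
move=> ur gr; rewrite [RHS](bigID (mem (msupp g))) /=.
rewrite [X in _ + X]big1_seq ?addr0; last first.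
  by move=> m /andP [mg _]; rewrite memN_msupp_eq0 ?scale0r.
rewrite -[RHS]big_filter; apply: perm_big; apply: uniq_perm => //.
  exact: filter_uniq.
move=> m; rewrite mem_filter /=.
by case mg: (m \in msupp g) => //=; rewrite gr.
Qed.

Definition linext (V : lmodType R) (f : 'X_{1..n} -> V) (g : S) : V :=
  \sum_(m <- msupp g) g@_m *: f m.

Lemma linext_linear (V : lmodType R) (f : 'X_{1..n} -> V) : linear (linext f).
Proof.
move=> c g h; pose r := undup (msupp (c *: g + h) ++ msupp g ++ msupp h).
have ur : uniq r by exact: undup_uniq.
have sub x : {subset msupp x <= msupp (c *: g + h) ++ msupp g ++ msupp h} ->
    linext f x = \sum_(m <- r) x@_m *: f m.
  by move=> s; apply: big_msupp => // m /s; rewrite mem_undup.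
rewrite !sub; first last.
- by move=> m ml; rewrite mem_cat ml.
- by move=> m ml; rewrite !mem_cat ml orbT.
- by move=> m ml; rewrite !mem_cat ml !orbT.
rewrite scaler_sumr -big_split; apply: eq_bigr => m _ /=.
by rewrite mcoeffD mcoeffZ scalerDl scalerA.
Qed.

HB.instance Definition _ (V : lmodType R) (f : 'X_{1..n} -> V) :=
  GRing.isLinear.Build R S V *:%R (linext f) (linext_linear f).

Lemma linextX (V : lmodType R) (f : 'X_{1..n} -> V) m : linext f 'X_[m] = f m.
Proof. by rewrite /linext msuppX big_seq1 mcoeffX eqxx scale1r. Qed.

End MonomialInduction.

(** * Divided differences *)

Section DividedDifference.
Variables (R : idomainType) (n : nat).
Local Notation S := {mpoly R[n]}.
Implicit Types (i j l : 'I_n) (p g : S).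

Local Notation sw i j := (msym (tperm i j)).

Lemma msymXU (s : 'S_n) i : msym s ('X_i : S) = 'X_(s i).
Proof.
rewrite msymX; congr 'X_[_]; apply/mnmP => j; rewrite mnmE !mnm1E.
by rewrite -(inj_eq (@perm_inj _ s)) permKV.
Qed.

Lemma swK i j p : sw i j (sw i j p) = p.
Proof. by rewrite -msymMm tperm2 msym1m. Qed.

Lemma sw_id i p : sw i i p = p.
Proof. by rewrite tperm1 msym1m. Qed.

Lemma swC i j p : sw i j p = sw j i p.
Proof. by rewrite tpermC. Qed.

Lemma msym_sw (s : 'S_n) i j p : msym s (sw i j p) = sw (s i) (s j) (msym s p).
Proof.
rewrite -!msymMm -tpermJ conjgE; congr (msym _ p).
by rewrite !mulgA mulgV mul1g.
Qed.

Lemma divdiff_ex i j p : exists g : S, ('X_i - 'X_j) * g == p - sw i j p.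
Proof.
elim/mpoly_Xind: p => [c|p q [g /eqP gE] [h /eqP hE]|l p [g /eqP gE]].
- by exists 0; rewrite mulr0 /msym mmapC subrr.
- by exists (g + h); rewrite mulrDr gE hE msymD opprD; apply/eqP; ring.
have [->|li] := eqVneq l i.
  exists ('X_i * g + sw i j p); rewrite mulrDr mulrCA gE msymM msymXU tpermL.
  by apply/eqP; ring.
have [->|lj] := eqVneq l j.
  exists ('X_j * g - sw i j p); rewrite mulrBr mulrCA gE msymM msymXU tpermR.
  by apply/eqP; ring.
exists ('X_l * g); rewrite mulrCA gE msymM msymXU tpermD 1?eq_sym //.
by rewrite mulrBr.
Qed.

(** The quotient exists by induction on p; uniqueness, from which all the
    rules below follow, comes from the absence of zero divisors. For i = j the
    value is 0, so that sums can range over all indices. *)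
Definition divdiff i j p : S := if i == j then 0 else xchoose (divdiff_ex i j p).

Lemma divdiffii i p : divdiff i i p = 0. Proof. by rewrite /divdiff eqxx. Qed.

Lemma divdiffE i j p : ('X_i - 'X_j) * divdiff i j p = p - sw i j p.
Proof.
rewrite /divdiff; case: (i =P j) => [->|ij]; first by rewrite mulr0 sw_id subrr.
exact/eqP/(xchooseP (divdiff_ex i j p)).
Qed.

Lemma XB_neq0 i j : i != j -> ('X_i - 'X_j : S) != 0.
Proof.
move=> ij; rewrite subr_eq0; apply/eqP => /(congr1 (mcoeff U_(i)%MM)).
rewrite !mcoeffX eqxx eq_mnm1 eq_sym (negbTE ij) => /eqP.
by rewrite oner_eq0.
Qed.

Lemma divdiff_uniq i j p g : i != j -> ('X_i - 'X_j) * g = p - sw i j p -> divdiff i j p = g.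
Proof. by move=> ij; rewrite -divdiffE => /(mulfI (XB_neq0 ij)). Qed.

Lemma divdiff_linear i j : linear (divdiff i j).
Proof.
move=> c p q; have [->|ij] := eqVneq i j; first by rewrite !divdiffii scaler0 addr0.
apply: (divdiff_uniq ij); rewrite mulrDr -scalerAr !divdiffE msymD msymZ scalerBr opprD.
by rewrite addrACA.
Qed.

HB.instance Definition _ i j :=
  GRing.isLinear.Build R S S *:%R (divdiff i j) (divdiff_linear i j).

Lemma divdiff_msym (s : 'S_n) i j p : msym s (divdiff i j p) = divdiff (s i) (s j) (msym s p).
Proof.
have [->|ij] := eqVneq i j; first by rewrite !divdiffii msym0.
apply/esym; apply: divdiff_uniq; first by rewrite (inj_eq perm_inj).
by rewrite -!msymXU -msymB -msymM divdiffE msymB msym_sw .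
Qed.

Lemma divdiffC i j p : divdiff i j p = - divdiff j i p.
Proof.
have [->|ij] := eqVneq i j; first by rewrite !divdiffii oppr0.
by apply: (divdiff_uniq ij); rewrite mulrN -mulNr opprB divdiffE swC.
Qed.

Lemma divdiff_mulX i j l p :
  divdiff i j ('X_l * p) = 'X_l * divdiff i j p + sw i j p *+ (l == i) - sw i j p *+ (l == j).
Proof.
have [->|ij] := eqVneq i j; first by rewrite !divdiffii mulr0 addrK.
apply: (divdiff_uniq ij); rewrite mulrBr mulrDr mulrCA divdiffE msymM msymXU.
have [->|li] := eqVneq l i.
  by rewrite tpermL (negbTE ij) mulr1n mulr0n; ring.
have [->|lj] := eqVneq l j.
  by rewrite tpermR mulr1n mulr0n; ring.
by rewrite tpermD 1?eq_sym // mulr0n; ring.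
Qed.

Lemma divdiff_sym i j p : sw i j p = p -> divdiff i j p = 0.
Proof.
move=> sp; have [->|ij] := eqVneq i j; first by rewrite divdiffii.
by apply: (divdiff_uniq ij); rewrite sp subrr mulr0.
Qed.

Lemma divdiff_mon_aux i j (b : 'X_{1..n}) c : i != j -> b i = b j ->
  divdiff i j 'X_[b + U_(i) *+ c] =
  \sum_(a < c) 'X_[b + U_(i) *+ (c.-1 - a) + U_(j) *+ a].
Proof.
move=> ij bij; apply: (divdiff_uniq ij).
rewrite msymX.
have -> : [multinom (b + U_(i) *+ c)%MM ((tperm i j)^-1%g l) | l < n]
    = (b + U_(j) *+ c)%MM.
  apply/mnmP => l; rewrite mnmE !mnmDE !mulmnE !mnm1E tpermV.
  rewrite -(inj_eq (@perm_inj _ (tperm i j)) i) tpermL tpermK; congr (_ + _)%N.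
  by case: tpermP => [->|->|].
rewrite !(mpolyXD, mpolyXn) -mulrBr -!mpolyXn subrXX mulrCA; congr (_ * _).
rewrite mulr_sumr; apply: eq_bigr => a _.
by rewrite !mpolyXD -!mpolyXn mulrA.
Qed.

(** What a divided difference or a derivative does to exponents: the total
    degree drops by one and no bound on the exponents is lost. *)
Definition lowers_degree (x m : 'X_{1..n}) := (mdeg x).+1 = mdeg m /\
  forall N, (forall l, m l <= N)%N -> forall l, (x l <= N)%N.

(** From the formula for (x^c - y^c)/(x - y), after taking out the common
    power of the two variables; the case of the other order follows by
    antisymmetry. *)
Lemma divdiff_mon i j (m : 'X_{1..n}) x : x \in msupp (divdiff i j 'X_[m]) -> lowers_degree x m.
Proof.
have [->|ij] := eqVneq i j; first by rewrite divdiffii msupp0.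
wlog le : i j m ij / (m j <= m i)%N.
  move=> W; case: (leqP (m j) (m i)) => h; first exact: W.
  rewrite divdiffC => xs; apply: (W j i); rewrite 1?eq_sym ?(ltnW h) //.
  by move: xs; rewrite (perm_mem (msuppN _)).
pose b := (m - U_(i) *+ (m i - m j))%MM.
have bE l : b l = if l == i then m j else m l.
  rewrite mnmBE mulmnE mnm1E; case: (eqVneq i l) => [<-|] /=; last lia.
  by lia.
have mE : m = (b + U_(i) *+ (m i - m j))%MM.
  apply/mnmP => l; rewrite mnmDE mulmnE mnm1E bE.
  by case: (eqVneq i l) => [<-|_] /=; lia.
rewrite {1}mE divdiff_mon_aux //; last by rewrite !bE eqxx eq_sym (negbTE ij).
rewrite mcoeff_msupp raddf_sum /= => nz.
have [a xE] : exists a : 'I_(m i - m j),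
    x = (b + U_(i) *+ ((m i - m j).-1 - a) + U_(j) *+ a)%MM.
  apply: NNPP => no; move/negP: nz; apply; apply/eqP; apply: big1 => a _.
  by rewrite mcoeffX; case: eqP => // xE; case: no; exists a.
have la := ltn_ord a; split.
  by rewrite [in RHS]mE xE !mdegD !mdegMn !mdeg1; lia.
move=> N mN l; rewrite xE !mnmDE !mulmnE !mnm1E bE.
have := mN i; have := mN l; rewrite [l == i]eq_sym [j == l]eq_sym.
case: (i =P l) => [<-|_]; first by rewrite (negbTE ij) /=; lia.
by case: (l =P j) => [->|_] /=; lia.
Qed.

End DividedDifference.

(** * Dunkl operators *)

Section SumOfDifferences.
Variables (R : idomainType) (n : nat).
Local Notation S := {mpoly R[n]}.
Implicit Types (i j l : 'I_n) (p g h : S).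
Local Notation sw i j := (msym (tperm i j)).

Definition sumdivdiff i p : S := \sum_l divdiff i l p.

Lemma sumdivdiff_linear i : linear (sumdivdiff i).
Proof.
move=> c p q; rewrite /sumdivdiff scaler_sumr -big_split; apply: eq_bigr => l _.
exact: linearP.
Qed.

Lemma sumdivdiff_mulX i l p : l != i ->
  sumdivdiff i ('X_l * p) = 'X_l * sumdivdiff i p - sw i l p.
Proof.
move=> li; rewrite /sumdivdiff mulr_sumr (bigD1 l) //= [X in _ = X - _](bigD1 l) //=.
rewrite divdiff_mulX (negbTE li) eqxx mulr0n addr0 mulr1n addrAC; congr (_ + _ - _).
apply: eq_bigr => j jl.
by rewrite divdiff_mulX (negbTE li) eq_sym (negbTE jl) mulr0n addr0 subr0.
Qed.

Definition sumsw i p : S := \sum_(j | j != i) sw i j p.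

Lemma sumdivdiff_mulXi i p : sumdivdiff i ('X_i * p) = 'X_i * sumdivdiff i p + sumsw i p.
Proof.
rewrite /sumdivdiff /sumsw [X in _ = _ + X]big_mkcond mulr_sumr -big_split.
apply: eq_bigr => j _ /=.
have [->|ji] := eqVneq j i; first by rewrite !divdiffii mulr0 addr0.
by rewrite divdiff_mulX eqxx eq_sym (negbTE ji) mulr1n mulr0n subr0.
Qed.

End SumOfDifferences.

(** The rational Dunkl operator of the symmetric group, with parameter -k in
    the usual normalisation. *)
HB.lock Definition dunkl (R : idomainType) (n k : nat) (i : 'I_n)
  (p : {mpoly R[n]}) : {mpoly R[n]} := p^`M(i) - sumdivdiff i p *+ k.

Section Dunkl.
Variables (R : idomainType) (n k : nat).
Local Notation S := {mpoly R[n]}.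
Implicit Types (i j l : 'I_n) (p g h : S).
Local Notation sw i j := (msym (tperm i j)).
Local Notation dunkl := (@dunkl R n k).

Lemma dunklE i p : dunkl i p = p^`M(i) - sumdivdiff i p *+ k.
Proof. by rewrite dunkl.unlock. Qed.

Lemma dunkl_linear i : linear (dunkl i).
Proof.
move=> c p q; rewrite !dunklE sumdivdiff_linear mderivD mderivZ.
by rewrite mulrnDl scalerMnr scalerBr opprD addrACA.
Qed.

HB.instance Definition _ i :=
  GRing.isLinear.Build R S S *:%R (dunkl i) (dunkl_linear i).

Lemma dunkl0 i : dunkl i 0 = 0. Proof. exact: linear0. Qed.
Lemma dunklD i p q : dunkl i (p + q) = dunkl i p + dunkl i q. Proof. exact: linearD. Qed.
Lemma dunklB i p q : dunkl i (p - q) = dunkl i p - dunkl i q. Proof. exact: linearB. Qed.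
Lemma dunklMn i a p : dunkl i (p *+ a) = dunkl i p *+ a. Proof. exact: linearMn. Qed.
Lemma dunklZ i c p : dunkl i (c *: p) = c *: dunkl i p. Proof. exact: linearZ. Qed.

Lemma msymC (s : 'S_n) (c : R) : msym s (c%:MP : S) = c%:MP.
Proof. by rewrite /msym mmapC. Qed.

Lemma dunklC i c : dunkl i c%:MP = 0.
Proof.
rewrite dunklE /sumdivdiff mderivC big1 ?mul0rn ?subr0 // => l _.
by rewrite divdiff_sym // msymC.
Qed.

Lemma dunkl_mulX i l p : l != i ->
  dunkl i ('X_l * p) = 'X_l * dunkl i p + sw i l p *+ k.
Proof.
move=> li; rewrite !dunklE mderivM mderivX mnm1E (negbTE li) scale0r mul0r add0r.
by rewrite sumdivdiff_mulX // mulrnBl mulrBr opprB mulrnAr addrA addrAC.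
Qed.

Lemma dunkl_mulXi i p :
  dunkl i ('X_i * p) = 'X_i * dunkl i p + p - sumsw i p *+ k.
Proof.
rewrite !dunklE mderivM mderivX mnm1E eqxx scale1r.
have -> : (U_(i) - U_(i) = 0)%MM by apply/mnmP => j; rewrite mnmBE mnm0E subnn.
by rewrite mpolyX0 mul1r sumdivdiff_mulXi mulrBr mulrnDl mulrnAr; ring.
Qed.

Lemma mderiv_msym (s : 'S_n) i p : msym s p^`M(i) = (msym s p)^`M(s i).
Proof.
apply/mpolyP => m; rewrite mcoeff_sym !mcoeff_deriv mcoeff_sym mnmE.
congr (p@_ _ *+ _); apply/mnmP => j; rewrite mnmDE !mnmE.
by rewrite (inj_eq perm_inj).
Qed.

Lemma dunkl_msym (s : 'S_n) i p : msym s (dunkl i p) = dunkl (s i) (msym s p).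
Proof.
rewrite !dunklE msymB msymMn mderiv_msym; congr (_ - _ *+ _); rewrite /sumdivdiff.
rewrite (raddf_sum (msym s)) [RHS](reindex_inj (@perm_inj _ s)) /=.
by apply: eq_bigr => j _; rewrite divdiff_msym.
Qed.

Lemma dunkl_sw i j p : dunkl i (sw i j p) = sw i j (dunkl j p).
Proof. by rewrite dunkl_msym tpermR. Qed.

Lemma dunkl_swD i j l p : i != j -> i != l -> dunkl i (sw j l p) = sw j l (dunkl i p).
Proof. by move=> ij il; rewrite dunkl_msym tpermD 1?eq_sym. Qed.

(** The commutator of two Dunkl operators kills constants and, by the product
    rules above, commutes with multiplication by each variable, hence
    vanishes. The argument is an induction on p. *)
Lemma dunkl_comm i j p : dunkl i (dunkl j p) = dunkl j (dunkl i p).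
Proof.
have [->//|ij] := eqVneq i j; move: i j ij p.
have key i j p : i != j -> dunkl i (dunkl j p) = dunkl j (dunkl i p) ->
    dunkl i (dunkl j ('X_i * p)) = dunkl j (dunkl i ('X_i * p)).
  move=> ij C.
  have E1 : dunkl i (dunkl j ('X_i * p)) = 'X_i * dunkl i (dunkl j p)
      + dunkl j p - sumsw i (dunkl j p) *+ k + sw i j (dunkl j p) *+ k.
    by rewrite (dunkl_mulX _ ij) dunklD dunklMn dunkl_mulXi (swC j i) dunkl_sw.
  have E2 : dunkl j (dunkl i ('X_i * p)) = 'X_i * dunkl j (dunkl i p)
      + sw i j (dunkl i p) *+ k + dunkl j p - dunkl j (sumsw i p) *+ k.
    rewrite dunkl_mulXi dunklB dunklD dunklMn (dunkl_mulX _ ij).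
    by rewrite (swC j i).
  have E3 : dunkl j (sumsw i p) - sw i j (dunkl i p) =
            sumsw i (dunkl j p) - sw i j (dunkl j p).
    have ji : j != i by rewrite eq_sym.
    have -> : dunkl j (sumsw i p) = \sum_(l | l != i) dunkl j (sw i l p).
      exact: raddf_sum.
    rewrite /sumsw (bigD1 j ji) /= [X in _ = X - _](bigD1 j ji) /=.
    rewrite (swC i j p) dunkl_sw (swC j i (dunkl i p)) [LHS]addrAC [RHS]addrAC.
    rewrite !subrr !add0r.
    by apply: eq_bigr => l /andP [li lj]; rewrite dunkl_swD // eq_sym.
  rewrite E1 E2 C; move/eqP: E3; rewrite subr_eq => /eqP ->.
  move: (sumsw i _) (sw i j (dunkl i p)) (sw i j _) => A B G.
  move: ('X_i * _) (dunkl j p) => E H.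
  by rewrite !mulrnDl mulNrn; ring.
move=> i j ij p; elim/mpoly_Xind: p => [c|p q Cp Cq|l p C].
- by rewrite !dunklC ?dunkl0.
- by rewrite !dunklD Cp Cq.
have [->|li] := eqVneq l i; first exact: key.
have [->|lj] := eqVneq l j; first by apply/esym/key; rewrite // eq_sym.
rewrite !(dunkl_mulX _ lj, dunkl_mulX _ li, dunklD, dunklMn) C.
have il : i != l by rewrite eq_sym.
have jl : j != l by rewrite eq_sym.
have ji : j != i by rewrite eq_sym.
rewrite (dunkl_swD p ij il) (dunkl_swD p ji jl).
exact: addrAC.
Qed.
End Dunkl.

(** * Polynomials in the Dunkl operators and their pairing *)

Section DunklMonomials.
Variables (R : idomainType) (n k : nat).
Local Notation S := {mpoly R[n]}.
Implicit Types (i j l : 'I_n) (p g h : S) (m : 'X_{1..n}).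
Local Notation D := (@dunkl R n k).

Definition Dmon m h : S := foldr (fun i => iter (m i) (D i)) h (enum 'I_n).

Lemma dunkl_iter i j a h : D i (iter a (D j) h) = iter a (D j) (D i h).
Proof. by elim: a => //= a IH; rewrite dunkl_comm IH. Qed.

Lemma dunkl_Dmon i m h : D i (Dmon m h) = Dmon m (D i h).
Proof. by rewrite /Dmon; elim: (enum _) => //= j s IH; rewrite dunkl_iter IH. Qed.

Lemma Dmon0 h : Dmon 0%MM h = h.
Proof. by rewrite /Dmon; elim: (enum _) => //= j s ->; rewrite mnm0E. Qed.

Lemma DmonU i m h : Dmon (U_(i) + m) h = D i (Dmon m h).
Proof.
have : i \in enum 'I_n by rewrite mem_enum.
rewrite /Dmon; have := enum_uniq 'I_n.
elim: (enum _) => //= j s IH /andP [js us]; rewrite inE mnmDE mnm1E.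
have [eij|ij] := eqVneq i j => /= is_; last by rewrite add0n IH // dunkl_iter.
subst j; rewrite add0n; congr (D _ (iter _ _ _)).
elim: s js {us is_ IH} => //= l s IH; rewrite inE negb_or mnmDE mnm1E => /andP [il ls].
by rewrite (negbTE il) add0n IH.
Qed.

Lemma iter_linear i a : linear (fun h => iter a (D i) h).
Proof. by move=> c g h; elim: a => //= a ->; rewrite linearP. Qed.

Lemma Dmon_linear m : linear (Dmon m).
Proof.
move=> c g h; rewrite /Dmon; elim: (enum _) => //= j s ->.
exact: (iter_linear j (m j)).
Qed.

HB.instance Definition _ m :=
  GRing.isLinear.Build R S S *:%R (Dmon m) (Dmon_linear m).

End DunklMonomials.

(** The polynomial g evaluated at the commuting operators D_i and applied to
    h. *)
HB.lock Definition opD (R : idomainType) (n k : nat) (g h : {mpoly R[n]}) :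
  {mpoly R[n]} := linext (fun m => Dmon k m h) g.

Section DunklPairing.
Variables (R : idomainType) (n k : nat).
Local Notation S := {mpoly R[n]}.
Implicit Types (i j l : 'I_n) (p g h : S) (m : 'X_{1..n}).
Local Notation D := (@dunkl R n k).
Local Notation Dmon := (@Dmon R n k).
Local Notation opD := (@opD R n k).

Lemma opDE g h : opD g h = linext (Dmon^~ h) g.
Proof. by rewrite opD.unlock. Qed.

Lemma opD_linear_l h : linear (opD^~ h).
Proof. by move=> c g1 g2; rewrite !opDE linearP. Qed.

Definition opDl h : {linear S -> S} :=
  HB.pack (opD^~ h) (GRing.isLinear.Build R S S *:%R (opD^~ h) (opD_linear_l h)).

Lemma opDD g1 g2 h : opD (g1 + g2) h = opD g1 h + opD g2 h.
Proof. exact: (linearD (opDl h)). Qed.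

Lemma opD0 h : opD 0 h = 0.
Proof. exact: (linear0 (opDl h)). Qed.

Lemma opDB g1 g2 h : opD (g1 - g2) h = opD g1 h - opD g2 h.
Proof. exact: (linearB (opDl h)). Qed.

Lemma opDMn g a h : opD (g *+ a) h = opD g h *+ a.
Proof. exact: (linearMn (opDl h)). Qed.

Lemma opD_sum (I : Type) (r : seq I) (P : pred I) (f : I -> S) h :
  opD (\sum_(i <- r | P i) f i) h = \sum_(i <- r | P i) opD (f i) h.
Proof. exact: (linear_sum (opDl h)). Qed.

Lemma opDZ c g h : opD (c *: g) h = c *: opD g h.
Proof. exact: (linearZZ (opDl h)). Qed.

Lemma opDX m h : opD 'X_[m] h = Dmon m h.
Proof. by rewrite opDE linextX. Qed.

Lemma opD_linear g : linear (opD g).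
Proof.
move=> c h1 h2; rewrite !opDE /linext scaler_sumr -big_split; apply: eq_bigr => m _ /=.
by rewrite linearP scalerDr !scalerA [c * _]mulrC.
Qed.

HB.instance Definition _ g :=
  GRing.isLinear.Build R S S *:%R (opD g) (opD_linear g).

Lemma opDrD g h1 h2 : opD g (h1 + h2) = opD g h1 + opD g h2.
Proof. exact: linearD. Qed.
Lemma opDrB g h1 h2 : opD g (h1 - h2) = opD g h1 - opD g h2.
Proof. exact: linearB. Qed.
Lemma opDrMn g a h : opD g (h *+ a) = opD g h *+ a.
Proof. exact: linearMn. Qed.
Lemma opDrZ g c h : opD g (c *: h) = c *: opD g h.
Proof. exact: linearZ. Qed.
Lemma opDr0 g : opD g 0 = 0.
Proof. exact: linear0. Qed.
Lemma opDr_sum (I : Type) (r : seq I) (P : pred I) (f : I -> S) g :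
  opD g (\sum_(i <- r | P i) f i) = \sum_(i <- r | P i) opD g (f i).
Proof. exact: linear_sum. Qed.

Lemma opDC c h : opD c%:MP h = c *: h.
Proof. by rewrite -[c%:MP]mulr1 mul_mpolyC opDZ -mpolyX0 opDX Dmon0. Qed.

Lemma opD_mulX i g h : opD ('X_i * g) h = D i (opD g h).
Proof.
elim/mpolyind: g => [|c m p _ _ IH].
  by rewrite mulr0 !opD0 dunkl0.
by rewrite mulrDr !opDD dunklD IH -scalerAr -mpolyXD !opDZ !opDX DmonU dunklZ.
Qed.

Lemma dunkl_opD i g h : D i (opD g h) = opD g (D i h).
Proof.
elim/mpolyind: g => [|c m p _ _ IH]; first by rewrite !opD0 dunkl0.
by rewrite !opDD dunklD IH !opDZ !opDX dunklZ dunkl_Dmon.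
Qed.

Lemma opDM f g h : opD (f * g) h = opD f (opD g h).
Proof.
elim/mpoly_Xind: f => [c|p q IHp IHq|i p IH].
- by rewrite mul_mpolyC opDZ opDC.
- by rewrite mulrDl !opDD IHp IHq.
- by rewrite -mulrA !opD_mulX IH.
Qed.

Lemma msym_opD (s : 'S_n) g h : msym s (opD g h) = opD (msym s g) (msym s h).
Proof.
elim/mpoly_Xind: g => [c|p q IHp IHq|i p IH].
- by rewrite msymC !opDC msymZ.
- by rewrite !(msymD, opDD) IHp IHq.
- by rewrite msymM msymXU !opD_mulX dunkl_msym IH.
Qed.

Definition cterm p : R := p@_0%MM.

Lemma ctermD p q : cterm (p + q) = cterm p + cterm q. Proof. exact: mcoeffD. Qed.
Lemma ctermB p q : cterm (p - q) = cterm p - cterm q. Proof. exact: mcoeffB. Qed.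
Lemma ctermZ c p : cterm (c *: p) = c * cterm p. Proof. exact: mcoeffZ. Qed.
Lemma ctermMn p a : cterm (p *+ a) = cterm p *+ a. Proof. exact: mcoeffMn. Qed.
Lemma cterm0 : cterm 0 = 0. Proof. exact: mcoeff0. Qed.
Lemma ctermC c : cterm c%:MP = c. Proof. by rewrite /cterm mcoeffC eqxx mulr1. Qed.
Lemma cterm_sum (I : Type) (r : seq I) (P : pred I) (f : I -> S) :
  cterm (\sum_(i <- r | P i) f i) = \sum_(i <- r | P i) cterm (f i).
Proof. exact: raddf_sum. Qed.

Lemma cterm_msym (s : 'S_n) p : cterm (msym s p) = cterm p.
Proof.
rewrite /cterm mcoeff_sym; congr (p@_ _).
by apply/mnmP => i; rewrite mnmE !mnm0E.
Qed.

Lemma cterm_mulX i p : cterm ('X_i * p) = 0.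
Proof. by rewrite /cterm mcoeff0_is_multiplicative mcoeffX mnm1_eq0 mul0r. Qed.

Lemma cterm_opD_sw i j g h :
  cterm (opD g (msym (tperm i j) h)) = cterm (opD (msym (tperm i j) g) h).
Proof. by rewrite -(cterm_msym (tperm i j)) msym_opD swK. Qed.

Lemma cterm_opD_sumsw i g h : cterm (opD g (sumsw i h)) = cterm (opD (sumsw i g) h).
Proof.
rewrite /sumsw opDr_sum opD_sum !cterm_sum; apply: eq_bigr => j _.
exact: cterm_opD_sw.
Qed.

(** Multiplication by a variable is adjoint to the Dunkl operator of the same
    index. Both sides satisfy the same recursion in g, because the commutator
    of D_l and x_i is self-adjoint. *)
Lemma cterm_opD_mulX i g h : cterm (opD g ('X_i * h)) = cterm (opD (D i g) h).
Proof.
elim/mpoly_Xind: g h => [c|p q IHp IHq|l g IH] h.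
- by rewrite dunklC opDC ctermZ cterm_mulX mulr0 opD0 cterm0.
- by rewrite dunklD !opDD !ctermD IHp IHq.
rewrite opD_mulX dunkl_opD.
have [->|li] := eqVneq l i.
  rewrite !dunkl_mulXi opDrB opDrD opDrMn opDB opDD opDMn opD_mulX dunkl_opD.
  by rewrite !(ctermB, ctermD, ctermMn) IH cterm_opD_sumsw.
have il : i != l by rewrite eq_sym.
rewrite (dunkl_mulX k h il) (dunkl_mulX k g li) opDrD opDrMn opDD opDMn opD_mulX dunkl_opD.
by rewrite !(ctermD, ctermMn) IH cterm_opD_sw tpermC.
Qed.

Lemma cterm_opD_const g c : cterm (opD g c%:MP) = c * cterm g.
Proof.
elim/mpoly_Xind: g => [a|p q IHp IHq|l g IH].
- by rewrite opDC ctermZ !ctermC mulrC.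
- by rewrite opDD !ctermD IHp IHq mulrDr.
- by rewrite opD_mulX dunkl_opD dunklC opDr0 cterm0 cterm_mulX mulr0.
Qed.

(** The symmetry of the pairing follows from the adjunction, moving the
    variables of h one by one to the other side. *)
Lemma cterm_opD_sym g h : cterm (opD g h) = cterm (opD h g).
Proof.
elim/mpoly_Xind: h g => [c|p q IHp IHq|l h IH] g.
- by rewrite cterm_opD_const opDC ctermZ.
- by rewrite opDD opDrD !ctermD IHp IHq.
- by rewrite cterm_opD_mulX IH opD_mulX dunkl_opD.
Qed.

Lemma dunkl_supp i p x : x \in msupp (D i p) -> exists2 m, m \in msupp p & lowers_degree x m.
Proof.
move=> xs; apply: NNPP => no; move: xs; rewrite mcoeff_msupp.
move/negP; apply; rewrite dunklE mcoeffB mcoeffMn mcoeff_deriv.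
have -> : (sumdivdiff i p)@_x = \sum_l (divdiff i l p)@_x by exact: raddf_sum.
rewrite big1 => [|l _].
  rewrite mul0rn subr0; case: (boolP (x + U_(i) \in msupp p)%MM) => [xp|xp].
    case: no; exists (x + U_(i))%MM => //; split; first by rewrite mdegD mdeg1 addn1.
    by move=> N b l; have := b l; rewrite mnmDE; lia.
  by rewrite memN_msupp_eq0 // mul0rn.
have -> : (divdiff i l p)@_x = \sum_(m <- msupp p) (divdiff i l (p@_m *: 'X_[m]))@_x.
  by rewrite {1}[p]mpolyE !linear_sum.
rewrite big_seq big1 // => m mp; rewrite linearZ mcoeffZ /=.
apply/eqP; rewrite mulf_eq0; apply/orP; right.
rewrite mcoeff_eq0; apply/negP => /divdiff_mon sm; apply: no; by exists m.
Qed.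

Definition bounded N p := forall m, m \in msupp p -> forall l, (m l <= N)%N.

Lemma dunkl_bounded N i p : bounded N p -> bounded N (D i p).
Proof. by move=> b x /dunkl_supp [m /b mN [_ h]]; apply: h. Qed.

Lemma boundedD N p q : bounded N p -> bounded N q -> bounded N (p + q).
Proof. by move=> bp bq m /msuppD_le; rewrite mem_cat => /orP [/bp|/bq]. Qed.

Lemma boundedZ N c p : bounded N p -> bounded N (c *: p).
Proof. by move=> bp m /msuppZ_le /bp. Qed.

Lemma opD_bounded N g p : bounded N p -> bounded N (opD g p).
Proof.
move=> bp; elim/mpoly_Xind: g => [c|g h Hg Hh|i g Hg].
- by rewrite opDC; apply: boundedZ.
- by rewrite opDD; apply: boundedD.
- by rewrite opD_mulX; apply: dunkl_bounded.
Qed.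

Lemma dunkl_homog i d p : p \is d.+1.-homog -> D i p \is d.-homog.
Proof.
move=> /dhomogP h; apply/dhomogP => x /dunkl_supp [m /h /= md [xm _]].
by apply: succn_inj; rewrite xm.
Qed.

Lemma dunkl_0homog i p : p \is 0.-homog -> D i p = 0.
Proof.
move=> /dhomogP h; apply/mpolyP => x; rewrite mcoeff0; apply/eqP.
rewrite mcoeff_eq0; apply/negP => /dunkl_supp [m /h /= md [xm _]].
by rewrite md in xm.
Qed.

Lemma Dmon_homog m d p : p \is (d + mdeg m).-homog -> Dmon m p \is d.-homog.
Proof.
elim/mnm_ind: m d p => [|i m IH] d p; first by rewrite mdeg0 addn0 Dmon0.
rewrite mdegD mdeg1 DmonU add1n -addSnnS => /IH; exact: dunkl_homog.
Qed.

Lemma Dmon_homog_lt m d p : p \is d.-homog -> (d < mdeg m)%N -> Dmon m p = 0.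
Proof.
elim/mnm_ind: m d p => [|i m IH] d p hp; first by rewrite mdeg0 ltn0.
rewrite mdegD mdeg1 DmonU add1n ltnS leq_eqVlt => /orP [/eqP dm|lt].
  by apply: dunkl_0homog; apply: Dmon_homog; rewrite add0n -dm.
by rewrite (IH _ _ hp lt) dunkl0.
Qed.

Lemma cterm_homog d p : p \is d.-homog -> d != 0%N -> cterm p = 0.
Proof.
by move=> hp d0; rewrite /cterm (dhomog_nemf_coeff hp) //= mdeg0 eq_sym.
Qed.

Lemma epowDmon_homog m d p : p \is d.-homog -> d != mdeg m -> cterm (Dmon m p) = 0.
Proof.
move=> hp; rewrite neq_ltn => /orP [lt|gt]; first by rewrite (Dmon_homog_lt hp) // cterm0.
apply: (@cterm_homog (d - mdeg m)); last by rewrite subn_eq0 -ltnNge.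
by apply: Dmon_homog; rewrite subnK // ltnW.
Qed.
End DunklPairing.

(** * Polynomials annihilated by all Dunkl operators but one *)

Section Integral.
Variables (F : fieldType) (n : nat).
Hypothesis char0 : forall m, m.+1%:R != 0 :> F.
Local Notation S := {mpoly F[n]}.
Implicit Types (i j l : 'I_n) (P Q : {poly S}) (g : S).

Definition psum a : S := \sum_l 'X_l ^+ a.

(** The sum over l of the integral of P from 0 to x_l, P being a polynomial in
    one variable with coefficients in the polynomial ring of the x_l. *)
Definition sumint P : S := \sum_(a < size P) (a.+1%:R^-1 : F) *: (P`_a * psum a.+1).

Lemma sumint_wide P m : (size P <= m)%N ->
  sumint P = \sum_(a < m) (a.+1%:R^-1 : F) *: (P`_a * psum a.+1).
Proof.
move=> le; rewrite /sumint (big_ord_widen _ (fun a => (a.+1%:R^-1 : F) *: (P`_a * psum a.+1)) le).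
rewrite big_mkcond; apply: eq_bigr => a _; case: ltnP => // sa.
by rewrite nth_default // mul0r scaler0.
Qed.

Lemma sumint_is_additive : additive sumint.
Proof.
move=> P Q; pose m := maxn (size P) (size Q).
rewrite !(@sumint_wide _ m) ?leq_maxl ?leq_maxr //; last first.
  by rewrite (leq_trans (size_polyD _ _)) // size_polyN.
rewrite -sumrB; apply: eq_bigr => a _.
by rewrite coefB mulrBl scalerBr.
Qed.

HB.instance Definition _ := GRing.isAdditive.Build {poly S} S sumint sumint_is_additive.

Lemma sumintZ g P : sumint (g *: P) = g * sumint P.
Proof.
rewrite (@sumint_wide _ (size P)) ?size_scale_leq // mulr_sumr; apply: eq_bigr => a _.
by rewrite coefZ -scalerAr mulrA.
Qed.

Lemma mderivXn l i a : ('X_i ^+ a : S)^`M(l) = if i == l then 'X_l ^+ a.-1 *+ a else 0.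
Proof.
rewrite mpolyXn mderivX mulmnE mnm1E; case: (i =P l) => [->|_]; last first.
  by rewrite mul0n scale0r.
rewrite mul1n scaler_nat mpolyXn; congr ('X_[_] *+ _).
apply/mnmP => j; rewrite mnmBE !mulmnE mnm1E; case: eqP => _; lia.
Qed.

Lemma mderiv_psum l a : (psum a.+1)^`M(l) = 'X_l ^+ a *+ a.+1.
Proof.
have -> : (psum a.+1)^`M(l) = \sum_i ('X_i ^+ a.+1 : S)^`M(l) by exact: raddf_sum.
rewrite (bigD1 l) //= big1 => [|i il]; rewrite mderivXn ?eqxx ?addr0 //.
by rewrite (negbTE il).
Qed.

(** Differentiation under the integral sign, plus the contribution of the
    bound x_l. *)
Lemma mderiv_sumint l P :
  (sumint P)^`M(l) = sumint (map_poly (mderiv l) P) + P.['X_l].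
Proof.
rewrite (@sumint_wide (map_poly _ _) (size P)); last by rewrite size_poly.
have -> : (sumint P)^`M(l) = \sum_(a < size P) ((a.+1%:R^-1 : F) *: (P`_a * psum a.+1))^`M(l).
  exact: raddf_sum.
rewrite horner_coef -big_split; apply: eq_bigr => a _ /=.
rewrite mderivZ mderivM scalerDr coef_map; congr (_ + _).
rewrite mderiv_psum mulrnAr -scaler_nat scalerA mulVf ?scale1r //.
Qed.

Lemma msym_psum (s : 'S_n) a : msym s (psum a) = psum a.
Proof.
rewrite /psum raddf_sum [RHS](reindex_inj (@perm_inj _ s)) /=.
by apply: eq_bigr => i _; rewrite rmorphXn /= msymXU.
Qed.

Lemma msym_sumint (s : 'S_n) P : msym s (sumint P) = sumint (map_poly (msym s) P).
Proof.
rewrite (@sumint_wide (map_poly _ _) (size P)); last by rewrite size_poly.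
rewrite raddf_sum; apply: eq_bigr => a _ /=.
by rewrite msymZ msymM msym_psum coef_map.
Qed.

(** P is homogeneous of degree T in its own variable and the x_l together. *)
Definition bihomog T P := forall a, P`_a \is (T - a).-homog /\ ((T < a)%N -> P`_a = 0).

Lemma bihomogM T1 T2 P Q : bihomog T1 P -> bihomog T2 Q -> bihomog (T1 + T2) (P * Q).
Proof.
move=> hP hQ a; rewrite coefM; split; last first.
  move=> lt; apply: big1 => b _; have [lt1|le1] := ltnP T1 b.
    by rewrite (hP b).2 // mul0r.
  by rewrite (hQ (a - b)%N).2 ?mulr0 //; lia.
apply: rpred_sum => b _; have [lt1|le1] := ltnP T1 b.
  by rewrite (hP b).2 // mul0r dhomog0.
have [lt2|le2] := ltnP T2 (a - b).
  by rewrite (hQ (a - b)%N).2 // mulr0 dhomog0.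
have lb := ltn_ord b.
have -> : (T1 + T2 - a = (T1 - b) + (T2 - (a - b)))%N by lia.
apply: dhomogM; [exact: (hP b).1 | exact: (hQ _).1].
Qed.

Lemma bihomog1 : bihomog 0 1.
Proof.
move=> a; rewrite coef1; case: a => [|a] /=; first by rewrite dhomog1.
by rewrite dhomog0.
Qed.

Lemma bihomogX : bihomog 1 'X.
Proof.
move=> a; rewrite coefX; case: a => [|[|a]] /=; rewrite ?dhomog0 //.
by rewrite dhomog1.
Qed.

Lemma bihomog_lin i : bihomog 1 ('X - ('X_i)%:P).
Proof.
move=> a; rewrite coefB coefX coefC; case: a => [|[|a]] /=.
- by rewrite sub0r rpredN dhomogX /= mdeg1.
- by rewrite subr0 dhomog1.
- by rewrite subr0 dhomog0.
Qed.

Lemma bihomogXn T P a : bihomog T P -> bihomog (T * a) (P ^+ a).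
Proof.
move=> hP; elim: a => [|a IH]; first by rewrite muln0; exact: bihomog1.
by rewrite exprS mulnS; apply: bihomogM.
Qed.

Lemma bihomog_prod (I : eqType) (r : seq I) (p : pred I) (f : I -> {poly S}) T :
  (forall x, bihomog T (f x)) -> bihomog (T * count p r) (\prod_(i <- r | p i) f i).
Proof.
move=> hf; elim: r => [|x r IH] /=; first by rewrite muln0 big_nil; exact: bihomog1.
rewrite big_cons; case: (p x) => //=.
by rewrite mulnDr muln1; apply: bihomogM.
Qed.

Lemma sumint_homog T P : bihomog T P -> sumint P \is T.+1.-homog.
Proof.
move=> hP; apply: rpred_sum => a _; apply: dhomogZ.
have [lt|le] := ltnP T a; first by rewrite (hP a).2 // mul0r dhomog0.
have -> : (T.+1 = (T - a) + a.+1)%N by lia.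
apply: dhomogM; first exact: (hP a).1.
apply: rpred_sum => l _; have X1 : ('X_l : S) \is 1.-homog by rewrite dhomogX /= mdeg1.
by have := dhomogMn a.+1 X1; rewrite mul1n.
Qed.
End Integral.

Section DerivationPoly.
Variables (A : comNzRingType) (d : {additive A -> A}).
Hypothesis dM : forall a b, d (a * b) = d a * b + a * d b.
Local Notation dp := (map_poly d).

Lemma map_polyM_der (P Q : {poly A}) : dp (P * Q) = dp P * Q + P * dp Q.
Proof.
apply/polyP => a; rewrite coefD !coefM coef_map coefM raddf_sum -big_split.
by apply: eq_bigr => b _; rewrite /= !coef_map dM.
Qed.

Lemma der1 : d 1 = 0.
Proof. by have := dM 1 1; rewrite !mulr1 mul1r -{1}[d 1]addr0 => /addrI. Qed.

Lemma map_poly_der1 : dp 1 = 0.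
Proof.
have d1 := der1.
by apply/polyP => a; rewrite coef_map coef1 coef0; case: (_ == _); rewrite /= ?d1 ?raddf0.
Qed.

Lemma map_poly_derX : dp 'X = 0.
Proof.
have d1 := der1.
by apply/polyP => a; rewrite coef_map coefX coef0; case: (_ == _); rewrite /= ?d1 ?raddf0.
Qed.

Lemma map_polyXn_der (P : {poly A}) m : dp (P ^+ m) = P ^+ m.-1 * dp P *+ m.
Proof.
elim: m => [|[|m] IH]; first by rewrite expr0 map_poly_der1 mulr0n.
  by rewrite expr1 expr0 mul1r.
by rewrite exprS map_polyM_der IH /= !exprS; ring.
Qed.

Lemma map_poly_prod_der0 (I : Type) (r : seq I) (p : pred I) (f : I -> {poly A}) :
  (forall i, p i -> dp (f i) = 0) -> dp (\prod_(i <- r | p i) f i) = 0.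
Proof.
move=> f0; apply: (big_rec (fun P => dp P = 0)); first exact: map_poly_der1.
by move=> i P pi P0; rewrite map_polyM_der f0 // P0 mul0r mulr0 addr0.
Qed.
End DerivationPoly.

HB.lock Definition lin (F : fieldType) (n : nat) (l : 'I_n) : {poly {mpoly F[n]}} :=
  'X - ('X_l)%:P.

HB.lock Definition rest (F : fieldType) (n k : nat) (A : pred 'I_n) :
  {poly {mpoly F[n]}} := \prod_(l | A l) lin F l ^+ k.

Section Joint.
Variables (F : fieldType) (n k' e : nat).
Hypothesis char0 : forall m, m.+1%:R != 0 :> F.
Local Notation S := {mpoly F[n]}.
Implicit Types (i j l : 'I_n).
Local Notation k := k'.+1.

Local Notation lin := (@lin F n).
Local Notation rest := (@rest F n k).

Lemma linE l : lin l = 'X - ('X_l)%:P. Proof. by rewrite lin.unlock. Qed.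
Lemma restE A : rest A = \prod_(l | A l) lin l ^+ k. Proof. by rewrite rest.unlock. Qed.

(** The integrand: all factors with exponent k, except that of index i which
    has one less. *)
Definition Hpol i : {poly S} := 'X^e * lin i ^+ k' * rest (fun l => l != i).

(** This is Hpol i divided by X - x_j, which is also Hpol j divided by X -
    x_i. *)
Definition Gpol i j : {poly S} :=
  'X^e * lin i ^+ k' * lin j ^+ k' * rest (fun l => (l != i) && (l != j)).

Lemma rest_split i j : i != j ->
  rest (fun l => l != i) = lin j ^+ k * rest (fun l => (l != i) && (l != j)).
Proof. by move=> ij; rewrite !restE (bigD1 j) 1?eq_sym. Qed.

Lemma Hpol_split i j : i != j -> Hpol i = lin j * Gpol i j.
Proof. move=> ij; rewrite /Hpol /Gpol (rest_split ij) (exprS (lin j) k').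
move: (rest _) (lin i ^+ k') (lin j ^+ k') (lin j) ('X^e : {poly S}) => A B C E G; ring. Qed.

Lemma Gpol_sym i j : Gpol i j = Gpol j i.
Proof.
rewrite /Gpol.
have -> : rest (fun l => (l != j) && (l != i)) =
    rest (fun l => (l != i) && (l != j)).
  by rewrite !restE; apply: eq_bigl => l; rewrite andbC.
by rewrite (mulrAC 'X^e (lin j ^+ k')).
Qed.

Lemma msym_lin (s : 'S_n) l : map_poly (msym s) (lin l) = lin (s l).
Proof. by rewrite !linE rmorphB /= map_polyX map_polyC /= msymXU. Qed.

Lemma msym_Hpol (s : 'S_n) i : map_poly (msym s) (Hpol i) = Hpol (s i).
Proof.
rewrite /Hpol !restE !rmorphM /= !rmorphXn /= map_polyX msym_lin rmorph_prod; congr (_ * _).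
rewrite [RHS](reindex_inj (@perm_inj _ s)) /=; apply: eq_big => [l|l _].
  by rewrite (inj_eq perm_inj).
by rewrite rmorphXn /= msym_lin.
Qed.

Lemma mderivXU l j : ('X_l : S)^`M(j) = (l == j)%:R.
Proof.
rewrite mderivX mnm1E; have [->|_] := eqVneq l j; last by rewrite scale0r.
have -> : (U_(j) - U_(j) = 0)%MM by apply/mnmP => i; rewrite mnmBE mnm0E subnn.
by rewrite mpolyX0 scale1r.
Qed.

Lemma mderiv_lin j l : map_poly (mderiv j) (lin l) = - (l == j)%:R.
Proof.
have z0 : 0^`M(j) = 0 :> S by exact: linear0.
have z1 : 1^`M(j) = 0 :> S by exact: mderivC.
rewrite linE; apply/polyP => a; rewrite coef_map /= coefB coefX coefC mderivB coefN.
have -> : ((l == j)%:R : {poly S}) = ((l == j)%:R : S)%:P by rewrite rmorph_nat.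
rewrite coefC; case: a => [|[|a]] /=.
- by rewrite mderivXU z0 sub0r.
- by rewrite z1 z0 subr0 oppr0.
- by rewrite z0 subr0 oppr0.
Qed.

Lemma mderiv_Hpol i j : i != j -> map_poly (mderiv j) (Hpol i) = - (Gpol i j *+ k).
Proof.
move=> ij; have dM := @mderivM n F j.
have d0 (A B : {poly S}) : map_poly (mderiv j) A = 0 -> map_poly (mderiv j) B = 0 ->
    map_poly (mderiv j) (A * B) = 0.
  by move=> A0 B0; rewrite (map_polyM_der dM) A0 B0 mul0r mulr0 addr0.
have dX (A : {poly S}) m : map_poly (mderiv j) A = 0 -> map_poly (mderiv j) (A ^+ m) = 0.
  by move=> A0; rewrite (map_polyXn_der dM) A0 mulr0 mul0rn.
have lin0 l : l != j -> map_poly (mderiv j) (lin l) = 0.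
  by move=> lj; rewrite mderiv_lin (negbTE lj) oppr0.
pose A := 'X^e * lin i ^+ k' * rest (fun l => (l != i) && (l != j)).
have A0 : map_poly (mderiv j) A = 0.
  apply: (d0 _ _ (d0 _ _ (dX _ _ (map_poly_derX dM)) (dX _ _ (lin0 _ ij)))).
  rewrite restE; apply: (map_poly_prod_der0 dM) => l /andP [_ lj].
  exact: (dX _ _ (lin0 _ lj)).
have -> : Hpol i = lin j ^+ k * A by rewrite /Hpol (rest_split ij) /A mulrCA.
rewrite (map_polyM_der dM) A0 mulr0 addr0 (map_polyXn_der dM) mderiv_lin eqxx /=.
rewrite mulrN1 mulNrn mulNr mulrnAl /A /Gpol; congr (- (_ *+ k)).
by rewrite mulrA mulrA (mulrAC 'X^e) -!mulrA mulrCA.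
Qed.

Lemma Hpol_root i j : i != j -> (Hpol i).['X_j] = 0.
Proof.
move=> ij; rewrite (Hpol_split ij) hornerM linE hornerD hornerN hornerX hornerC.
by rewrite subrr mul0r.
Qed.

Definition qpol i : S := sumint (Hpol i).

(** The derivative contributes -k times the integral of Gpol, since the
    boundary term vanishes. The divided difference of indices j and i is the
    opposite of this integral, and the others vanish by symmetry. *)
Lemma dunkl_qpol i j : i != j -> dunkl k j (qpol i) = 0.
Proof.
move=> ij; rewrite dunklE /qpol (mderiv_sumint char0) (mderiv_Hpol ij) (Hpol_root ij) addr0.
rewrite raddfN raddfMn /=.
have -> : sumdivdiff j (sumint (Hpol i)) = - sumint (Gpol i j).
  rewrite /sumdivdiff (bigD1 i isT) big1 /= ?addr0 => [|l li].
    apply: divdiff_uniq; first by rewrite eq_sym.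
    rewrite msym_sumint msym_Hpol tpermR -raddfB /= (Hpol_split ij).
    have ji : j != i by rewrite eq_sym.
    rewrite (Hpol_split ji) (Gpol_sym j i) -mulrBl.
    have -> : lin j - lin i = ('X_i - 'X_j)%:P.
      by rewrite !linE polyCB opprB addrC addrA subrK.
    by rewrite mul_polyC sumintZ; ring.
  have [->|lj] := eqVneq l j; first by rewrite divdiffii.
  by apply: divdiff_sym; rewrite msym_sumint msym_Hpol tpermD // eq_sym.
by rewrite mulNrn opprK addNr.
Qed.

Lemma qpol_homog i : qpol i \is (e + k * n).-homog.
Proof.
have n0 : (0 < n)%N by apply: leq_ltn_trans (ltn_ord i).
have -> : (e + k * n = (1 * e + 1 * k' + (1 * k) * n.-1).+1)%N.
  by case: n n0 => // m _ /=; lia.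
apply: sumint_homog; apply: bihomogM; first apply: bihomogM.
- exact/bihomogXn/bihomogX.
- by rewrite linE; exact/bihomogXn/bihomog_lin.
have <- : count (fun l => l != i) (index_enum 'I_n) = n.-1.
  have := cardC1 i; rewrite card_ord => <-.
  by rewrite -sum1_card -sum1_count; apply: eq_bigl => l; rewrite !inE.
by rewrite restE; apply: bihomog_prod => l; rewrite linE; exact/bihomogXn/bihomog_lin.
Qed.
End Joint.

(** * The annihilated polynomials have no common zero *)

Section Primitive.
Variable F : fieldType.
Hypothesis char0 : forall m, m.+1%:R != 0 :> F.
Implicit Types (p : {poly F}) (t u : F).

(** The primitive that vanishes at 0; it exists in characteristic 0. *)
Definition prim p : {poly F} :=
  \poly_(a < (size p).+1) (if a is b.+1 then b.+1%:R^-1 * p`_b else 0).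

Lemma coef_prim p a : (prim p)`_a = if a is b.+1 then b.+1%:R^-1 * p`_b else 0.
Proof.
rewrite coef_poly; case: ltnP => //; case: a => [|a] // le.
by rewrite nth_default // mulr0.
Qed.

Lemma prim_linear : linear prim.
Proof.
move=> c p q; apply/polyP => a; rewrite coefD coefZ !coef_prim.
case: a => [|a]; first by rewrite mulr0 addr0.
by rewrite coefD coefZ mulrDr mulrCA.
Qed.

HB.instance Definition _ :=
  GRing.isLinear.Build F {poly F} {poly F} *:%R prim prim_linear.

Lemma deriv_prim p : (prim p)^`() = p.
Proof.
apply/polyP => a; rewrite coef_deriv coef_prim -mulrnAl -[_^-1 *+ _]mulr_natl divff ?mul1r //.
Qed.

Lemma prim_0 p : (prim p).[0] = 0.
Proof. by rewrite horner_coef0 coef_prim. Qed.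

Lemma size_prim p : (size (prim p) <= (size p).+1)%N.
Proof. exact: size_poly. Qed.

(** Multiplicities at a zero drop by exactly one under differentiation in
    characteristic 0. *)
Lemma deriv_mult (U : {poly F}) t m : U.[t] = 0 -> ('X - t%:P) ^+ m %| U^`() ->
  ('X - t%:P) ^+ m.+1 %| U.
Proof.
have [->|U0] := eqVneq U 0; first by rewrite dvdp0.
move=> Ut; have [j [g]] := multiplicity_XsubC U t; rewrite U0 /= => gt UE.
case: j UE => [|j] UE.
  by move/rootP: Ut gt; rewrite UE expr0 mulr1 => ->.
have -> : U^`() = ('X - t%:P) ^+ j * (g^`() * ('X - t%:P) + g *+ j.+1).
  rewrite UE derivM deriv_exp derivXsubC mul1r exprS /=; ring.
have [lt|le _] := ltnP j m; last first.
  by rewrite UE dvdp_mull // dvdp_exp2l.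
rewrite -(subnK lt) addnC exprD exprSr -mulrA dvdp_mul2l ?expf_neq0 ?polyXsubC_eq0 //.
move/(dvdp_trans (dvdp_mulr _ (dvdpp _))); rewrite dvdp_XsubCl => /rootP.
rewrite hornerD hornerM hornerXsubC subrr mulr0 add0r hornerMn -mulr_natr => /eqP.
by rewrite mulf_eq0 (negbTE (char0 j)) orbF -rootE (negbTE gt).
Qed.

Lemma dvdp_prod_XsubC (ts : seq F) (m : F -> nat) (U : {poly F}) : uniq ts ->
  (forall t, t \in ts -> ('X - t%:P) ^+ m t %| U) ->
  \prod_(t <- ts) ('X - t%:P) ^+ m t %| U.
Proof.
elim: ts => [|t ts IH] /=; first by rewrite big_nil dvd1p.
move=> /andP [tts uts] h; rewrite big_cons Gauss_dvdp.
  by rewrite h ?inE ?eqxx // IH // => u us; rewrite h // inE us orbT.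
rewrite big_seq; apply: (big_ind (fun P => coprimep (('X - t%:P) ^+ m t) P)).
- exact: coprimep1.
- by move=> P Q cP cQ; rewrite coprimepMr cP cQ.
move=> u us; apply: coprimep_expl; apply: coprimep_expr.
rewrite coprimep_XsubC root_XsubC; apply: contraNneq tts => <-; exact: us.
Qed.

Lemma dvdp_XsubC_cancel t u m (A : {poly F}) :
  ('X - t%:P) ^+ m %| A * ('X - u%:P) ->
  ('X - t%:P) ^+ (if t == u then m.-1 else m) %| A.
Proof.
have [->|tu] := eqVneq t u; last first.
  have cop : coprimep (('X - t%:P) ^+ m) ('X - u%:P).
    by apply: coprimep_expl; rewrite coprimep_XsubC root_XsubC eq_sym.
  by rewrite Gauss_dvdpl.
case: m => [|m]; first by rewrite /= expr0 !dvd1p.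
by rewrite exprSr dvdp_mul2r // polyXsubC_eq0.
Qed.

Section Integrals.
Variables (n k' e : nat) (v : 'I_n -> F).
Local Notation k := k'.+1.

Definition wpol : {poly F} := 'X^e * \prod_l ('X - (v l)%:P) ^+ k.

(** The integrand specialised at v; it is wpol divided by its factor X - v
    i. *)
Definition hpol i : {poly F} :=
  'X^e * ('X - (v i)%:P) ^+ k' * \prod_(l | l != i) ('X - (v l)%:P) ^+ k.

Lemma hpol_wpol i : hpol i * ('X - (v i)%:P) = wpol.
Proof.
rewrite /hpol /wpol [in RHS](bigD1 i) //= exprSr.
by rewrite -!mulrA; congr (_ * (_ * _)); rewrite mulrC.
Qed.

Lemma wpol_neq0 : wpol != 0.
Proof.
rewrite mulf_neq0 ?expf_neq0 ?polyX_eq0 //.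
by apply/prodf_neq0 => l _; rewrite expf_neq0 // polyXsubC_eq0.
Qed.

Lemma hpol_neq0 i : hpol i != 0.
Proof. by have := wpol_neq0; rewrite -(hpol_wpol i) mulf_eq0 negb_or => /andP []. Qed.

Lemma size_hpol i : (size (hpol i)).+1 = size wpol.
Proof.
rewrite -(hpol_wpol i) (size_mul (hpol_neq0 i)) ?polyXsubC_eq0 // size_XsubC.
by rewrite addn2.
Qed.

Definition nu t : nat := \sum_(l | v l == t) 1.

Lemma wpol_fac (ts : seq F) : uniq ts -> (forall l, v l \in ts) ->
  \prod_l ('X - (v l)%:P) ^+ k = \prod_(t <- ts) ('X - t%:P) ^+ (k * nu t).
Proof.
move=> uts vts.
have -> : \prod_l ('X - (v l)%:P) ^+ k =
    \prod_l \prod_(t <- ts) (if v l == t then ('X - t%:P) ^+ k else 1).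
  apply: eq_bigr => l _; rewrite (bigD1_seq (v l)) //= eqxx big1 ?mulr1 // => t.
  by rewrite eq_sym => /negbTE ->.
rewrite exchange_big /=; apply: eq_bigr => t _.
rewrite -big_mkcond /= /nu; elim/big_rec2: _ => [|l a b _ ->]; first by rewrite muln0.
by rewrite mulnDr muln1 exprD.
Qed.

(** Let t_1, ..., t_s be the distinct nonzero values. The integrals from 0 to
    the t_b of the s quotients w / (X - t_a) form a matrix killed by the
    vector of multiplicities. So some nonzero combination of the quotients has
    a primitive U that vanishes at 0 and at all t_b. Counting multiplicities,
    X w divides U, so by degrees U = 0; but U is not 0 because the quotients
    are independent. *)
Lemma all_integrals_zero :
  (forall i, v i != 0 -> \sum_l (prim (hpol i)).[v l] = 0) -> forall i, v i = 0.
Proof.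
move=> int0 i0; apply/eqP; apply: contraT => vi0.
pose es := undup [seq v i | i <- enum 'I_n & v i != 0].
have ues : uniq es by exact: undup_uniq.
have esP t : (t \in es) = (t != 0) && [exists i, v i == t].
  rewrite mem_undup; apply/mapP/andP => [[i]|[t0 /existsP [i /eqP vi]]].
    by rewrite mem_filter => /andP [vi _] ->; split=> //; apply/existsP; exists i.
  by exists i => //; rewrite mem_filter mem_enum vi t0.
pose s := size es; pose eta (a : 'I_s) := es`_a.
have eta_in a : eta a \in es by exact: mem_nth.
have eta_inj : injective eta.
  by move=> a b /eqP; rewrite nth_uniq // => /eqP /val_inj.
have /fin_all_exists [idx idxE] : forall a, exists i, v i = eta a.
  by move=> a; have := eta_in a; rewrite esP => /andP [_ /existsP [i /eqP]]; exists i.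
have eta0 a : eta a != 0 by have := eta_in a; rewrite esP => /andP [].
pose h a := hpol (idx a).
have hE a : h a * ('X - (eta a)%:P) = wpol by rewrite -idxE hpol_wpol.
pose M := \matrix_(a < s, b < s) (prim (h a)).[eta b].
have es_sum (f : F -> F) : f 0 = 0 -> \sum_l f (v l) = \sum_b f (eta b) * (nu (eta b))%:R.
  move=> f0.
  have -> : \sum_l f (v l) = \sum_l \sum_(t <- es) (if v l == t then f t else 0).
    apply: eq_bigr => l _; have [vl0|vl0] := eqVneq (v l) 0.
      rewrite vl0 f0 big_seq big1 // => t; rewrite esP eq_sym => /andP [t0 _].
      by rewrite (negbTE t0).
    rewrite (bigD1_seq (v l)) //=; last first.
      by rewrite esP vl0; apply/existsP; exists l.
    by rewrite eqxx big1 ?addr0 // => t; rewrite eq_sym => /negbTE ->.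
  rewrite exchange_big /= (big_nth 0) big_mkord; apply: eq_bigr => b _.
  rewrite -big_mkcond /= sumr_const mulr_natr; congr (_ *+ _).
  by rewrite /nu sum1_card; apply: eq_card => l.
pose mu := \col_(b < s) ((nu (eta b))%:R : F).
have Mmu : M *m mu = 0.
  apply/matrixP => a b; rewrite !mxE.
  transitivity (\sum_l (prim (h a)).[v l]).
    rewrite (es_sum (fun t => (prim (h a)).[t])) ?prim_0 //.
    by apply: eq_bigr => c _; rewrite !mxE.
  by apply: int0; rewrite idxE.
have [c c0 cM] : exists2 c : 'rV_s, c != 0 & c *m M = 0.
  apply/det0P; rewrite -det_tr; apply/det0P; exists mu^T; last first.
    by rewrite -trmx_mul Mmu trmx0.
  have ie : v i0 \in es by rewrite esP vi0; apply/existsP; exists i0.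
  have lt : (index (v i0) es < s)%N by rewrite index_mem.
  apply/eqP => /matrixP /(_ 0 (Ordinal lt)) /eqP; rewrite !mxE /eta /= nth_index //.
  by rewrite /nu (bigD1 i0) //= add1n; apply/negP/char0.
pose p := \sum_a c 0 a *: h a.
have pb b : (prim p).[eta b] = 0.
  have /matrixP /(_ 0 b) := cM; rewrite !mxE => <-.
  rewrite linear_sum horner_sum; apply: eq_bigr => a _.
  by rewrite linearZ /= hornerZ mxE.
have p0 : p != 0.
  apply: contraNneq c0 => pz; apply/eqP/matrixP => x a; rewrite ord1 mxE.
  pose g := \sum_a c 0 a *: \prod_(b | b != a) ('X - (eta b)%:P).
  have : wpol * g = 0.
    rewrite -(mul0r (\prod_b ('X - (eta b)%:P))) -pz mulr_suml mulr_sumr.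
    apply: eq_bigr => b _; rewrite -scalerAr -scalerAl -(hE b); congr (_ *: _).
    by rewrite [in RHS](bigD1 b) //= mulrA.
  move/eqP; rewrite mulf_eq0 (negbTE wpol_neq0) /= => /eqP g0.
  have gE : g.[eta a] = c 0 a * \prod_(b | b != a) (eta a - eta b).
    rewrite /g horner_sum [LHS](bigD1 a) //= [X in _ + X]big1 => [|b ba].
      rewrite addr0 hornerZ horner_prod; congr (_ * _).
      by apply: eq_bigr => b _; rewrite hornerXsubC.
    rewrite hornerZ horner_prod; apply/eqP; rewrite mulf_eq0; apply/orP; right.
    by apply/prodf_eq0; exists a; rewrite 1?eq_sym // hornerXsubC subrr.
  move: gE; rewrite g0 horner0 => /esym/eqP; rewrite mulf_eq0.
  case/orP => [/eqP //|/prodf_eq0 [b ba]].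
  by rewrite subr_eq0 (inj_eq eta_inj) eq_sym (negbTE ba).
(* The multiplicities of the combination p: nothing is lost at 0, one at the
   other zeros of wpol. *)
pose m t := if t == 0 then (e + k * nu t)%N else (k * nu t).-1.
have uts : uniq (0 :: es) by rewrite /= ues andbT esP eqxx.
have vts l : v l \in 0 :: es.
  rewrite inE esP; case: eqVneq => //= _.
  by apply/existsP; exists l.
have prod_m : 'X * wpol = \prod_(t <- 0 :: es) ('X - t%:P) ^+ (m t).+1.
  rewrite /wpol (wpol_fac uts vts) !big_cons /m eqxx subr0 exprS exprD -!mulrA.
  congr (_ * (_ * (_ * _))); rewrite [LHS]big_seq [RHS]big_seq; apply: eq_bigr => t te.
  have := te; rewrite esP => /andP [/negbTE -> /existsP [l vl]].
  by rewrite prednK // /nu (bigD1 l) //= add1n mulnS.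
have dvd : 'X * wpol %| prim p.
  rewrite prod_m; apply: dvdp_prod_XsubC => // t tts; apply: deriv_mult.
    move: tts; rewrite inE => /orP [/eqP ->|te]; first exact: prim_0.
    have lt : (index t es < s)%N by rewrite index_mem.
    by have := pb (Ordinal lt); rewrite /eta /= nth_index.
  rewrite deriv_prim /p.
  elim/big_ind: _ => [|P Q dP dQ|a _]; [exact: dvdp0|exact: dvdp_add|].
  rewrite -mul_polyC dvdp_mull // /m.
  have dw : ('X - t%:P) ^+ ((if t == 0 then e else 0%N) + k * nu t) %| wpol.
    rewrite /wpol (wpol_fac uts vts) exprD dvdp_mul //; last first.
      by rewrite (bigD1_seq t) //= dvdp_mulr.
    by case: eqP => [->|_]; rewrite ?subr0 // expr0 dvd1p.
  rewrite -(hE a) in dw; have := dvdp_XsubC_cancel dw.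
  have [->|_] := eqVneq t 0; first by rewrite eq_sym (negbTE (eta0 a)).
  case: (t == eta a) => //; apply: dvdp_trans; apply: dvdp_exp2l; exact: leq_pred.
have sp : (size p < size wpol)%N.
  rewrite /p; apply: (big_ind (fun P : {poly F} => (size P < size wpol)%N)) => [|P Q dP dQ|a _].
  - by rewrite size_poly0 size_poly_gt0 wpol_neq0.
  - by apply: (leq_ltn_trans (size_polyD _ _)); rewrite gtn_max dP dQ.
  - by apply: (leq_ltn_trans (size_scale_leq _ _)); have := size_hpol (idx a); rewrite /h; lia.
have U0 : prim p != 0 by apply: contraNneq p0 => U0; rewrite -(deriv_prim p) U0 deriv0.
have := leq_trans (dvdp_leq U0 dvd) (size_prim p).
by rewrite mulrC size_mulX ?wpol_neq0 // ltnS leqNgt sp.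
Qed.

Lemma sumint_eval (P : {poly {mpoly F[n]}}) :
  (sumint P).@[v] = \sum_l (prim (map_poly (meval v) P)).[v l].
Proof.
have -> : (sumint P).@[v] = \sum_(a < size P) ((a.+1%:R^-1 : F) *: (P`_a * psum F n a.+1)).@[v].
  exact: raddf_sum.
transitivity (\sum_l \sum_(a < size P) (a.+1%:R^-1 * (P`_a).@[v]) * (v l) ^+ a.+1).
  rewrite exchange_big; apply: eq_bigr => a _ /=.
  rewrite mevalZ mevalM mulrA -mulr_sumr; congr (_ * _).
  rewrite /psum raddf_sum; apply: eq_bigr => l _ /=.
  by rewrite rmorphXn /= mevalXU.
apply: eq_bigr => l _.
have sz : (size (prim (map_poly (meval v) P)) <= (size P).+1)%N.
  by apply: leq_trans (size_prim _) _; rewrite ltnS size_poly.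
rewrite (horner_coef_wide _ sz) big_ord_recl coef_prim mul0r add0r.
by apply: eq_bigr => a _; rewrite coef_prim /= coef_map.
Qed.

Lemma map_Hpol i : map_poly (meval v) (Hpol F k' e i) = hpol i.
Proof.
have mlin l : map_poly (meval v) (lin F l) = 'X - (v l)%:P.
  by rewrite linE rmorphB /= map_polyX map_polyC /= mevalXU.
rewrite /Hpol /hpol restE !rmorphM /= !rmorphXn /= map_polyX mlin rmorph_prod.
by congr (_ * _); apply: eq_bigr => l _; rewrite rmorphXn /= mlin.
Qed.
End Integrals.

Theorem qpol_zero (n k' e : nat) (v : 'I_n -> F) :
  (forall i, v i != 0 -> (qpol F k' e i).@[v] = 0) -> forall i, v i = 0.
Proof.
move=> h; apply: (all_integrals_zero (k' := k') (e := e)) => i vi.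
by rewrite -(map_Hpol k' e v) -sumint_eval; apply: h.
Qed.
End Primitive.

(** * Nondegeneracy of the pairing *)

Section Duality.
Variables (F : closedFieldType) (n k' : nat).
Hypothesis char0 : forall m, m.+1%:R != 0 :> F.
Local Notation k := k'.+1.
Local Notation S := {mpoly F[n]}.
Local Notation D := (@dunkl F n k).
Local Notation opD := (@opD F n k).
Local Notation Dmon := (@Dmon F n k).
Implicit Types (i j l : 'I_n) (g h p : S) (m : 'X_{1..n}).

(** Its powers are killed by divided differences, so the Dunkl operators act
    on them as derivatives; they witness that the pairing with the top
    monomial is nonzero. *)
Definition sumX : S := \sum_i 'X_i.

Lemma dunkl_sumX i M : D i (sumX ^+ M) = M%:R *: sumX ^+ M.-1.
Proof.
rewrite dunklE.
have -> : sumdivdiff i (sumX ^+ M) = 0.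
  rewrite /sumdivdiff big1 // => l _; apply: divdiff_sym; rewrite rmorphXn /=; congr (_ ^+ M).
  rewrite /sumX raddf_sum [RHS](reindex_inj (@perm_inj _ (tperm i l))) /=.
  by apply: eq_bigr => j _; rewrite msymXU.
rewrite mul0rn subr0 scaler_nat.
have p1i : sumX^`M(i) = 1.
  have -> : sumX^`M(i) = \sum_j ('X_j : S)^`M(i) by exact: raddf_sum.
  rewrite (bigD1 i) //= mderivXU eqxx big1 ?addr0 // => j /negbTE ji.
  by rewrite mderivXU ji.
elim: M => [|[|M] IH]; first by rewrite expr0 mulr0n mderivC.
  by rewrite expr1 expr0 p1i.
rewrite exprS mderivM p1i mul1r IH /= mulrnAr -exprS.
by rewrite [RHS]mulrS.
Qed.

Lemma Dmon_sumX m M : Dmon m (sumX ^+ M) = (M ^_ (mdeg m))%:R *: sumX ^+ (M - mdeg m).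
Proof.
elim/mnm_ind: m => [|i m IH]; first by rewrite mdeg0 ffactn0 subn0 scale1r Dmon0.
rewrite DmonU IH dunklZ dunkl_sumX scalerA -natrM mdegD mdeg1 add1n ffactnSr.
by rewrite subnS.
Qed.

Section Level.
Variable e : nat.
Local Notation N := (e + k * n)%N.
Local Notation q := (qpol F k' e.+1).

Lemma q_homogN i : q i \is N.+1.-homog.
Proof. exact: qpol_homog. Qed.

(** A monomial of degree N + 1 with exponents at most N involves some x_j with
    j <> i, and D_j kills q i; so the monomial is orthogonal to q i, and the
    symmetry of the pairing turns this into the claim. Monomials of other
    degrees pair to 0 with q i. *)
Lemma cterm_q_bounded i p : bounded N p -> cterm (opD (q i) p) = 0.
Proof.
move=> bp; rewrite cterm_opD_sym opDE /linext cterm_sum big_seq big1 // => m mp.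
rewrite ctermZ; case: (boolP [exists j, (j != i) && (0 < m j)%N]) => [/existsP [j /andP [ji mj]]|].
  have -> : m = (U_(j) + (m - U_(j)))%MM.
    apply/mnmP => l; rewrite mnmDE mnmBE mnm1E.
    by case: (j =P l) => [<-|] /=; lia.
  rewrite DmonU dunkl_Dmon (dunkl_qpol k' e.+1 char0); last by rewrite eq_sym.
  by rewrite linear0 cterm0 mulr0.
rewrite negb_exists => /forallP no.
rewrite (epowDmon_homog k (q_homogN i)) ?mulr0 //.
rewrite mdegE (bigD1 i) //= big1 ?addn0 => [|j ji].
  by have := bp m mp i; rewrite neq_ltn ltnS => ->; rewrite orbT.
by have := no j; rewrite ji /= -leqNgt leqn0 => /eqP.
Qed.

Lemma in_ideal_cterm_bounded g p : in_ideal (qideal q) g -> bounded N p -> cterm (opD g p) = 0.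
Proof.
move=> gq bp; rewrite /qideal in gq.
elim: (enum _) g gq => [|i s IH] g /=; first by move=> ->; rewrite opD0 cterm0.
case=> a /IH; rewrite opDB ctermB mulrC opDM => /eqP; rewrite subr_eq0 => /eqP ->.
by apply: cterm_q_bounded; apply: opD_bounded.
Qed.

Definition topm : 'X_{1..n} := [multinom N | i < n].

Lemma mdeg_topm : mdeg topm = (n * N)%N.
Proof.
by rewrite mdegE (eq_bigr (fun=> N)) ?sum_nat_const ?card_ord // => i _; rewrite mnmE.
Qed.

Lemma bounded_top : bounded N ('X_[topm] : S).
Proof. by move=> m; rewrite msuppX inE => /eqP -> l; rewrite mnmE. Qed.

(** The linear form with which the quotient by the q i is tested in the
    Gorenstein argument. *)
Definition phi g : F := cterm (opD g 'X_[topm]).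

Lemma phi_linear : scalar phi.
Proof. by move=> c g h; rewrite /phi opDD opDZ ctermD ctermZ. Qed.

HB.instance Definition _ := GRing.isLinear.Build F S F *%R phi phi_linear.

(** The form phi kills the ideal of the q i and is nonzero on a power of sumX
    of the degree of the socle. *)
Lemma dunkl_gorenstein g :
  (forall m, cterm (opD g (opD 'X_[m] 'X_[topm])) = 0) -> in_ideal (qideal q) g.
Proof.
move=> h; apply: (@gorenstein F n N q q_homogN (qpol_zero char0 (k' := k') (e := e.+1))
  phi (sumX ^+ (n * N))).
- by move=> a aq; apply: in_ideal_cterm_bounded => //; exact: bounded_top.
- have X1 : sumX \is 1.-homog by apply: rpred_sum => i _; rewrite dhomogX /= mdeg1.
  by have := dhomogMn (n * N) X1; rewrite mul1n.
- rewrite /= /phi cterm_opD_sym opDX Dmon_sumX mdeg_topm subnn expr0 ctermZ ffactnn.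
  rewrite /cterm mcoeff1 eqxx mulr1.
  by case: ((n * N)`!) (fact_gt0 (n * N)) => // a _; apply: char0.
- by move=> m; rewrite /= /phi mulrC opDM.
Qed.

Lemma in_ideal_low g m : in_ideal (qideal q) g -> (mdeg m <= N)%N -> g@_m = 0.
Proof.
rewrite /qideal => gq le; elim: (enum _) g gq => [|i s IH] g /=.
  by move=> ->; rewrite mcoeff0.
case=> a /IH; rewrite mcoeffB => /eqP; rewrite subr_eq0 => /eqP ->.
rewrite mcoeffM big1 // => x /eqP mx.
rewrite (dhomog_nemf_coeff (q_homogN i)) ?mulr0 //= neq_ltn.
apply/orP; left; rewrite ltnS (leq_trans _ le) //.
by rewrite [leqRHS](congr1 (@mdeg n) mx) mdegD leq_addl.
Qed.
End Level.

(** An element orthogonal to everything lies in the ideal of the q i for all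
    levels N, and this ideal starts in degree N + 1. *)
Lemma cterm_nondeg g : (forall h, cterm (opD g h) = 0) -> g = 0.
Proof.
move=> g0; apply/mpolyP => m; rewrite mcoeff0.
apply: (@in_ideal_low (mdeg m)); last by rewrite leq_addr.
by apply: dunkl_gorenstein => x; apply: g0.
Qed.

(** The pairing respects degrees, so it is already nondegenerate on the
    polynomials of degree less than b, where a Gram matrix can be inverted. *)
Lemma cterm_represent (eta : 'X_{1..n} -> F) b :
  exists g, forall m, (mdeg m < b)%N -> cterm (opD g 'X_[m]) = eta m.
Proof.
pose T := 'X_{1..n < b}; pose s := #|{: T}|.
pose mo (a : 'I_s) : 'X_{1..n} := val (enum_val a).
pose gr := \matrix_(x < s, y < s) cterm (opD 'X_[mo x] 'X_[mo y]).
have gE (c : 'rV[F]_s) y : cterm (opD (\sum_x c 0 x *: 'X_[mo x]) 'X_[mo y]) = (c *m gr) 0 y.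
  rewrite mxE opD_sum cterm_sum; apply: eq_bigr => x _.
  by rewrite opDZ ctermZ mxE.
have moP m : (mdeg m < b)%N -> exists y, m = mo y.
  by move=> lt; exists (enum_rank (BMultinom lt)); rewrite /mo enum_rankK.
have gr_unit : gr \in unitmx.
  rewrite unitmxE unitfE; apply/negP => /det0P [c c0 cgr].
  pose g : S := \sum_x c 0 x *: 'X_[mo x].
  have g0 : g = 0.
    apply: cterm_nondeg => h; elim/mpolyind: h => [|a m h _ _ IH].
      by rewrite opDr0 cterm0.
    rewrite opDrD opDrZ ctermD ctermZ IH addr0.
    have [lt|le] := ltnP (mdeg m) b.
      by have [y ->] := moP m lt; rewrite gE cgr mxE mulr0.
    rewrite opD_sum cterm_sum big1 ?mulr0 // => x _; rewrite opDZ ctermZ opDX.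
    rewrite (@epowDmon_homog _ _ _ _ (mdeg m)) ?mulr0 // ?dhomogX //.
    by rewrite neq_ltn (leq_trans _ le) ?orbT // bmdeg.
  move/negP: c0; apply; apply/eqP/matrixP => i x; rewrite ord1 mxE.
  have := congr1 (mcoeff (mo x)) g0; rewrite mcoeff0 /g raddf_sum /= (bigD1 x) //=.
  rewrite mcoeffZ mcoeffX eqxx mulr1 big1 ?addr0 // => y yx.
  rewrite mcoeffZ mcoeffX; case: eqP => [/val_inj/enum_val_inj yx'|]; last by rewrite mulr0.
  by rewrite yx' eqxx in yx.
pose c := \row_y eta (mo y) *m invmx gr.
exists (\sum_x c 0 x *: 'X_[mo x]) => m /moP [y ->].
by rewrite gE /c mulmxKV // mxE.
Qed.

(** Represent eta by g on the polynomials with bounded exponents. The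
    hypothesis says that g is orthogonal to all r(D) applied to the top
    monomial, so g is in the ideal of the q i, which pairs to zero with such
    polynomials. *)
Theorem dunkl_functional0 (eta : {scalar S}) :
  (forall m, eta (opD 'X_[m] 'X_[topm 0]) = 0) ->
  forall p, bounded (k * n) p -> eta p = 0.
Proof.
move=> h; have [g gE] := cterm_represent (fun m => eta 'X_[m]) (n * (0 + k * n)).+1.
have gB p : bounded (k * n) p -> eta p = cterm (opD g p).
  move=> bp; rewrite [p]mpolyE linear_sum opDr_sum cterm_sum big_seq [RHS]big_seq.
  apply: eq_bigr => m mp; rewrite linearZ /= opDrZ ctermZ gE // ltnS mdegE.
  rewrite (leq_trans (n := \sum_(i < n) (0 + k * n)))//; first last.
    by rewrite sum_nat_const card_ord.
  by apply: leq_sum => i _; apply: bp.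
move=> p bp; rewrite gB //.
apply: (@in_ideal_cterm_bounded 0); last exact: bp.
apply: dunkl_gorenstein => m; rewrite -gB ?h //.
by apply: opD_bounded; exact: bounded_top.
Qed.
End Duality.

(** * Operators acting on coefficients *)

Section Coefficientwise.
Variables (R R' : idomainType) (n k : nat).
Variable f : {additive R -> R'}.
Local Notation M := (@map_mpoly n R R' f).

Lemma map_mpolyZX c m : M (c *: 'X_[m]) = f c *: 'X_[m].
Proof.
apply/mpolyP => x; rewrite mcoeff_map_mpoly !mcoeffZ !mcoeffX.
by case: (m == x); rewrite ?mulr1 ?mulr0 ?raddf0.
Qed.

Lemma map_mpoly_mulX j p : M ('X_j * p) = 'X_j * M p.
Proof.
elim/mpolyind: p => [|c m p _ _ IH]; first by rewrite mulr0 raddf0 mulr0.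
rewrite mulrDr !raddfD /= mulrDr IH; congr (_ + _).
by rewrite -scalerAr -mpolyXD !map_mpolyZX -scalerAr -mpolyXD.
Qed.

Lemma map_mpoly_msym (s : 'S_n) p : M (msym s p) = msym s (M p).
Proof. by apply/mpolyP => m; rewrite mcoeff_map_mpoly !mcoeff_sym mcoeff_map_mpoly. Qed.

Lemma map_mpoly_divdiff i j p : M (divdiff i j p) = divdiff i j (M p).
Proof.
have [->|ij] := eqVneq i j; first by rewrite !divdiffii raddf0.
apply/esym; apply: (divdiff_uniq ij).
by rewrite mulrBl -!map_mpoly_mulX -raddfB -mulrBl divdiffE raddfB /= map_mpoly_msym.
Qed.

Lemma map_mpoly_mderiv i p : M p^`M(i) = (M p)^`M(i).
Proof.
apply/mpolyP => m; rewrite mcoeff_map_mpoly !mcoeff_deriv mcoeff_map_mpoly.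
by rewrite raddfMn.
Qed.

Lemma map_mpoly_dunkl i p : M (dunkl k i p) = dunkl k i (M p).
Proof.
rewrite !dunklE raddfB raddfMn /= map_mpoly_mderiv; congr (_ - _ *+ k).
rewrite /sumdivdiff raddf_sum; apply: eq_bigr => j _ /=.
exact: map_mpoly_divdiff.
Qed.
End Coefficientwise.

Lemma map_mpoly_compose (R : idomainType) n (f g h : {additive R -> R}) (p : {mpoly R[n]}) :
  (forall x, f x = g (h x)) -> map_mpoly f p = map_mpoly g (map_mpoly h p).
Proof. by move=> fgh; apply/mpolyP => m; rewrite !mcoeff_map_mpoly fgh. Qed.

Section CoefficientwiseRing.
Variables (R : idomainType) (n : nat).
Local Notation M := (@map_mpoly n R R).

Lemma map_mpolyM_der (d : {additive R -> R}) p q :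
  (forall a b, d (a * b) = d a * b + a * d b) ->
  M d (p * q) = M d p * q + p * M d q.
Proof.
move=> dM; apply/mpolyP => m; rewrite mcoeff_map_mpoly mcoeffD !mcoeffM raddf_sum.
rewrite -big_split; apply: eq_bigr => x _ /=.
by rewrite !mcoeff_map_mpoly dM.
Qed.
End CoefficientwiseRing.

(** * The kernel of the Dunkl operators *)

Section ProductRule.
Variables (A : comNzRingType) (d : A -> A) (I : finType) (f : I -> A) (k' : nat).
Hypothesis dM : forall a b, d (a * b) = d a * b + a * d b.

(** The product of all k-th powers divided by f x. *)
Definition prodbut x := f x ^+ k' * \prod_(y | y != x) f y ^+ k'.+1.

Lemma prodbutE x : f x * prodbut x = \prod_y f y ^+ k'.+1.
Proof. by rewrite /prodbut mulrA -exprS [RHS](bigD1 x). Qed.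

(** The logarithmic derivative of a product of k-th powers, with the divisions
    carried out. *)
Lemma product_rule : d (\prod_x f x ^+ k'.+1) = (\sum_x d (f x) * prodbut x) *+ k'.+1.
Proof.
have d1 : d 1 = 0 by have := dM 1 1; rewrite !mulr1 mul1r -{1}[d 1]addr0 => /addrI.
have dX a m : d (a ^+ m.+1) = (d a * a ^+ m) *+ m.+1.
  elim: m => [|m IH]; first by rewrite expr1 expr0 mulr1.
  by rewrite exprS dM IH mulrnAr mulrCA -exprS [RHS]mulrS.
have gen (s : seq I) : uniq s -> d (\prod_(x <- s) f x ^+ k'.+1) =
    (\sum_(x <- s) d (f x) * (f x ^+ k' * \prod_(y <- s | y != x) f y ^+ k'.+1)) *+ k'.+1.
  elim: s => [|x s IH] /=; first by rewrite !big_nil d1 mul0rn.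
  move=> /andP [xs us]; rewrite !big_cons eqxx /= dM IH // dX mulrnDl mulrnAl -!mulrA.
  congr (_ + _).
    congr ((_ * (_ * _)) *+ _); rewrite big_seq [RHS]big_seq_cond; apply: eq_bigl => y.
    by case: eqP => [->|]; rewrite ?(negbTE xs) ?andbF ?andbT.
  rewrite mulrnAr; congr (_ *+ _); rewrite mulr_sumr big_seq [RHS]big_seq.
  apply: eq_bigr => y ys; rewrite big_cons.
  have -> : x != y by apply: contraNneq xs => ->.
  by rewrite mulrCA; congr (_ * _); rewrite mulrCA.
exact: (gen (index_enum I) (index_enum_uniq I)).
Qed.
End ProductRule.

Lemma iter_addN (V : zmodType) (I : Type) (s : seq I) (g : V -> V) (h : I -> V) r m :
  additive g ->
  iter r g (- ((\sum_(i <- s) h i) *+ m)) = - ((\sum_(i <- s) iter r g (h i)) *+ m).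
Proof.
move=> ga; have ia : additive (iter r g) by move=> a b; elim: r => //= r ->.
pose G : {additive V -> V} := HB.pack (iter r g) (GRing.isAdditive.Build V V _ ia).
by rewrite -[LHS]/(G _) raddfN raddfMn raddf_sum.
Qed.

Definition neg_power_sum (R : idomainType) n k r (p : {mpoly R[n]}) : {mpoly R[n]} :=
  \sum_j iter r (fun x => - dunkl k j x) p.

Section Kernel.
Variables (R : idomainType) (n k' : nat) (t : 'I_n -> R).
Variables (Dt dt : 'I_n -> {additive R -> R}) (ddt : 'I_n -> 'I_n -> {additive R -> R}).
Variable (st : 'I_n -> 'I_n -> {rmorphism R -> R}).
Local Notation k := k'.+1.
Hypothesis Dt_mul : forall i p,
  Dt i (t i * p) = t i * Dt i p + p - (\sum_(a | a != i) st i a p) *+ k.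
Hypothesis stt : forall i a l, st i a (t l) = t (tperm i a l).
Hypothesis dtM : forall i a b, dt i (a * b) = dt i a * b + a * dt i b.
Hypothesis dtt : forall i l, dt i (t l) = (l == i)%:R.
Hypothesis DtE : forall i p, Dt i p = dt i p - (\sum_l ddt i l p) *+ k.
Hypothesis ddtE : forall i l p, (t i - t l) * ddt i l p = p - st i l p.
Hypothesis ddtii : forall i p, ddt i i p = 0.
Hypothesis t_neq : forall i l, i != l -> t i - t l != 0.

Local Notation Z := {mpoly R[n]}.
Local Notation M := (@map_mpoly n R R).
Implicit Types (i j l a : 'I_n) (p : Z).

Definition zsubt (x : 'I_n * 'I_n) : Z := 'X_(x.2) - (t x.1)%:MP.
Definition kerprod : Z := \prod_x zsubt x ^+ k.
Definition kerquot i j : Z := prodbut zsubt k' (i, j).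

Lemma zsubtK i j : zsubt (i, j) * kerquot i j = kerprod.
Proof. exact: prodbutE. Qed.

Lemma zsubt_neq0 x : zsubt x != 0.
Proof.
apply/eqP => /(congr1 (mcoeff U_(x.2))); rewrite mcoeffB mcoeffX eqxx mcoeffC mnm1_eq0.
by rewrite mulr0 subr0 mcoeff0 => /eqP; rewrite oner_eq0.
Qed.

Lemma msym_kerprod (s : 'S_n) : msym s kerprod = kerprod.
Proof.
rewrite /kerprod rmorph_prod [RHS](reindex_inj (h := fun x => (x.1, s x.2))) /=.
  by apply: eq_bigr => x _; rewrite rmorphXn /= /zsubt msymB msymXU msymC.
by move=> [a b] [c d] [-> /perm_inj ->].
Qed.

Lemma map_st_zsubt i a x : M (st i a) (zsubt x) = zsubt (tperm i a x.1, x.2).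
Proof. by rewrite /zsubt raddfB /= map_mpolyX map_mpolyC /= stt. Qed.

Lemma map_st_kerprod i a : M (st i a) kerprod = kerprod.
Proof.
have -> : M (st i a) kerprod = \prod_x M (st i a) (zsubt x ^+ k) by exact: rmorph_prod.
rewrite /kerprod [RHS](reindex_inj (h := fun x => (tperm i a x.1, x.2))) /=.
  by apply: eq_bigr => x _; rewrite rmorphXn /= map_st_zsubt.
by move=> [b c] [b' c'] [/perm_inj -> ->].
Qed.

Lemma msym_kerquot i j l : msym (tperm j l) (kerquot i j) = kerquot i l.
Proof.
apply: (mulfI (zsubt_neq0 (i, l))); rewrite zsubtK -(msym_kerprod (tperm j l)) -(zsubtK i j).
by rewrite msymM /zsubt msymB msymXU msymC tpermL.
Qed.

Lemma map_st_kerquot i a j : M (st i a) (kerquot i j) = kerquot a j.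
Proof.
apply: (mulfI (zsubt_neq0 (a, j))); rewrite zsubtK -(map_st_kerprod i a) -(zsubtK i j).
have -> : M (st i a) (zsubt (i, j) * kerquot i j) =
    M (st i a) (zsubt (i, j)) * M (st i a) (kerquot i j).
  exact: rmorphM.
by rewrite map_st_zsubt /= tpermL.
Qed.

Lemma dunkl_kerprod j : dunkl k j kerprod = (\sum_i kerquot i j) *+ k.
Proof.
rewrite dunklE /sumdivdiff big1 => [|l _]; last by rewrite divdiff_sym ?msym_kerprod.
rewrite mul0rn subr0 (product_rule zsubt k' (@mderivM n R j)); congr (_ *+ k).
rewrite -(pair_big xpredT xpredT (fun a b => (zsubt (a, b))^`M(j) * prodbut zsubt k' (a, b))) /=.
apply: eq_bigr => i _; have yd b : (zsubt (i, b))^`M(j) = (b == j)%:R.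
  rewrite mderivB mderivC subr0 /= mderivX mnm1E; have [->|_] := eqVneq b j.
    have -> : (U_(j) - U_(j) = 0)%MM by apply/mnmP => l; rewrite mnmBE mnm0E subnn.
    by rewrite mpolyX0 scale1r.
  by rewrite scale0r.
rewrite (bigD1 j) //= yd eqxx mul1r big1 ?addr0 // => b /negbTE bj.
by rewrite yd bj mul0r.
Qed.

Lemma map_Dt p i : M (Dt i) p = M (dt i) p - (\sum_l M (ddt i l) p) *+ k.
Proof.
apply/mpolyP => m; rewrite mcoeffB mcoeffMn (mcoeff_map_mpoly (Dt i)) DtE.
rewrite (mcoeff_map_mpoly (dt i)) (raddf_sum (mcoeff m)).
by congr (_ - _ *+ k); apply: eq_bigr => l _; rewrite /= mcoeff_map_mpoly.
Qed.

Lemma map_Dt_kerprod i : M (Dt i) kerprod = - ((\sum_j kerquot i j) *+ k).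
Proof.
rewrite map_Dt big1 => [|l _]; last first.
  apply/mpolyP => m; rewrite mcoeff_map_mpoly mcoeff0.
  have [<-|il] := eqVneq i l; first exact: ddtii.
  apply: (mulfI (t_neq il)); rewrite mulr0 ddtE.
  by rewrite -[st i l _](mcoeff_map_mpoly (st i l)) map_st_kerprod subrr.
have dM p q : M (dt i) (p * q) = M (dt i) p * q + p * M (dt i) q.
  by apply: map_mpolyM_der; exact: dtM.
rewrite mul0rn subr0 (product_rule zsubt k' dM) -mulNrn; congr (_ *+ k).
rewrite -(pair_big xpredT xpredT (fun a b => M (dt i) (zsubt (a, b)) * prodbut zsubt k' (a, b))) /=.
have d1 : dt i 1 = 0 by have := dtM i 1 1; rewrite !mulr1 mul1r -{1}[dt i 1]addr0 => /addrI.
have yd a b : M (dt i) (zsubt (a, b)) = - (a == i)%:R.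
  rewrite /zsubt raddfB /= map_mpolyC /= dtt.
  rewrite -['X_b]scale1r map_mpolyZX d1 scale0r sub0r.
  by rewrite mpolyC_nat.
rewrite (bigD1 i) //= [X in _ + X]big1 ?addr0 => [|a /negbTE ai].
  by rewrite -sumrN; apply: eq_bigr => b _; rewrite yd eqxx mulN1r.
by rewrite big1 // => b _; rewrite yd ai oppr0 mul0r.
Qed.

(** Apply the Dunkl operator to kerprod = zsubt * kerquot with the product
    rule, and compare with its direct computation on kerprod. *)
Lemma dunkl_kerquot i j : zsubt (i, j) * dunkl k j (kerquot i j) =
  (\sum_a kerquot a j) *+ k - kerquot i j + (\sum_(l | l != j) kerquot i l) *+ k.
Proof.
rewrite -dunkl_kerprod -(zsubtK i j) [in dunkl k j (_ * _)]mulrBl.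
rewrite dunklB dunkl_mulXi mul_mpolyC dunklZ.
have -> : sumsw j (kerquot i j) = \sum_(l | l != j) kerquot i l.
  by apply: eq_bigr => l _; rewrite msym_kerquot.
rewrite /zsubt /= mulrBl mul_mpolyC.
move: ('X_j * dunkl k j (kerquot i j)) (t i *: dunkl k j (kerquot i j)) => A B.
move: ((\sum_(l | l != j) kerquot i l) *+ k) (kerquot i j) => E C.
ring.
Qed.

Lemma map_Dt_kerquot i j : zsubt (i, j) * M (Dt i) (kerquot i j) =
  kerquot i j - (\sum_l kerquot i l) *+ k - (\sum_(a | a != i) kerquot a j) *+ k.
Proof.
have E : M (Dt i) kerprod = zsubt (i, j) * M (Dt i) (kerquot i j) - kerquot i j
   + (\sum_(a | a != i) kerquot a j) *+ k.
  rewrite -(zsubtK i j) [in LHS]mulrBl raddfB /= map_mpoly_mulX.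
  have -> : M (Dt i) ((t i)%:MP * kerquot i j) = (t i)%:MP * M (Dt i) (kerquot i j) + kerquot i j
      - (\sum_(a | a != i) kerquot a j) *+ k.
    apply/mpolyP => m; rewrite (mcoeff_map_mpoly (Dt i)) mcoeffCM Dt_mul.
    rewrite mcoeffB mcoeffD mcoeffMn mcoeffCM (mcoeff_map_mpoly (Dt i)) (raddf_sum (mcoeff m)).
    congr (_ - _ *+ k); apply: eq_bigr => a _.
    by rewrite -(map_st_kerquot i a j) /= (mcoeff_map_mpoly (st i a)).
  rewrite /zsubt /= mulrBl.
  move: ('X_j * M (Dt i) (kerquot i j)) ((t i)%:MP * M (Dt i) (kerquot i j)) => A B.
  move: ((\sum_(a | a != i) kerquot a j) *+ k) (kerquot i j) => C G; ring.
rewrite map_Dt_kerprod in E; move: E.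
move: (zsubt (i, j) * M (Dt i) (kerquot i j)) ((\sum_(a | a != i) kerquot a j) *+ k) => A B.
move: ((\sum_l kerquot i l) *+ k) (kerquot i j) => C G E.
have -> : A = (A - G + B) + G - B by ring.
by rewrite -E; ring.
Qed.

(** On each quotient of the kernel the operator in the variable t_i is the
    opposite of the operator in z_j: both were computed up to the nonzero
    factor z_j - t_i. *)
Lemma Dt_Dz_kerquot i j : M (Dt i) (kerquot i j) = - dunkl k j (kerquot i j).
Proof.
apply: (mulfI (zsubt_neq0 (i, j))); rewrite map_Dt_kerquot mulrN dunkl_kerquot.
rewrite [\sum_l kerquot i l](bigD1 j) //= [\sum_a kerquot a j](bigD1 i) //=.
move: (\sum_(_ | _) _) (\sum_(_ | _) _) (kerquot i j) => A B C.
by rewrite !mulrnDl; move: (A *+ k) (B *+ k) (C *+ k) => X Y V; ring.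
Qed.

Lemma map_Dt_iter i j r p : M (Dt i) (iter r (fun x => - dunkl k j x) p) =
  iter r (fun x => - dunkl k j x) (M (Dt i) p).
Proof. by elim: r => //= r IH; rewrite raddfN /= map_mpoly_dunkl IH. Qed.

Lemma kernel_iter i j r :
  iter r (M (Dt i)) (kerquot i j) = iter r (fun x => - dunkl k j x) (kerquot i j).
Proof.
elim: r => // r IH; rewrite iterS IH map_Dt_iter iterSr; congr (iter _ _ _).
exact: Dt_Dz_kerquot.
Qed.

(** The first application of an operator turns the kernel into the sum of its
    quotients; on these t_i and z_j act by opposite operators, and operators
    in t commute with operators in z. *)
Lemma kernel_power r : \sum_i iter r (M (Dt i)) kerprod = neg_power_sum k r kerprod.
Proof.
case: r => [|r]; first by [].
have Dz_add j : additive (fun x : Z => - dunkl k j x).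
  by move=> p q; rewrite dunklB opprB opprK addrC.
have E1 i : iter r.+1 (M (Dt i)) kerprod = - ((\sum_j iter r (M (Dt i)) (kerquot i j)) *+ k).
  by rewrite iterSr map_Dt_kerprod (@iter_addN _ _ _ _ _ _ _ (map_mpoly_is_additive (Dt i))).
have E2 j : iter r.+1 (fun x : Z => - dunkl k j x) kerprod =
    - ((\sum_i iter r (fun x : Z => - dunkl k j x) (kerquot i j)) *+ k).
  by rewrite iterSr dunkl_kerprod (@iter_addN _ _ _ _ _ _ _ (Dz_add j)).
rewrite /neg_power_sum (eq_bigr _ (fun i _ => E1 i)) (eq_bigr _ (fun j _ => E2 j)).
rewrite [LHS]sumrN [RHS]sumrN [in LHS]sumrMnl [in RHS]sumrMnl exchange_big /=.
have -> : \sum_j \sum_i iter r (M (Dt i)) (kerquot i j) =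
    \sum_j \sum_i iter r (fun x : Z => - dunkl k j x) (kerquot i j).
  by apply: eq_bigr => j _; apply: eq_bigr => i _; apply: kernel_iter.
by [].
Qed.
End Kernel.

(** * Monomial symmetric sums from power sums *)

Section PowerSums.
Variables (F : fieldType) (n : nat).
Local Notation S := {mpoly F[n]}.
Implicit Types (b : seq nat) (s : seq 'I_n).

Fixpoint expprod b s : S :=
  match b, s with c :: b', i :: s' => 'X_i ^+ c * expprod b' s' | _, _ => 1 end.

Fixpoint allseqs r : seq (seq 'I_n) :=
  if r is r'.+1 then [seq i :: s | i <- enum 'I_n, s <- allseqs r'] else [:: [::]].

Fixpoint add_at_each_entry c b : seq (seq nat) :=
  if b is d :: b' then ((c + d)%N :: b') ::
    [seq d :: b'' | b'' <- add_at_each_entry c b'] else [::].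

(** The sum over all words of distinct indices, a multiple of the monomial
    symmetric polynomial of exponents b. *)
Definition msum b : S := \sum_(s <- allseqs (size b) | uniq s) expprod b s.

Lemma size_add_at_each_entry c b b' : b' \in add_at_each_entry c b -> size b' = size b.
Proof.
elim: b b' => //= d b IH b'; rewrite inE => /orP [/eqP -> //|/mapP [b'' /IH]].
by move=> sb ->; rewrite /= sb.
Qed.

Lemma mem_allseqs r s : (s \in allseqs r) = (size s == r).
Proof.
elim: r s => [|r IH] [|i s] //=.
- by apply/negbTE/allpairsP => [[[j u] []]].
- rewrite eqSS -IH; apply/allpairsP/idP => [[[j u] /= [_ us [_ ->]]] //|ss].
  by exists (i, s); rewrite mem_enum.
Qed.

Lemma expprod_add_at_each_entry c b s : size s = size b ->
  \sum_(b' <- add_at_each_entry c b) expprod b' s = (\sum_(i <- s) 'X_i ^+ c) * expprod b s.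
Proof.
elim: b s => [|d b IH] [|i s] //=; first by rewrite !big_nil mul0r.
move=> [ss]; rewrite !big_cons big_map /= -mulr_sumr IH // exprD mulrDl -!mulrA.
by congr (_ + _); rewrite mulrCA.
Qed.

(** Letting the new index range over all values gives a power sum; the values
    already present in the word amount to adding c to one exponent. *)
Lemma msum_cons c b :
  msum (c :: b) = psum F n c * msum b - \sum_(b' <- add_at_each_entry c b) msum b'.
Proof.
have -> : \sum_(b' <- add_at_each_entry c b) msum b' =
    \sum_(s <- allseqs (size b) | uniq s) (\sum_(i <- s) 'X_i ^+ c) * expprod b s.
  rewrite big_seq (eq_bigr (fun b' => \sum_(s <- allseqs (size b) | uniq s) expprod b' s)).
    rewrite -big_seq exchange_big /= big_seq_cond [RHS]big_seq_cond.
    by apply: eq_bigr => s /andP [+ _]; rewrite mem_allseqs => /eqP /(expprod_add_at_each_entry c).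
  by move=> b' /size_add_at_each_entry sb; rewrite /msum sb.
rewrite /msum mulr_sumr -sumrB /= big_mkcond big_allpairs_dep /= big_enum /=.
rewrite exchange_big /= [RHS]big_mkcond; apply: eq_bigr => s _.
have [us|_] := ifP; last by apply: big1 => i _; rewrite andbF.
rewrite -mulrBl /psum [X in _ - X](big_uniq _ us) [X in _ - X]big_mkcond -sumrB mulr_suml.
apply: eq_bigr => i _; rewrite andbT.
by case: (i \in s) => /=; rewrite ?subrr ?mul0r ?subr0.
Qed.

(** Power sums generate the monomial symmetric sums, by induction on the
    number of exponents. *)
Lemma msum_ind (Q : S -> Prop) : Q 1 -> (forall g h, Q g -> Q h -> Q (g - h)) ->
  (forall g c, Q g -> Q (g * psum F n c)) -> forall b, Q (msum b).
Proof.
move=> Q1 QB Qp b; move: {2}(size b) (leqnn (size b)) => r.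
elim: r b => [|r IH] [|c b] //=; rewrite ?ltnS => le.
- by rewrite /msum /= big_mkcond big_seq1.
- by rewrite /msum /= big_mkcond big_seq1.
have Q0 : Q 0 by rewrite -(subrr 1); exact: (QB _ _ Q1 Q1).
have QD g h : Q g -> Q h -> Q (g + h).
  by move=> Qg Qh; rewrite -[h]opprK; apply: (QB _ _ Qg); rewrite -sub0r; exact: (QB _ _ Q0 Qh).
rewrite msum_cons; apply: QB; first by rewrite mulrC; apply/Qp/IH.
rewrite big_seq; apply: (big_ind Q) => // b' /size_add_at_each_entry sb.
by apply: IH; rewrite sb.
Qed.

Lemma expprod_prod b s (i0 : 'I_n) : size s = size b ->
  expprod b s = \prod_(j < size b) 'X_(nth i0 s j) ^+ nth 0%N b j.
Proof.
elim: b s => [|c b IH] [|i s] //=; first by rewrite big_ord0.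
by move=> [ss]; rewrite big_ord_recl /= IH.
Qed.

(** For a full word of distinct indices, the word is a permutation and the
    product of powers is the permuted monomial. *)
Lemma expprod_msym (m : 'X_{1..n}) s : uniq s -> size s = n ->
  exists w : 'S_n, expprod [seq m i | i <- enum 'I_n] s = msym w 'X_[m].
Proof.
move=> us ss; have [n0|n0] := posnP n.
  have no (i : 'I_n) : False by have := leq_ltn_trans (leq0n i) (ltn_ord i); rewrite n0.
  exists 1%g; rewrite msym1m; case: s us ss => [|i s] _ ss; last by case: (no i).
  have -> : expprod [seq m i | i <- enum 'I_n] [::] = 1 by case: [seq _ | _ <- _].
  by rewrite mpolyXE_id big1 // => i; case: (no i).
pose i0 := Ordinal n0.
have winj : injective (fun i : 'I_n => nth i0 s i).
  move=> i j /eqP; rewrite nth_uniq ?ss ?ltn_ord // => /eqP; exact: val_inj.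
exists (perm winj).
have sb : size [seq m i | i <- enum 'I_n] = n by rewrite size_map size_enum_ord.
rewrite (expprod_prod i0) ?sb //.
have -> : msym (perm winj) 'X_[m] = \prod_i 'X_(perm winj i) ^+ m i :> S.
  rewrite mpolyXE_id rmorph_prod; apply: eq_bigr => i _ /=.
  by rewrite rmorphXn /= msymXU.
apply: eq_bigr => i _; rewrite permE (nth_map i0) ?size_enum_ord //.
by rewrite nth_ord_enum.
Qed.
End PowerSums.

Lemma map_mpoly_neg_power_sum (R R' : idomainType) n k
    (f : {additive R -> R'}) r (p : {mpoly R[n]}) :
  map_mpoly f (neg_power_sum k r p) = neg_power_sum k r (map_mpoly f p).
Proof.
rewrite /neg_power_sum raddf_sum; apply: eq_bigr => j _ /=.
by elim: r => //= r IH; rewrite raddfN /= map_mpoly_dunkl IH.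
Qed.

Lemma neg_power_sum0 (R : idomainType) n k r : neg_power_sum k r (0 : {mpoly R[n]}) = 0.
Proof.
rewrite /neg_power_sum big1 // => j _.
by elim: r => //= r ->; rewrite dunkl0 oppr0.
Qed.

(** * Symmetric forms that kill the kernel *)

Section KernelApplication.
Variables (F : fieldType) (n k' : nat).
Local Notation k := k'.+1.
Local Notation S := {mpoly F[n]}.
Local Notation D := (@dunkl F n k).
Local Notation opD := (@opD F n k).
Implicit Types (i j l : 'I_n) (g h p : S) (m : 'X_{1..n}).

(** Polynomials in z with coefficients polynomials in x, for the variables t_i
    = x_i. *)
Definition cauchy_ker : {mpoly S[n]} := kerprod k' (fun i => 'X_i : S).

Lemma cauchy_ker_power r :
  \sum_i iter r (map_mpoly (D i)) cauchy_ker = neg_power_sum k r cauchy_ker.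
Proof.
apply: (@kernel_power _ n k' (fun i => 'X_i : S) (fun i => D i)
  (fun i => mderiv i) (fun i l => divdiff i l) (fun i l => msym (tperm i l))).
- by move=> i p; rewrite /= dunkl_mulXi.
- by move=> i a l; rewrite /= msymXU.
- by move=> i a b; rewrite /= mderivM.
- by move=> i l; rewrite /= mderivXU.
- by move=> i p; rewrite /= dunklE.
- by move=> i l p; rewrite /= divdiffE.
- by move=> i p; rewrite /= divdiffii.
- by move=> i l il; apply: XB_neq0.
Qed.

Lemma opD_psum r h : opD (psum F n r) h = \sum_i iter r (D i) h.
Proof.
rewrite /psum opD_sum; apply: eq_bigr => i _.
elim: r => [|r IH]; first by rewrite expr0 -mpolyC1 opDC scale1r.
by rewrite exprS opD_mulX IH.
Qed.

Lemma map_opD_psum r : map_mpoly (opD (psum F n r)) cauchy_ker = neg_power_sum k r cauchy_ker.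
Proof.
rewrite -cauchy_ker_power; apply/mpolyP => m.
rewrite mcoeff_map_mpoly /= opD_psum (raddf_sum (mcoeff m)).
apply: eq_bigr => i _ /=.
by elim: r => //= r IH; rewrite mcoeff_map_mpoly IH.
Qed.

Variable eta : {scalar S}.
Hypothesis eta_ker : forall m, eta cauchy_ker@_m = 0.
Hypothesis eta_sym : forall (s : 'S_n) p, eta (msym s p) = eta p.

Definition killed g := forall m, eta (opD g cauchy_ker@_m) = 0.

Lemma killedE g : killed g <-> map_mpoly eta (map_mpoly (opD g) cauchy_ker) = 0.
Proof.
split=> [h|h m]; last first.
  by have := congr1 (mcoeff m) h; rewrite !mcoeff_map_mpoly mcoeff0.
by apply/mpolyP => m; rewrite !mcoeff_map_mpoly mcoeff0; apply: h.
Qed.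

(** Power sums of the operators in x may be traded for operators in z, which
    commute with eta and with g(D) acting on coefficients, and which send 0 to
    0. *)
Lemma killed_psum g r : killed g -> killed (g * psum F n r).
Proof.
move=> /killedE h; apply/killedE.
have -> : map_mpoly (opD (g * psum F n r)) cauchy_ker =
    map_mpoly (opD g) (map_mpoly (opD (psum F n r)) cauchy_ker).
  by apply: map_mpoly_compose => x; exact: opDM.
by rewrite map_opD_psum !map_mpoly_neg_power_sum h neg_power_sum0.
Qed.

Lemma killed_msum b : killed (msum F n b).
Proof.
apply: (@msum_ind F n killed) => [m|g h kg kh m|g c]; last exact: killed_psum.
- by rewrite -mpolyC1 opDC scale1r.
- by rewrite opDB linearB /= kg kh subr0.
Qed.

Definition Xtop : S := \prod_i 'X_i ^+ (k * n).

Lemma cauchy_ker0 : cauchy_ker@_0%MM = (-1) ^+ (k * n * n) *: Xtop.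
Proof.
have -> : cauchy_ker@_0%MM = \prod_x (zsubt (fun i => 'X_i : S) x ^+ k)@_0%MM by exact: rmorph_prod.
rewrite (eq_bigr (fun x => (- 'X_(x.1)) ^+ k)) => [|x _]; last first.
  rewrite rmorphXn /= /zsubt mcoeffB mcoeffX mnm1_eq0 mcoeffC eqxx mulr1 sub0r //.
rewrite -(pair_big xpredT xpredT (fun a b => (- 'X_a) ^+ k)) /=.
rewrite (eq_bigr (fun a : 'I_n => (-1) ^+ (k * n) *: 'X_a ^+ (k * n))); last first.
  by move=> a _; rewrite prodr_const card_ord -exprM -scaleN1r exprZn.
by rewrite scaler_prod prodr_const card_ord -exprM.
Qed.

Lemma killed_top g : killed g -> eta (opD g Xtop) = 0.
Proof.
move=> /(_ 0%MM); rewrite cauchy_ker0 opDrZ linearZ /= => /eqP.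
by rewrite mulf_eq0 signr_eq0 /= => /eqP.
Qed.

Lemma msym_top (w : 'S_n) : msym w Xtop = Xtop.
Proof.
have -> : msym w Xtop = \prod_i msym w ('X_i ^+ (k * n)) by exact: rmorph_prod.
rewrite /Xtop [RHS](reindex_inj (@perm_inj _ w)) /=; apply: eq_bigr => i _.
by rewrite rmorphXn /= msymXU.
Qed.

Hypothesis char0 : forall a, a.+1%:R != 0 :> F.

(** By symmetry of eta all permutations of the monomial contribute equally,
    and their sum is killed; characteristic 0 allows to divide by the number
    of terms. *)
Lemma eta_opD_top m : eta (opD 'X_[m] Xtop) = 0.
Proof.
pose b := [seq m i | i <- enum 'I_n].
have sb : size b = n by rewrite size_map size_enum_ord.
have := killed_top (killed_msum b); rewrite /msum opD_sum linear_sum /= sb.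
rewrite big_seq_cond (eq_bigr (fun=> eta (opD 'X_[m] Xtop))) => [|s /andP [sn us]]; last first.
  rewrite mem_allseqs in sn; have [w ->] := expprod_msym F m us (eqP sn).
  by rewrite -{1}(msym_top w) -msym_opD eta_sym.
rewrite -big_seq_cond big_const_seq iter_addr_0 -mulr_natr => /eqP.
rewrite mulf_eq0 => /orP [/eqP //|].
have : (0 < count uniq (allseqs n n))%N.
  rewrite -has_count; apply/hasP; exists (enum 'I_n); last exact: enum_uniq.
  by rewrite mem_allseqs size_enum_ord.
by case: (count _ _) => // c _; rewrite (negbTE (char0 c)).
Qed.
End KernelApplication.

Section Vanishing.
Variables (F : closedFieldType) (n k' : nat).
Hypothesis char0 : forall a, a.+1%:R != 0 :> F.
Local Notation k := k'.+1.
Local Notation S := {mpoly F[n]}.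

Definition wpoly : {poly S} := \prod_(i < n) ('X - ('X_i)%:P) ^+ k.

(** The kernel is the product of the values of wpoly at the z_j, so its
    coefficients are products of n coefficients of wpoly. *)
Lemma cauchy_ker_expand : cauchy_ker F n k' = \sum_(f : {ffun 'I_n -> 'I_(size wpoly)})
   (\prod_j wpoly`_(f j)) *: 'X_[[multinom (f j : nat) | j < n]].
Proof.
have -> : cauchy_ker F n k' = \prod_j (map_poly (@mpolyC n S) wpoly).['X_j].
  rewrite /cauchy_ker /kerprod.
  rewrite -(pair_big xpredT xpredT (fun a b => zsubt (fun i => 'X_i : S) (a, b) ^+ k)) /=.
  rewrite exchange_big /=; apply: eq_bigr => j _.
  rewrite /wpoly rmorph_prod horner_prod; apply: eq_bigr => i _.
  by rewrite rmorphXn /= horner_exp rmorphB /= map_polyX map_polyC /= hornerXsubC.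
have E j : (map_poly (@mpolyC n S) wpoly).['X_j] =
    \sum_(a < size wpoly) (wpoly`_a)%:MP * 'X_j ^+ a.
  rewrite (@horner_coef_wide _ (size wpoly)) ?size_poly //.
  by apply: eq_bigr => a _; rewrite coef_map.
rewrite (eq_bigr _ (fun j _ => E j)) bigA_distr_bigA; apply: eq_bigr => f _ /=.
rewrite big_split /= -mul_mpolyC rmorph_prod; congr (_ * _).
by rewrite mpolyXE_id; apply: eq_bigr => j _; rewrite mnmE.
Qed.

(** The key fact: symmetric forms that kill all products of n coefficients of
    wpoly kill every polynomial with exponents at most k n. *)
Theorem functional_vanishing (eta : {scalar S}) :
  (forall (s : 'S_n) p, eta (msym s p) = eta p) ->
  (forall f : 'I_n -> nat, eta (\prod_j wpoly`_(f j)) = 0) ->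
  forall p, bounded (k * n) p -> eta p = 0.
Proof.
move=> eta_sym eta_w; apply: (dunkl_functional0 (k' := k') char0) => m.
have -> : 'X_[topm n k' 0] = Xtop F n k'.
  by rewrite mpolyXE_id; apply: eq_bigr => i _; rewrite mnmE.
apply: eta_opD_top => // x; rewrite cauchy_ker_expand raddf_sum /= linear_sum big1 // => f _.
rewrite mcoeffZ mcoeffX; case: (_ == _); rewrite ?mulr1 ?mulr0 ?linear0 //.
Qed.
End Vanishing.

(** * Independence of the products of coefficients *)

Section Content.
Variables (M n : nat).
Implicit Types (m : 'X_{1..M}) (x : 'X_{1..n}).

Definition spread m : seq nat := flatten [seq nseq (m a) (a : nat) | a <- enum 'I_M].

(** The exponent vector with m a entries equal to a, in increasing order:
    monomials of degree n in the coefficients correspond to orbits of exponent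
    vectors. *)
Definition spreadm m : 'X_{1..n} := [multinom nth 0%N (spread m) i | i < n].

(** The inverse correspondence: the number of entries with a given value. *)
Definition content (f : 'I_n -> nat) : 'X_{1..M} :=
  [multinom (\sum_(i | f i == a :> nat) 1)%N | a < M].

Lemma size_spread m : size (spread m) = mdeg m.
Proof.
rewrite /spread size_flatten /shape -map_comp sumnE big_map mdegE big_enum /=.
by apply: eq_bigr => a _; rewrite size_nseq.
Qed.

Lemma count_spread m (a : 'I_M) : count_mem (a : nat) (spread m) = m a.
Proof.
rewrite /spread count_flatten -map_comp sumnE big_map big_enum /= (bigD1 a) //=.
rewrite count_nseq /= eqxx mul1n big1 ?addn0 // => b ba.
by rewrite count_nseq /= (inj_eq val_inj) (negbTE ba) mul0n.
Qed.

Lemma content_spread m : mdeg m = n -> content (spreadm m) = m.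
Proof.
move=> dm; apply/mnmP => a; rewrite mnmE -(count_spread m a).
rewrite -sum1_count (big_nth 0%N) big_mkord size_spread dm.
by apply: eq_bigl => i; rewrite mnmE.
Qed.

Lemma content_perm (f : 'I_n -> nat) (s : 'S_n) : content (fun i => f (s i)) = content f.
Proof.
apply/mnmP => a; rewrite !mnmE [RHS](reindex_inj (@perm_inj _ s)) /=.
by [].
Qed.

Lemma mdeg_content (f : 'I_n -> nat) : (forall i, (f i < M)%N) -> mdeg (content f) = n.
Proof.
move=> fM; rewrite mdegE (eq_bigr (fun a : 'I_M => \sum_(i | f i == a) 1))%N; last first.
  by move=> a _; rewrite mnmE.
transitivity (\sum_(i < n) 1)%N; last by rewrite sum1_card card_ord.
by rewrite [RHS](partition_big (fun i => Ordinal (fM i)) xpredT).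
Qed.

Lemma prod_content (R : comNzRingType) (w : nat -> R) (f : 'I_n -> nat) :
  (forall i, (f i < M)%N) ->
  \prod_i w (f i) = \prod_(a < M) w a ^+ content f a.
Proof.
move=> fM; rewrite (partition_big (fun i => Ordinal (fM i)) xpredT) //=.
apply: eq_bigr => a _; rewrite mnmE sum1_card -prodr_const.
by apply: eq_big => [i|i /eqP <-].
Qed.

Lemma spread_lt m i : (0 < M)%N -> (nth 0%N (spread m) i < M)%N.
Proof.
move=> M0; have [lt|le] := ltnP i (size (spread m)); last by rewrite nth_default.
have : nth 0%N (spread m) i \in spread m by exact: mem_nth.
case/flatten_mapP => a _; rewrite mem_nseq => /andP [_ /eqP ->].
exact: ltn_ord.
Qed.
End Content.

Section Independence.
Variables (F : closedFieldType) (n k' : nat).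
Hypothesis char0 : forall a, a.+1%:R != 0 :> F.
Local Notation k := k'.+1.
Local Notation S := {mpoly F[n]}.
Local Notation M := (k * n).+1.

Definition wcoef (a : nat) : S := (wpoly F n k')`_a.

Lemma size_wpoly : (size (wpoly F n k') <= M)%N.
Proof.
have h (s : seq 'I_n) :
     (size (\prod_(i <- s) ('X - ('X_i)%:P : {poly S}) ^+ k)%R <= (k * size s).+1)%N.
  elim: s => [|i s IH]; first by rewrite big_nil size_poly1.
  rewrite big_cons; apply: (leq_trans (size_polyMleq _ _)).
  have : (size (('X - ('X_i)%:P : {poly S}) ^+ k)%R <= k.+1)%N.
    by apply: (leq_trans (size_poly_exp_leq _ _)); rewrite size_XsubC mul1n.
  move: IH; rewrite [size (_ :: _)]/= => IH1 IH2.
  by rewrite -ltnS; lia.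
have := h (index_enum 'I_n); rewrite -/(wpoly F n k').
by rewrite -[index_enum _]enumT size_enum_ord.
Qed.

Lemma msym_wcoef (s : 'S_n) a : msym s (wcoef a) = wcoef a.
Proof.
have E : map_poly (msym s) (wpoly F n k') = wpoly F n k'.
  rewrite {2}/wpoly [RHS](reindex_inj (@perm_inj _ s)) /=.
  rewrite /wpoly rmorph_prod; apply: eq_bigr => i _.
  by rewrite rmorphXn /= rmorphB /= map_polyX map_polyC /= msymXU.
by rewrite /wcoef -{2}E coef_map.
Qed.

Definition wmon (m : 'X_{1..M}) : S := \prod_(a < M) wcoef a ^+ m a.

Lemma msym_wmon (s : 'S_n) m : msym s (wmon m) = wmon m.
Proof.
rewrite /wmon rmorph_prod; apply: eq_bigr => a _ /=.
by rewrite rmorphXn /= msym_wcoef.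
Qed.

(** Rows indexed by monomials m in the coefficients w_a, columns by exponent
    vectors: the matrix of the coefficients of the products is square. If its
    rows were dependent so would be its columns, and a dependence between
    columns is a form that kills all products; after symmetrisation it
    contradicts the vanishing theorem. *)
Theorem independence (P : {mpoly F[M]}) : P \is n.-homog ->
  \sum_(m <- msupp P) P@_m *: wmon m = 0 -> P = 0.
Proof.
move=> homP P0; apply/eqP; apply: contraT => Pn0.
pose T := {x : 'X_{1..M < n.+1} | mdeg x == n}; pose s := #|{: T}|.
pose mo (x : 'I_s) : 'X_{1..M} := val (val (enum_val x)).
have mo_deg x : mdeg (mo x) = n by apply/eqP; exact: (valP (enum_val x)).
have mo_inj : injective mo by move=> x y /val_inj/val_inj/enum_val_inj.
have mo_onto (m : 'X_{1..M}) : mdeg m = n -> exists x, m = mo x.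
  move=> dm; have lt : (mdeg m < n.+1)%N by rewrite dm.
  have pf : mdeg (BMultinom lt) == n by rewrite /= dm.
  by exists (enum_rank (Sub (BMultinom lt) pf : T)); rewrite /mo enum_rankK.
pose A := \matrix_(x < s, y < s) (wmon (mo x))@_(spreadm n (mo y)).
have detA : \det A = 0.
  apply/eqP/det0P; exists (\row_x P@_(mo x)).
    apply: contraNneq Pn0 => c0; apply/eqP/mpolyP => m; rewrite mcoeff0.
    case: (boolP (m \in msupp P)) => [mP|/memN_msupp_eq0 //].
    have [x ->] := mo_onto m (dhomog_mf homP mP).
    by have /matrixP /(_ 0 x) := c0; rewrite !mxE.
  apply/matrixP => z y; rewrite !mxE.
  have E := congr1 (mcoeff (spreadm n (mo y))) P0; rewrite mcoeff0 in E.
  rewrite -[RHS]E raddf_sum /= {E}.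
  have sub : {subset msupp P <= [seq mo x | x <- index_enum 'I_s]}.
    move=> m mP; have [x ->] := mo_onto m (dhomog_mf homP mP).
    by apply: map_f; rewrite mem_index_enum.
  have um : uniq [seq mo x | x <- index_enum 'I_s].
    by rewrite map_inj_uniq // index_enum_uniq.
  rewrite (eq_bigr (fun m => P@_m *: ((wmon m)@_(spreadm n (mo y)) : F^o))); last first.
    by move=> m _; rewrite mcoeffZ.
  rewrite (big_msupp (fun m => (wmon m)@_(spreadm n (mo y)) : F^o) um sub) big_map.
  by apply: eq_bigr => x _; rewrite !mxE.
have [v v0 vA] : exists2 v : 'rV_s, v != 0 & v *m A^T = 0.
  by apply/det0P; rewrite det_tr detA.
pose eta0 (p : S) : F := \sum_y v 0 y * p@_(spreadm n (mo y)).
(* Symmetrisation of the form given by the dependent columns. *)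
pose eta p := \sum_(w : 'S_n) eta0 (msym w p).
have eta_lin : scalar eta.
  move=> c p q; rewrite /eta mulr_sumr -big_split; apply: eq_bigr => w _ /=.
  rewrite /eta0 mulr_sumr -big_split; apply: eq_bigr => y _ /=.
  by rewrite msymD msymZ mcoeffD mcoeffZ mulrDr mulrCA.
pose etaL : {scalar S} := HB.pack eta (GRing.isLinear.Build F S F *%R eta eta_lin).
have van : forall p, bounded (k * n) p -> etaL p = 0.
  apply: (functional_vanishing char0) => [w p|f].
    rewrite /etaL /= /eta [RHS](reindex_inj (mulgI w)) /=; apply: eq_bigr => u _.
    by rewrite msymMm.
  have [fM|] := boolP [forall i, f i < M]%N; last first.
    rewrite negb_forall => /existsP [i]; rewrite -leqNgt => Mf.
    have -> : \prod_j (wpoly F n k')`_(f j) = 0.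
      by rewrite (bigD1 i) //= nth_default ?mul0r // (leq_trans size_wpoly).
    exact: linear0.
  move/forallP in fM.
  have -> : \prod_j (wpoly F n k')`_(f j) = wmon (content M f).
    exact: (prod_content wcoef fM).
  rewrite /etaL /= /eta big1 // => w _; rewrite msym_wmon.
  have [x ->] := mo_onto _ (mdeg_content fM).
  have /matrixP /(_ 0 x) := vA; rewrite !mxE => E; rewrite -[RHS]E.
  by apply: eq_bigr => y _; rewrite !mxE.
move/negP: v0; case; apply/eqP/matrixP => z x; rewrite ord1 mxE {z}.
have bx : bounded (k * n) ('X_[spreadm n (mo x)] : S).
  move=> m; rewrite msuppX inE => /eqP -> i; rewrite mnmE.
  by have := @spread_lt M (mo x) i (ltn0Sn _); rewrite ltnS.
have := van _ bx; rewrite /etaL /= /eta.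
have E w : eta0 (msym w 'X_[spreadm n (mo x)]) =
    v 0 x * (msym w 'X_[spreadm n (mo x)] : S)@_(spreadm n (mo x)).
  rewrite /eta0 (bigD1 x) //= big1 ?addr0 // => y yx.
  rewrite msymX mcoeffX; case: eqP => [e|]; last by rewrite mulr0.
  case/eqP: yx; apply: mo_inj; rewrite -(content_spread (mo_deg x)) -(content_spread (mo_deg y)).
  rewrite -e -(content_perm M (spreadm n (mo x)) w^-1%g).
  by apply/mnmP => a; rewrite !mnmE; apply: eq_bigl => i; rewrite mnmE.
rewrite (eq_bigr _ (fun w _ => E w)) -mulr_sumr => /eqP; rewrite mulf_eq0.
case/orP => [/eqP //|].
rewrite (eq_bigr (fun w : 'S_n => (nat_of_bool
  ([multinom spreadm n (mo x) (w^-1%g i) | i < n] == spreadm n (mo x)))%:R)).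
  rewrite -natr_sum (bigD1 1%g) //=.
  have -> : [multinom spreadm n (mo x) ((1^-1 : 'S_n)%g i) | i < n] = spreadm n (mo x).
    by apply/mnmP => i; rewrite mnmE invg1 perm1.
  by rewrite eqxx add1n (negbTE (char0 _)).
by move=> w _; rewrite msymX mcoeffX.
Qed.
End Independence.

(** * Derivations, weights and sl2 *)

HB.lock Definition der (F : fieldType) (n : nat) (c : 'I_n -> {mpoly F[n]})
  (p : {mpoly F[n]}) : {mpoly F[n]} := \sum_i c i * p^`M(i).

Section Derivations.
Variables (F : fieldType) (n : nat).
Local Notation S := {mpoly F[n]}.
Implicit Types (i : 'I_n) (p q : S) (c : 'I_n -> S).

Lemma derE c p : der c p = \sum_i c i * p^`M(i).
Proof. by rewrite der.unlock. Qed.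

Lemma der_linear c : linear (der c).
Proof.
move=> a p q; rewrite !derE scaler_sumr -big_split; apply: eq_bigr => i _ /=.
by rewrite mderivD mderivZ mulrDr scalerAr.
Qed.

HB.instance Definition _ c := GRing.isLinear.Build F S S *:%R (der c) (der_linear c).

Lemma derD c p q : der c (p + q) = der c p + der c q. Proof. exact: linearD. Qed.
Lemma derB c p q : der c (p - q) = der c p - der c q. Proof. exact: linearB. Qed.
Lemma derZ c a p : der c (a *: p) = a *: der c p. Proof. exact: linearZ. Qed.
Lemma der0 c : der c 0 = 0. Proof. exact: linear0. Qed.

Lemma derM c p q : der c (p * q) = der c p * q + p * der c q.
Proof.
rewrite !derE mulr_suml mulr_sumr -big_split; apply: eq_bigr => i _ /=.
by rewrite mderivM mulrDr [c i * (_ * q)]mulrA [c i * (p * _)]mulrCA.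
Qed.

Lemma derC c a : der c a%:MP = 0.
Proof. by rewrite derE big1 // => i _; rewrite mderivC mulr0. Qed.

Lemma derX c i : der c 'X_i = c i.
Proof.
rewrite derE (bigD1 i) //= mderivXU eqxx mulr1 big1 ?addr0 // => j ji.
by rewrite mderivXU eq_sym (negbTE ji) mulr0.
Qed.

Lemma der_supp c p z : z \in msupp (der c p) -> exists i u v,
  [/\ u \in msupp (c i), (v + U_(i))%MM \in msupp p & z = (u + v)%MM].
Proof.
rewrite derE => /msupp_sum_le /flatten_mapP [i _ /msuppM_le /allpairsP [[u v] /= [uc vp ->]]].
exists i, u, v; split => //.
move: vp; rewrite !mcoeff_msupp mcoeff_deriv; apply: contraNneq => ->.
by rewrite mul0rn.
Qed.
End Derivations.

Section Weights.
Variables (F : fieldType) (n : nat).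
Local Notation S := {mpoly F[n]}.
Implicit Types (p q : S) (x y : 'X_{1..n}).

Definition wt x : nat := (\sum_(i < n) i * x i)%N.

Lemma wtD x y : wt (x + y)%MM = (wt x + wt y)%N.
Proof. by rewrite /wt -big_split; apply: eq_bigr => i _; rewrite mnmDE mulnDr. Qed.

Lemma wt1 i : wt U_(i)%MM = i.
Proof.
rewrite /wt (bigD1 i) //= mnm1E eqxx muln1 big1 ?addn0 // => j ji.
by rewrite mnm1E eq_sym (negbTE ji) muln0.
Qed.

Lemma wt0 : wt 0%MM = 0%N.
Proof. by rewrite /wt big1 // => i _; rewrite mnm0E muln0. Qed.

Definition wthomog m w p := forall x, x \in msupp p -> mdeg x = m /\ wt x = w.

Lemma wthomog0 m w : wthomog m w 0. Proof. by move=> x; rewrite msupp0. Qed.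

Lemma wthomogD m w p q : wthomog m w p -> wthomog m w q -> wthomog m w (p + q).
Proof. by move=> hp hq x /msuppD_le; rewrite mem_cat => /orP [/hp|/hq]. Qed.

Lemma wthomogZ m w a p : wthomog m w p -> wthomog m w (a *: p).
Proof. by move=> hp x /msuppZ_le /hp. Qed.

Lemma wthomogB m w p q : wthomog m w p -> wthomog m w q -> wthomog m w (p - q).
Proof. by move=> hp hq; rewrite -scaleN1r; apply: wthomogD => //; apply: wthomogZ. Qed.

Lemma wthomog_sum m w (I : Type) (r : seq I) (P : pred I) (f : I -> S) :
  (forall i, P i -> wthomog m w (f i)) -> wthomog m w (\sum_(i <- r | P i) f i).
Proof. by move=> h; apply: (big_ind (wthomog m w)) => //; [exact: wthomog0|exact: wthomogD]. Qed.

Lemma wthomogM m1 w1 m2 w2 p q : wthomog m1 w1 p -> wthomog m2 w2 q ->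
  wthomog (m1 + m2) (w1 + w2) (p * q).
Proof.
move=> hp hq x /msuppM_le /allpairsP [[u v] /= [/hp [mu wu] /hq [mv wv] ->]].
by rewrite mdegD wtD mu mv wu wv.
Qed.

Lemma wthomogX x : wthomog (mdeg x) (wt x) ('X_[x] : S).
Proof. by move=> y; rewrite msuppX inE => /eqP ->. Qed.

Lemma wthomog1 : wthomog 0 0 (1 : S).
Proof. by have := @wthomogX 0%MM; rewrite mpolyX0 mdeg0 wt0. Qed.
End Weights.
Arguments wt {n}.

Section Sl2.
Variables (F : fieldType) (N : nat).
Hypothesis char0 : forall a, a.+1%:R != 0 :> F.
Local Notation S := {mpoly F[N.+1]}.
Implicit Types (i : 'I_N.+1) (p q : S).

(** The lowering operator sends x_i to (N - i + 1) x_(i-1); the recursion on i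
    avoids an index -1. *)
Definition lowc i : S :=
  if (i : nat) is j.+1 then (N - j)%:R *: 'X_(inord j) else 0.

Definition upc i : S := if (i < N)%N then i.+1%:R *: 'X_(inord i.+1) else 0.

Local Notation L := (der lowc).
Local Notation U := (der upc).

Definition hcoef i : F := N%:R - (2 * i)%:R.
Local Notation H := (der (fun i => hcoef i *: 'X_i)).

Lemma low_up i : L (upc i) - U (lowc i) = hcoef i *: 'X_i.
Proof.
have E1 : L (upc i) = (i.+1 * (N - i))%:R *: 'X_i.
  rewrite /upc; case: ltnP => iN; last first.
    by rewrite der0 (eqP iN) muln0 scale0r.
  rewrite derZ derX /lowc inordK // scalerA -natrM; congr (_ *: 'X_ _).
  exact: inord_val.
have E2 : U (lowc i) = (i * (N - i).+1)%:R *: 'X_i.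
  rewrite /lowc; case: i {E1} => -[|j] ij /=; first by rewrite der0 mul0n scale0r.
  have jN : (j < N)%N by rewrite -ltnS.
  rewrite derZ derX /upc inordK ?(ltnW ij) // jN scalerA -natrM.
  congr (_%:R *: 'X_ _); first by rewrite mulnC subnSK.
  by apply: val_inj; rewrite /= inordK.
rewrite E1 E2 -scalerBl; congr (_ *: _); rewrite /hcoef.
have iN : (i <= N)%N by rewrite -ltnS.
apply/eqP; rewrite subr_eq addrAC eq_sym subr_eq -!natrD; apply/eqP; congr (_%:R).
by nia.
Qed.

(** The commutator of two derivations is a derivation, so it is enough to
    compute it on variables. *)
Lemma comm_low_up p : L (U p) = U (L p) + H p.
Proof.
elim/mpoly_Xind: p => [c|p q IHp IHq|i p IH]; first by rewrite !derC ?der0 addr0.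
  by rewrite !derD IHp IHq addrACA.
rewrite !derM !derX !derD !derM !derX IH -low_up.
move: (L (upc i)) (U (lowc i)) (L (U p)) (U (L p)) (H p) (L p) (U p) ('X_i) (upc i) (lowc i).
by move=> A B C D E G J K M O; ring.
Qed.

(** Euler's relation: the commutator acts as a scalar on polynomials of given
    degree and weight. *)
Lemma H_wthomog m w p : wthomog m w p -> H p = ((N * m)%:R - (2 * w)%:R) *: p.
Proof.
move=> hp; rewrite [in RHS](mpolyE p) scaler_sumr [in LHS](mpolyE p) linear_sum.
rewrite big_seq [RHS]big_seq.
apply: eq_bigr => x /hp [mx wx].
rewrite /= derZ scalerA mulrC -scalerA; congr (_ *: _).
rewrite derE (eq_bigr (fun i => (hcoef i * (x i)%:R) *: 'X_[x])) => [|i _].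
  rewrite -scaler_suml; congr (_ *: _).
  rewrite -mx -wx mdegE /wt mulnC big_distrl big_distrr /= !natr_sum -sumrB.
  apply: eq_bigr => i _; rewrite /hcoef mulrBl -!natrM; congr (_%:R - _%:R); lia.
rewrite mderivX -scalerAl -scalerAr scalerA; have [->|xi] := posnP (x i).
  by rewrite mulr0 !scale0r.
congr (_ *: _); rewrite -mpolyXD; congr 'X_[_].
by apply/mnmP => j; rewrite mnmDE mnmBE mnm1E; case: eqP => [<-|_] /=; lia.
Qed.

Lemma low_wthomog m w p : wthomog m w.+1 p -> wthomog m w (L p).
Proof.
move=> hp z /der_supp [i [u [v [uc /hp [mv wv] ->]]]].
move: mv wv; rewrite !mdegD !wtD mdeg1 wt1 => mv wv.
move: uc; rewrite /lowc; case: i mv wv => -[|j] ij /= mv wv; first by rewrite msupp0.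
move/msuppZ_le; rewrite msuppX inE => /eqP ->.
by rewrite mdeg1 wt1 inordK 1?ltnW //; lia.
Qed.

Lemma low_wthomog0 m p : wthomog m 0 p -> L p = 0.
Proof.
move=> hp; apply/mpolyP => z; rewrite mcoeff0; apply/eqP; rewrite mcoeff_eq0.
apply/negP => /der_supp [i [u [v [uc /hp [mv wv] _]]]].
move: wv uc; rewrite wtD wt1 /lowc; case: i {mv} => -[|j] ij /= wv; first by rewrite msupp0.
by lia.
Qed.

Lemma up_wthomog m w p : wthomog m w p -> wthomog m w.+1 (U p).
Proof.
move=> hp z /der_supp [i [u [v [uc /hp [mv wv] ->]]]].
move: mv wv; rewrite !mdegD !wtD mdeg1 wt1 => mv wv.
move: uc; rewrite /upc; case: ltnP => iN; last by rewrite msupp0.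
move/msuppZ_le; rewrite msuppX inE => /eqP ->.
by rewrite mdeg1 wt1 inordK ?ltnS //; lia.
Qed.

Lemma iter_up_wthomog m w p s : wthomog m w p -> wthomog m (w + s) (iter s U p).
Proof.
move=> hp; elim: s => [|s IH]; first by rewrite addn0.
by rewrite addnS; apply: up_wthomog.
Qed.

Lemma iter_low_wthomog m w p s : wthomog m (w + s) p -> wthomog m w (iter s L p).
Proof.
elim: s w => [|s IH] w; first by rewrite addn0.
by rewrite addnS -addSn => /IH; apply: low_wthomog.
Qed.

Lemma iter_low_wthomog0 m w p s : wthomog m w p -> (w < s)%N -> iter s L p = 0.
Proof.
move=> hp ws; have -> : s = ((s - w.+1) + w.+1)%N by rewrite subnK.
have Lw : L (iter w L p) = 0.
  by apply: (low_wthomog0 (m := m)); apply: iter_low_wthomog; rewrite add0n.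
by rewrite iterD iterS Lw; elim: (s - w.+1)%N => //= t ->; exact: der0.
Qed.

(** The scalar s (M - s + 1), shifted by one in s, of the lowering operator on
    the s-th raising of a lowest vector, M being N m - 2 w. *)
Definition raising_coef m w s : F := s.+1%:R * ((N * m)%:R - (2 * w)%:R - s%:R).

Lemma low_iter_up m w h s : wthomog m w h -> L h = 0 ->
  L (iter s.+1 U h) = raising_coef m w s *: iter s U h.
Proof.
move=> hh Lh; elim: s => [|s IH].
  by rewrite /= comm_low_up Lh der0 add0r (H_wthomog hh) /raising_coef mul1r subr0.
rewrite iterS comm_low_up IH derZ (H_wthomog (iter_up_wthomog (s := s.+1) hh)) -iterS -scalerDl.
congr (_ *: _); rewrite /raising_coef mulnDr natrD.
have -> : s.+2%:R = s%:R + 1 + 1 :> F by rewrite !natr1.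
have -> : (2 * s.+1)%:R = (s%:R + 1) * 2%:R :> F by rewrite natr1 -natrM mulnC.
have -> : s.+1%:R = s%:R + 1 :> F by rewrite natr1.
by move: (s%:R) ((N * m)%:R) ((2 * w)%:R) => A B C; ring.
Qed.

Lemma iter_lowZ s a p : iter s L (a *: p) = a *: iter s L p.
Proof. by elim: s => //= s ->; rewrite derZ. Qed.

Lemma iter_low_up m w h s : wthomog m w h -> L h = 0 ->
  iter s L (iter s U h) = (\prod_(t < s) raising_coef m w t) *: h.
Proof.
move=> hh Lh; elim: s => [|s IH]; first by rewrite big_ord0 scale1r.
by rewrite iterSr (low_iter_up s hh Lh) iter_lowZ IH big_ord_recr scalerA mulrC.
Qed.

Lemma iter_lowB s p q : iter s L (p - q) = iter s L p - iter s L q.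
Proof. by elim: s => //= s ->; rewrite derB. Qed.

(** Induction on r such that the r-th power of the lowering operator kills G.
    The last nonzero lowering of G is a lowest vector h; raising it r + 1
    times and lowering once reproduces, up to a nonzero scalar, an element
    with the same r-th lowering h, which is subtracted from G. *)
Theorem lowering_onto m (i : nat) G : wthomog m i G -> (2 * i < N * m)%N ->
  exists2 E, wthomog m i.+1 E & L E = G.
Proof.
move=> hG lt; suff key r G0 : wthomog m i G0 -> iter r L G0 = 0 ->
    exists2 E, wthomog m i.+1 E & L E = G0.
  by apply: (key i.+1) => //; apply: (iter_low_wthomog0 hG).
elim: r G0 {G hG} => [|r IH] G hG rG.
  by exists 0; [exact: wthomog0|rewrite der0 -rG].
have [h0|h0] := eqVneq (iter r L G) 0; first exact: IH.
have ri : (r <= i)%N by rewrite leqNgt; apply: contraNN h0 => ir; rewrite (iter_low_wthomog0 hG ir).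
set h := iter r L G in h0.
have hh : wthomog m (i - r) h by apply: iter_low_wthomog; rewrite subnK.
have Lh : L h = 0 by [].
pose c := \prod_(t < r.+1) raising_coef m (i - r) t.
have c0 : c != 0.
  apply/prodf_neq0 => t _; rewrite /raising_coef mulf_neq0 //.
  have tr := ltn_ord t; rewrite ltnS in tr.
  have -> : (N * m)%:R - (2 * (i - r))%:R - t%:R = (N * m - 2 * (i - r) - t).-1.+1%:R :> F.
    rewrite prednK ?natrB //; lia.
  exact: char0.
pose E1 := c^-1 *: iter r.+1 U h.
have hE1 : wthomog m i.+1 E1.
  by apply: wthomogZ; have := iter_up_wthomog (s := r.+1) hh; rewrite addnS subnK.
have [|E2 hE2 LE2] := IH (G - L E1) (wthomogB hG (low_wthomog hE1)).
  rewrite iter_lowB -iterSr /E1 iter_lowZ (iter_low_up r.+1 hh Lh) scalerA mulVf //.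
  by rewrite scale1r subrr.
by exists (E1 + E2); [exact: wthomogD|rewrite derD LE2 addrC subrK].
Qed.
End Sl2.

(** * The substitution and its injectivity *)

Lemma wthomog_exp (F : fieldType) n m w t (p : {mpoly F[n]}) :
  wthomog m w p -> wthomog (m * t) (w * t) (p ^+ t).
Proof.
move=> hp; elim: t => [|t IH]; first by rewrite !muln0; exact: wthomog1.
by rewrite exprS !mulnS; apply: wthomogM.
Qed.

Lemma wthomog_prod (F : fieldType) n (I : Type) (r : seq I)
    (m w : I -> nat) (f : I -> {mpoly F[n]}) :
  (forall i, wthomog (m i) (w i) (f i)) ->
  wthomog (\sum_(i <- r) m i) (\sum_(i <- r) w i) (\prod_(i <- r) f i).
Proof.
move=> hf; elim: r => [|i r IH]; first by rewrite !big_nil; exact: wthomog1.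
by rewrite !big_cons; apply: wthomogM.
Qed.

Section Rho.
Variables (F : fieldType) (d k' : nat).
Local Notation k := k'.+1.
Local Notation S := {mpoly F[d.+1]}.
Local Notation Z := {mpoly F[(k * d).+1]}.

Definition epoly : {poly S} := \poly_(j < d.+1) 'X_(inord j).

Definition epow (a : nat) : S := (epoly ^+ k)`_a.

(** The substitution of the coefficients of the k-th power of a generic
    polynomial of degree d; its source has one variable for each of these
    coefficients. *)
Definition rho : Z -> S := mmap (@mpolyC d.+1 F) (fun a : 'I_(k * d).+1 => epow a).

HB.instance Definition _ := GRing.RMorphism.on rho.

Lemma rhoC c : rho c%:MP = c%:MP. Proof. exact: mmapC. Qed.
Lemma rhoD p q : rho (p + q) = rho p + rho q. Proof. exact: rmorphD. Qed.
Lemma rhoM p q : rho (p * q) = rho p * rho q. Proof. exact: rmorphM. Qed.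
Lemma rhoZ c p : rho (c *: p) = c *: rho p.
Proof. by rewrite -mul_mpolyC rhoM rhoC mul_mpolyC. Qed.
Lemma rhoXU a : rho 'X_a = epow a.
Proof. by rewrite /rho mmapX mmap1U. Qed.

Lemma rhoE P : rho P = \sum_(m <- msupp P) P@_m *: \prod_(a < (k * d).+1) epow a ^+ m a.
Proof. by apply: eq_bigr => m _; rewrite mul_mpolyC. Qed.

Local Notation L := (der (@lowc F d)).

(** On the generic polynomial e(s) the lowering operator acts as the
    first-order operator d s - s^2 d/ds; hence on e(s)^k as the same operator
    with k d instead of d. *)
Lemma low_epoly : map_poly L epoly = 'X * epoly *+ d - 'X^2 * epoly^`().
Proof.
apply/polyP => i; rewrite coef_map coefB coefMn coefXM coefXnM /=.
case: i => [|i] /=.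
  by rewrite mul0rn subr0 coef_poly /= derX /lowc inordK.
have -> : (if (i.+1 < 2)%N then 0 else epoly^`()`_(i.+1 - 2)) = epoly`_i *+ i.
  by case: i => [|i] /=; [rewrite mulr0n|rewrite coef_deriv !subSS subn0].
rewrite !coef_poly ltnS; case: (ltngtP i d) => [lt|gt|->]; last first.
- by rewrite ltnSn der0 subrr.
- by rewrite ltnS leqNgt gt /= der0 !mul0rn subr0.
rewrite ltnS ltnW // derX /lowc inordK ?ltnS //= scaler_nat mulrnBr //.
exact: ltnW.
Qed.

Lemma low_epolyk : map_poly L (epoly ^+ k) =
  'X * epoly ^+ k *+ (k * d) - 'X^2 * (epoly ^+ k)^`().
Proof.
have dM := @derM F d.+1 (@lowc F d).
rewrite (map_polyXn_der dM) low_epoly deriv_exp /= mulrBr mulrnBl mulrnAr -mulrnA.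
congr (_ - _); last by rewrite mulrnAr mulrCA (mulrC (epoly^`())).
by rewrite mulrCA -exprSr mulnC.
Qed.

Lemma low_epow0 : L (epow 0) = 0.
Proof.
have := congr1 (fun p : {poly S} => p`_0) low_epolyk.
by rewrite coef_map coefB coefMn coefXM coefXnM /= mul0rn subr0.
Qed.

Lemma low_epowS a : L (epow a.+1) = epow a *+ (k * d) - epow a *+ a.
Proof.
have := congr1 (fun p : {poly S} => p`_a.+1) low_epolyk.
rewrite coef_map coefB coefMn coefXM coefXnM /= -/(epow _) => ->; congr (_ - _).
by case: a => [|a] /=; [rewrite mulr0n|rewrite coef_deriv !subSS subn0].
Qed.

Lemma rho_low P : L (rho P) = rho (der (@lowc F (k * d)) P).
Proof.
elim/mpoly_Xind: P => [c|p q IHp IHq|a p IH].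
- by rewrite rhoC !derC /rho mmap0.
- by rewrite rhoD !derD rhoD IHp IHq.
rewrite rhoM !derM rhoD !rhoM IH rhoXU !derX; congr (_ * _ + _).
rewrite /lowc; case: a => -[|a] ai /=; first by rewrite low_epow0 /rho mmap0.
rewrite low_epowS rhoZ rhoXU inordK ?(ltnW ai) // scaler_nat mulrnBr //.
exact: ltnW.
Qed.

Lemma wthomog_epow a : wthomog k a (epow a).
Proof.
rewrite /epow; elim: k a => [|m IH] a.
  by rewrite expr0 coef1; case: a => [|a]; [exact: wthomog1|exact: wthomog0].
rewrite exprS coefM; apply: wthomog_sum => i _.
have h1 : wthomog 1 i (epoly`_i).
  rewrite coef_poly; case: ltnP => [lt|_]; last exact: wthomog0.
  by have := @wthomogX F _ U_(inord i : 'I_d.+1); rewrite mdeg1 wt1 inordK.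
have := wthomogM h1 (IH (a - i)%N); rewrite subnKC //.
by rewrite -ltnS.
Qed.

Lemma wthomog_rho m w P : wthomog m w P -> wthomog (k * m) w (rho P).
Proof.
move=> hP; rewrite rhoE big_seq; apply: wthomog_sum => x /hP [mx wx]; apply: wthomogZ.
rewrite -mx -wx mdegE big_distrr /=.
by apply: wthomog_prod => a; apply: wthomog_exp; exact: wthomog_epow.
Qed.
End Rho.

Section RhoInjective.
Variables (F : closedFieldType) (d k' : nat).
Hypothesis char0 : forall a, a.+1%:R != 0 :> F.
Local Notation k := k'.+1.

Definition vpoly : {poly {mpoly F[d]}} := \prod_(i < d) ('X - ('X_i)%:P).

(** The specialisation of the generic polynomial to the monic one with roots
    x_i, under which rho becomes evaluation at the coefficients of wpoly. *)
Definition sigma : {mpoly F[d.+1]} -> {mpoly F[d]} :=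
  mmap (@mpolyC d F) (fun j : 'I_d.+1 => vpoly`_j).

HB.instance Definition _ := GRing.RMorphism.on sigma.

Lemma sigma_epoly : map_poly sigma (epoly F d) = vpoly.
Proof.
apply/polyP => i; rewrite coef_map coef_poly; case: ltnP => [lt|le].
  by rewrite /= /sigma mmapX mmap1U inordK.
rewrite raddf0 nth_default // (leq_trans _ le) // /vpoly size_prod_XsubC.
by rewrite -[index_enum _]enumT size_enum_ord.
Qed.

Lemma sigma_epow a : sigma (epow F d k' a) = wcoef F d k' a.
Proof.
have -> : sigma (epow F d k' a) = (map_poly sigma (epoly F d ^+ k))`_a by rewrite coef_map.
by rewrite rmorphXn /= sigma_epoly /wcoef /wpoly /vpoly prodrXl.
Qed.

Lemma rho_inj_top (P : {mpoly F[(k * d).+1]}) : P \is d.-homog -> rho P = 0 -> P = 0.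
Proof.
move=> hP P0; apply: (independence char0 hP).
have sigmaZ c p : sigma (c *: p) = c *: sigma p by rewrite /sigma mmapZ mul_mpolyC.
have E := congr1 sigma P0; rewrite raddf0 in E; rewrite -[RHS]E rhoE.
have -> : sigma (\sum_(m <- msupp P) P@_m *: \prod_(a < (k * d).+1) epow F d k' a ^+ m a) =
    \sum_(m <- msupp P) sigma (P@_m *: \prod_(a < (k * d).+1) epow F d k' a ^+ m a).
  exact: raddf_sum.
apply: eq_bigr => m _; rewrite sigmaZ; congr (_ *: _).
have -> : sigma (\prod_(a < (k * d).+1) epow F d k' a ^+ m a) =
    \prod_(a < (k * d).+1) sigma (epow F d k' a ^+ m a).
  exact: rmorph_prod.
by apply: eq_bigr => a _; rewrite rmorphXn /= sigma_epow.
Qed.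

(** Multiplication by a power of the first variable reduces the statement to
    degree d, which is the independence of the products. *)
Lemma rho_inj r (P : {mpoly F[(k * d).+1]}) : (r <= d)%N ->
  P \is r.-homog -> rho P = 0 -> P = 0.
Proof.
move=> le hP P0; pose Q := 'X_(ord0 : 'I_(k * d).+1) ^+ (d - r) * P.
have X1 : ('X_(ord0 : 'I_(k * d).+1) : {mpoly F[(k * d).+1]}) \is 1.-homog.
  by rewrite dhomogX /= mdeg1.
have hQ := dhomogM (dhomogMn (d - r) X1) hP; rewrite mul1n subnK // in hQ.
have Q0 : Q = 0 by apply: (rho_inj_top hQ); rewrite rhoM P0 mulr0.
apply/eqP; move/eqP: Q0; rewrite mulf_eq0 expf_eq0 => /orP [/andP [_ /eqP X0]|//].
have := congr1 (mcoeff U_(ord0)) X0; rewrite mcoeffX eqxx mcoeff0 => /eqP.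
by rewrite oner_eq0.
Qed.
End RhoInjective.

(** * Comparison of dimensions *)

Section Bases.
Variables (N m w : nat).

Definition wbasis := {f : {ffun 'I_N.+1 -> 'I_m.+1} |
  ((\sum_(i < N.+1) f i == m) && (\sum_(i < N.+1) i * f i == w))%N}.

Definition nmon : nat := #|{: wbasis}|.

Definition bmon (x : 'I_nmon) : 'X_{1..N.+1} := [multinom (val (enum_val x) i : nat) | i < N.+1].

Lemma bmonP x : mdeg (bmon x) = m /\ wt (bmon x) = w.
Proof.
have /andP [/eqP h1 /eqP h2] := valP (enum_val x); split.
  by rewrite mdegE -[RHS]h1; apply: eq_bigr => i _; rewrite mnmE.
by rewrite /wt -[RHS]h2; apply: eq_bigr => i _; rewrite mnmE.
Qed.

Lemma bmon_inj : injective bmon.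
Proof.
move=> x y /mnmP e; apply/enum_val_inj/val_inj/ffunP => i; apply: val_inj.
by have := e i; rewrite !mnmE.
Qed.

Lemma bmon_onto y : mdeg y = m -> wt y = w -> exists x, y = bmon x.
Proof.
move=> dy wy; have ylt i : (y i < m.+1)%N by rewrite ltnS -dy mdegE (bigD1 i) //= leq_addr.
pose f : {ffun 'I_N.+1 -> 'I_m.+1} := [ffun i => Ordinal (ylt i)].
have pf : ((\sum_(i < N.+1) f i == m) && (\sum_(i < N.+1) i * f i == w))%N.
  apply/andP; split; apply/eqP; [rewrite -[RHS]dy mdegE|rewrite -[RHS]wy /wt];
  by apply: eq_bigr => i _; rewrite ffunE.
exists (enum_rank (Sub f pf : wbasis)); apply/mnmP => i.
by rewrite mnmE enum_rankK /= ffunE.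
Qed.

Variable F : fieldType.
Local Notation S := {mpoly F[N.+1]}.

Definition vec2poly (c : 'rV[F]_nmon) : S := \sum_x c 0 x *: 'X_[bmon x].
Definition poly2vec (p : S) : 'rV[F]_nmon := \row_x p@_(bmon x).

Lemma vec2polyK c : poly2vec (vec2poly c) = c.
Proof.
apply/rowP => x; rewrite mxE raddf_sum /= (bigD1 x) //= mcoeffZ mcoeffX eqxx mulr1.
rewrite big1 ?addr0 // => y yx; rewrite mcoeffZ mcoeffX (inj_eq bmon_inj).
by rewrite (negbTE yx) mulr0.
Qed.

Lemma poly2vec_eq0 p : wthomog m w p -> poly2vec p = 0 -> p = 0.
Proof.
move=> hp p0; apply/mpolyP => y; rewrite mcoeff0.
have [yp|/memN_msupp_eq0 //] := boolP (y \in msupp p).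
have [dy wy] := hp y yp; have [x ->] := bmon_onto dy wy.
by have /rowP /(_ x) := p0; rewrite !mxE.
Qed.

Lemma wthomog_vec2poly c : wthomog m w (vec2poly c).
Proof.
apply: wthomog_sum => x _; apply: wthomogZ; have [<- <-] := bmonP x; exact: wthomogX.
Qed.

Lemma vec2poly0 : vec2poly 0 = 0.
Proof. by rewrite /vec2poly big1 // => x _; rewrite mxE scale0r. Qed.

Lemma poly2vecK p : wthomog m w p -> vec2poly (poly2vec p) = p.
Proof.
move=> hp; apply/eqP; rewrite -subr_eq0; apply/eqP; apply: poly2vec_eq0.
  by apply: wthomogB => //; exact: wthomog_vec2poly.
apply/rowP => x; rewrite !mxE mcoeffB.
by have /rowP /(_ x) := vec2polyK (poly2vec p); rewrite !mxE => ->; rewrite subrr.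
Qed.
End Bases.

Section MatrixOf.
Variables (F : fieldType) (N1 m1 w1 N2 m2 w2 : nat).
Variable f : {mpoly F[N1.+1]} -> {mpoly F[N2.+1]}.
Hypothesis f_lin : linear f.
Hypothesis f_wthomog : forall p, wthomog m1 w1 p -> wthomog m2 w2 (f p).

Definition mx_of : 'M[F]_(nmon N1 m1 w1, nmon N2 m2 w2) :=
  \matrix_(x, y) (f 'X_[bmon x])@_(bmon y).

Lemma mul_mx_of c : c *m mx_of = poly2vec m2 w2 (f (vec2poly c)).
Proof.
pose fl : {linear {mpoly F[N1.+1]} -> {mpoly F[N2.+1]}} :=
  HB.pack f (GRing.isLinear.Build F _ _ *:%R f f_lin).
have fZ a p : f (a *: p) = a *: f p by exact: (linearZZ fl).
have fS : f (vec2poly c) = \sum_x f (c 0 x *: 'X_[bmon x]) by exact: (linear_sum fl).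
apply/rowP => y; rewrite !mxE fS raddf_sum /=.
by apply: eq_bigr => x _; rewrite mxE fZ mcoeffZ.
Qed.

Lemma vec2poly_mul c : vec2poly (c *m mx_of) = f (vec2poly c).
Proof. by rewrite mul_mx_of poly2vecK //; apply/f_wthomog/wthomog_vec2poly. Qed.
End MatrixOf.

Lemma vec2poly_inj N m w (F : fieldType) : injective (@vec2poly N m w F).
Proof. by move=> c1 c2 e; rewrite -(vec2polyK c1) e vec2polyK. Qed.

Section Dimension.
Variables (F : closedFieldType) (d k' r : nat).
Hypothesis char0 : forall a, a.+1%:R != 0 :> F.
Hypothesis le_rd : (r <= d)%N.
Local Notation k := k'.+1.

(** In degree r the lowering operators are DB on the source of rho and DA on
    its target. As rho is injective and commutes with them, it embeds the
    kernel of DB into that of DA; the latter has the expected dimension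
    because DA is onto. *)
Theorem nmon_growth i : (2 * i < k * d * r)%N ->
  (nmon (k * d) r i.+1 + nmon d (k * r) i <= nmon d (k * r) i.+1 + nmon (k * d) r i)%N.
Proof.
move=> lt.
have linL n : linear (der (@lowc F n)) by move=> c p q; rewrite linearP.
have lin_rho : linear (@rho F d k') by move=> c p q; rewrite rhoD rhoZ.
pose DA := mx_of (k * r) i.+1 (k * r) i (der (@lowc F d)).
pose DB := mx_of r i.+1 r i (der (@lowc F (k * d))).
pose RR := mx_of r i.+1 (k * r) i.+1 (@rho F d k').
have hR w p : wthomog r w p -> wthomog (k * r) w (@rho F d k' p) by exact: wthomog_rho.
have lowA p : wthomog (k * r) i.+1 p -> wthomog (k * r) i (der (@lowc F d) p) by exact: low_wthomog.
have lowB p : wthomog r i.+1 p -> wthomog r i (der (@lowc F (k * d)) p) by exact: low_wthomog.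
have fullA : row_full DA.
  rewrite -sub1mx; apply/row_subP => y; apply/submxP.
  have hG : wthomog (k * r) i (vec2poly (row y 1%:M) : {mpoly F[d.+1]}) by exact: wthomog_vec2poly.
  have lt' : (2 * i < d * (k * r))%N by rewrite mulnCA mulnA.
  have [E hE LE] := lowering_onto char0 hG lt'.
  exists (poly2vec (k * r) i.+1 E); apply: vec2poly_inj.
  by rewrite (vec2poly_mul (linL d) lowA) poly2vecK.
have freeR : row_free RR.
  rewrite -kermx_eq0; apply/eqP/row_matrixP => z; rewrite row0; apply: vec2poly_inj.
  have kz : row z (kermx RR) *m RR = 0 by rewrite -row_mul mulmx_ker row0.
  rewrite vec2poly0.
  have hz := @wthomog_vec2poly (k * d) r i.+1 F (row z (kermx RR)).
  apply: (rho_inj char0 le_rd).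
    by apply/dhomogP => x /hz [].
  by rewrite -(vec2poly_mul lin_rho (hR i.+1)) -/RR kz vec2poly0.
have kerDA : kermx DB *m RR *m DA = 0.
  apply/row_matrixP => z; rewrite row0 (row_mul z (kermx DB *m RR)) (row_mul z (kermx DB)).
  apply: vec2poly_inj.
  rewrite (vec2poly_mul (linL d) lowA) (vec2poly_mul lin_rho (hR i.+1)) rho_low.
  rewrite -(vec2poly_mul (linL (k * d)%N) lowB) -/DB -(row_mul z (kermx DB)) mulmx_ker row0.
  by rewrite !vec2poly0 /rho mmap0.
(* The kernel of DB, mapped injectively by RR, is contained in that of DA. *)
have := mxrankS (introT sub_kermxP kerDA).
rewrite mxrankMfree // !mxrank_ker.
have := rank_leq_col DB; have := rank_leq_row DA; rewrite (eqP fullA).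
by have := rank_leq_row DB; lia.
Qed.
End Dimension.

(** * Gaussian binomials count monomials *)

Lemma nmonE N m w : nmon N m w = (\sum_(f : {ffun 'I_N.+1 -> 'I_m.+1} |
  (\sum_(i < N.+1) f i == m) && (\sum_(i < N.+1) i * f i == w)) 1)%N.
Proof. by rewrite /nmon card_sig sum1_card. Qed.

(** Reversing the order of the variables sends the weight w to N m - w. *)
Lemma nmon_rev N m w : (w <= N * m)%N -> nmon N m w = nmon N m (N * m - w).
Proof.
move=> le; rewrite !nmonE.
pose h (f : {ffun 'I_N.+1 -> 'I_m.+1}) := [ffun i => f (rev_ord i)].
have h_inj : injective h.
  move=> f g /ffunP e; apply/ffunP => i; have := e (rev_ord i).
  by rewrite !ffunE rev_ordK.
rewrite (reindex_inj h_inj) /=; apply: eq_bigl => f.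
have -> : (\sum_(i < N.+1) h f i = \sum_(i < N.+1) f i)%N.
  rewrite [RHS](reindex_inj rev_ord_inj) /=.
  by apply: eq_bigr => i _; rewrite ffunE.
have [sf|] //= := eqVneq (\sum_(i < N.+1) f i)%N m.
have E : (\sum_(i < N.+1) i * h f i + \sum_(i < N.+1) i * f i = N * m)%N.
  transitivity (N * \sum_(i < N.+1) f i)%N; last by rewrite sf.
  rewrite [X in (X + _)%N](reindex_inj rev_ord_inj) -big_split /= big_distrr /=.
  apply: eq_bigr => i _; rewrite ffunE rev_ordK -mulnDl; congr (_ * _)%N.
  by have := ltn_ord i; rewrite subSS; lia.
move: E; move: (\sum_(i < N.+1) i * h f i)%N (\sum_(i < N.+1) i * f i)%N => A B E.
by apply/eqP/eqP => e; lia.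
Qed.

Lemma nmon_out N m w : (N * m < w)%N -> nmon N m w = 0%N.
Proof.
move=> lt; rewrite nmonE big1 // => f /andP [/eqP sf /eqP wf].
suff : (w <= N * m)%N by rewrite leqNgt lt.
apply: (@leq_trans (N * \sum_(i < N.+1) f i)%N); last by rewrite sf.
rewrite -wf big_distrr /=; apply: leq_sum => i _.
by rewrite leq_mul2r -ltnS ltn_ord orbT.
Qed.

Section GaussianGenerating.
Local Notation Z2 := {poly {poly int}}.

Definition qfact m : {poly int} := \prod_(i < m) qint i.+1.

Lemma qfactS m : qfact m.+1 = qfact m * qint m.+1.
Proof. by rewrite /qfact big_ord_recr. Qed.

Lemma qintD a b : qint (a + b) = qint a + 'X^a * qint b.
Proof.
rewrite /qint big_split_ord /= mulr_sumr; congr (_ + _).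
by apply: eq_bigr => i _; rewrite exprD.
Qed.

Lemma qint_coef0 m : (qint m.+1)`_0 = 1.
Proof.
rewrite /qint big_ord_recl coefD expr0 coef1 coef_sum big1 ?addr0 // => i _.
by rewrite coefXn.
Qed.

Lemma qfact_coef0 m : (qfact m)`_0 = 1.
Proof.
elim: m => [|m IH]; first by rewrite /qfact big_ord0 coef1.
by rewrite qfactS coef0M IH qint_coef0 mulr1.
Qed.

Lemma qint_monic m : qint m.+1 \is monic.
Proof.
have -> : qint m.+1 = \poly_(i < m.+1) 1.
  by rewrite poly_def; apply: eq_bigr => i _; rewrite scale1r.
by rewrite monicE lead_coef_poly ?oner_eq0.
Qed.

Lemma qfact_monic m : qfact m \is monic.
Proof. by apply: monic_prod => i _; exact: qint_monic. Qed.

(** The generating function of monomials in N variables, truncated at exponent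
    B - 1 in each variable: the exponent of the outer variable is the degree,
    that of the inner one the weight. *)
Definition hgen N B : Z2 := \prod_(i < N) \sum_(t < B) ('X^i *: 'X) ^+ t.

Lemma hgen_expand N B : hgen N B = \sum_(f : {ffun 'I_N -> 'I_B})
  'X^(\sum_(i < N) i * f i) *: 'X^(\sum_(i < N) f i).
Proof.
rewrite /hgen bigA_distr_bigA; apply: eq_bigr => f _ /=.
rewrite (eq_bigr (fun i : 'I_N => 'X^(i * f i) *: 'X^(f i))); last first.
  by move=> i _; rewrite exprZn -exprM.
by rewrite scaler_prod !prodrXr.
Qed.

Lemma hgen_nmon N m w : ((hgen N.+1 m.+1)`_m)`_w = (nmon N m w)%:R.
Proof.
rewrite hgen_expand !coef_sum nmonE natr_sum [RHS]big_mkcond; apply: eq_bigr => f _.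
rewrite coefZ coefXn eq_sym; case: eqP => _ /=; last by rewrite mulr0 coef0.
by rewrite mulr1 coefXn eq_sym; case: eqP.
Qed.

(** The last factor is a truncated geometric series, and the truncation is not
    felt in degrees less than B. *)
Lemma hgen_rec N B m : (m < B)%N -> (hgen N.+1 B)`_m =
  (hgen N B)`_m + (if m is m'.+1 then 'X^N * (hgen N.+1 B)`_m' else 0).
Proof.
move=> mB; pose u : Z2 := 'X^N *: 'X.
have E : hgen N.+1 B - hgen N.+1 B * u = hgen N B - hgen N B * u ^+ B.
  have geo : (1 - u) * (\sum_(t < B) u ^+ t) = 1 - u ^+ B.
    rewrite -[1 - u ^+ B]opprB subrX1 -[u - 1]opprB mulNr opprK; congr (_ * _).
  rewrite -[X in X - _]mulr1 -mulrBr /hgen big_ord_recr /= -/(hgen N B) -/u.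
  by rewrite -mulrA [(\sum_(t < B) _) * _]mulrC geo mulrBr mulr1.
have := congr1 (fun p : Z2 => p`_m) E; rewrite !coefB.
have -> : (hgen N B * u ^+ B)`_m = 0.
  by rewrite /u exprZn -scalerAr coefZ coefMXn mB mulr0.
rewrite subr0 => /eqP; rewrite subr_eq => /eqP ->; congr (_ + _).
rewrite /u -scalerAr coefZ coefMX; case: m {mB E} => [|m] //=.
by rewrite mulr0.
Qed.

(** Both sides satisfy the q-Pascal recursion. *)
Lemma hgen_fact N B m : (m < B)%N ->
  (hgen N.+1 B)`_m * (qfact N * qfact m) = qfact (N + m).
Proof.
have h0 M : (0 < B)%N -> (hgen M B)`_0 = 1.
  move=> B0; elim: M => [|M IH]; first by rewrite /hgen big_ord0 coef1.
  by rewrite hgen_rec // IH addr0.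
elim: N m => [|N IHN] m mB.
  have -> : (hgen 1 B)`_m = 1.
    elim: m mB => [|m IH] mB; first exact: h0.
    by rewrite hgen_rec // IH ?(ltnW mB) // /hgen big_ord0 coef1 add0r expr0 mul1r.
  by rewrite /qfact big_ord0 !mul1r.
elim: m mB => [|m IHm] mB.
  by rewrite h0 // mul1r addn0 {2}/qfact big_ord0 mulr1.
rewrite hgen_rec // mulrDl.
have E1 := IHN m.+1 mB; have E2 := IHm (ltnW mB).
have -> : (hgen N.+1 B)`_m.+1 * (qfact N.+1 * qfact m.+1) = qfact (N + m.+1) * qint N.+1.
  by rewrite -E1 qfactS; ring.
have -> : 'X^(N.+1) * (hgen N.+2 B)`_m * (qfact N.+1 * qfact m.+1) =
    qfact (N.+1 + m) * ('X^(N.+1) * qint m.+1).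
  by rewrite -E2 (qfactS m); ring.
by rewrite -addSnnS -mulrDr -qintD !addnS qfactS.
Qed.
End GaussianGenerating.

Lemma prod_qint_rev c : \prod_(i < c) qint (c - i) = qfact c.
Proof.
rewrite /qfact (reindex_inj rev_ord_inj) /=; apply: eq_bigr => i _.
by rewrite subKn.
Qed.

Lemma prod_qint_top c N : (\prod_(i < c) qint (c + N - i)) * qfact N = qfact (c + N).
Proof.
elim: c => [|c IH]; first by rewrite big_ord0 mul1r.
rewrite big_ord_recl subn0 -mulrA addSn qfactS -IH mulrC; congr (_ * _).
Qed.

(** The coefficient of the generating function times the q-factorial of m is
    the numerator, and the q-factorial is monic, so the division is exact. *)
Lemma qbinomE N m : qbinom (m + N) m = (hgen N.+1 m.+1)`_m.
Proof.
rewrite /qbinom prod_qint_rev.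
have -> : \prod_(i < m) qint (m + N - i) = (hgen N.+1 m.+1)`_m * qfact m.
  apply: (mulIf (monic_neq0 (qfact_monic N))).
  by rewrite prod_qint_top -mulrA [qfact m * _]mulrC hgen_fact // addnC.
by rewrite (Pdiv.IdomainMonic.mulpK (qfact_monic m)).
Qed.

Lemma qbinom_sym N m : qbinom (m + N) m = qbinom (m + N) N.
Proof.
rewrite qbinomE [in RHS]addnC qbinomE.
have nz : qfact N * qfact m != 0 by rewrite mulf_neq0 ?monic_neq0 ?qfact_monic.
apply: (mulIf nz); rewrite hgen_fact //.
by rewrite [qfact N * _]mulrC hgen_fact // addnC.
Qed.

(** The difference r is palindromic, starts at 0 and increases up to the
    middle. *)
Lemma unimodal_of_growth (p q : {poly int}) T :
  (forall i, (2 * i < T)%N -> q`_i.+1 + p`_i <= p`_i.+1 + q`_i) ->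
  (forall i, (i <= T)%N -> p`_i = p`_(T - i)) ->
  (forall i, (i <= T)%N -> q`_i = q`_(T - i)) ->
  (forall i, (T < i)%N -> p`_i = 0) -> (forall i, (T < i)%N -> q`_i = 0) ->
  p`_0 = q`_0 -> unimodal (p - q).
Proof.
move=> grow ps qs pout qout pq0; pose r := p - q.
have rs i : (i <= T)%N -> r`_i = r`_(T - i) by move=> le; rewrite !coefB -ps // -qs.
have rout i : (T < i)%N -> r`_i = 0 by move=> lt; rewrite coefB pout // qout // subrr.
have rg i : (2 * i < T)%N -> r`_i <= r`_i.+1.
  move=> lt; have := grow i lt; rewrite -subr_ge0 => g; rewrite -subr_ge0 !coefB.
  by rewrite [leRHS](_ : _ = p`_i.+1 + q`_i - (q`_i.+1 + p`_i)) //; ring.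
have r0 : r`_0 = 0 by rewrite coefB pq0 subrr.
have rd i : (T <= 2 * i)%N -> r`_i.+1 <= r`_i.
  move=> le; case: (ltngtP i T) => [iT|iT|iT].
  - rewrite rs // [in leRHS]rs ?(ltnW iT) // (_ : (T - i = (T - i.+1).+1)%N); last by lia.
    apply: rg; lia.
  - by rewrite !rout // ltnW.
  - by rewrite rout ?iT // rs ?iT // subnn r0.
have rnn i : (2 * i <= T.+1)%N -> 0 <= r`_i.
  elim: i => [|i IH] le; first by rewrite r0.
  by apply: le_trans (rg i _); [apply: IH|]; lia.
split.
  apply/polyOverP => i; rewrite nnegrE -/r.
  have [iT|Ti] := leqP i T; last by rewrite rout.
  have [le|gt] := leqP (2 * i) T.+1; first exact: rnn.
  by rewrite rs //; apply: rnn; lia.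
(* The last index at which the sequence may still be increasing precedes the
   half of T + 1. *)
exists (T.+1)./2; split=> i hi; [apply: rg|apply: rd]; lia.
Qed.

Lemma unimodal_divisible a d k' : (0 < a)%N -> (a <= d)%N ->
  unimodal (qbinom (k'.+1 * a + d) (k'.+1 * a) - qbinom (a + k'.+1 * d) a).
Proof.
move=> a0 ad; pose k := k'.+1; rewrite !qbinomE.
have char0 m : m.+1%:R != 0 :> algC by rewrite pnatr_eq0.
have eT : (d * (k * a) = k * d * a)%N by rewrite mulnCA mulnA.
apply: (@unimodal_of_growth _ _ (k * d * a)%N).
- move=> i lt; rewrite !hgen_nmon -!natrD ler_nat.
  exact: (nmon_growth (F := algC) char0 ad lt).
- by move=> i le; rewrite !hgen_nmon nmon_rev eT.
- by move=> i le; rewrite !hgen_nmon nmon_rev.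
- by move=> i lt; rewrite hgen_nmon nmon_out // eT.
- by move=> i lt; rewrite hgen_nmon nmon_out.
have c0 N m : ((hgen N.+1 m.+1)`_m)`_0 = 1.
  have := congr1 (fun p : {poly int} => p`_0) (hgen_fact N (ltnSn m)).
  by rewrite !coef0M !qfact_coef0 !mulr1.
by rewrite !c0.
Qed.

Theorem corollary1p6 (a b c d : nat)
  (ha : (0 < a)%N) (hb : (0 < b)%N) (hc : (0 < c)%N) (hd : (0 < d)%N)
  (habcd : (a * b = c * d)%N)
  (hmin : a = minn a (minn b (minn c d)))
  (hdvd : (a %| c)%N \/ (a %| d)%N) :
  unimodal (qbinom (c + d) c - qbinom (a + b) a).
Proof.
have [ac ad] : (a <= c)%N /\ (a <= d)%N by lia.
case: hdvd => /dvdnP [[|k] kE].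
- by rewrite kE in hc.
- have -> : b = (k.+1 * d)%N.
    by apply/eqP; rewrite -(eqn_pmul2l ha) habcd kE -mulnA mulnCA.
  by rewrite kE; apply: unimodal_divisible.
- by rewrite kE in hd.
have -> : b = (k.+1 * c)%N.
  by apply/eqP; rewrite -(eqn_pmul2l ha) habcd kE mulnC -mulnA mulnCA.
by rewrite [(c + d)%N]addnC -qbinom_sym kE; apply: unimodal_divisible.
Qed.
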